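(* Let $A\in\mathbb{R}^{n\times n}$, $B_1,B_2,B_3,B_4\in\mathbb{R}^{n\times 1}$, $\alpha>0$, $\beta>0$. Assume that $\sigma(A)\cap\sigma(\mathbb{A}_1)=\varnothing$ and that the pair $\big(A,\;AB_2+B_1+(\cosh A)(AB_4+B_3)\big)$ is controllable. Let $L_1,L_2:[0,1]\to\mathbb{R}^n$ and $L_3,L_4\in\mathbb{R}^n$ be given by the formulas in the context, and let $K\in\mathbb{R}^{n}$ be a column vector such that $A+L_2(1)K^T$ is Hurwitz. Then the closed-loop system $$ \left\{\begin{array}{l} \dot X(t)=AX(t)+B_1w(0,t)+B_2w_t(0,t)+B_3w(1,t)+B_4w_t(1,t),\quad t>0,\\ w_{tt}(x,t)=w_{xx}(x,t),\quad x\in(0,1),\ t>0,\\ w_x(0,t)=0,\quad t\ge 0,\\ w_x(1,t)=-\alpha w(1,t)-\beta w_t(1,t)+K^T\Big[X(t)+L_3w(0,t)+L_4w(1,t)\\ \qquad\qquad+\int_0^1L_1(x)w(x,t)\,dx+\int_0^1L_2(x)w_t(x,t)\,dx\Big],\quad t\ge 0, \end{array}\right. $$ with state $(X(t),w(\cdot,t),w_t(\cdot,t))$ in $\mathbb{R}^n\times\mathbb{H}_1$, is exponentially stable.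
   Context: $\mathbb{H}_1=H^1(0,1)\times L^2(0,1)$ with norm $\|(f,g)\|_{\mathbb{H}_1}^2=\int_0^1[|f'(x)|^2+|g(x)|^2]\,dx+\alpha|f(1)|^2$. The operator $\mathbb{A}_1$ on $\mathbb{H}_1$ is $\mathbb{A}_1(f,g)=(g,f'')$ with domain $D(\mathbb{A}_1)=\{(f,g)\in H^2(0,1)\times H^1(0,1): f'(0)=0,\ f'(1)=-\alpha f(1)-\beta g(1)\}$. $\sigma(\cdot)$ denotes the spectrum (over $\mathbb{C}$). $\mathcal{G}$ is the entire function $\mathcal{G}(z)=\sinh(z)/z$ for $z\ne0$, $\mathcal{G}(0)=1$; entire functions of matrices are defined by power series. The gains are $$L_2(x)=-x\mathcal{G}(Ax)(AB_2+B_1)+(\cosh Ax)Q,\qquad L_1(x)=-(\sinh Ax)(AB_2+B_1)+A(\cosh Ax)Q,$$ $$L_3=-B_2,\qquad L_4=-\beta\mathcal{G}(A)(AB_2+B_1)+\beta(\cosh A)Q-B_4,$$ $$Q=[A\sinh A+(\alpha+\beta A)\cosh A]^{-1}\big\{AB_4+B_3+[\cosh A+(\alpha+\beta A)\mathcal{G}(A)](AB_2+B_1)\big\}$$ (the matrix being inverted is invertible when $\sigma(A)\cap\sigma(\mathbb{A}_1)=\varnothing$). A matrix is Hurwitz if all its eigenvalues have negative real part. Solutions are understood in the mild (semigroup) sense; exponentially stable means that the norm of the state in $\mathbb{R}^n\times\mathbb{H}_1$ is bounded by $Me^{-\omega t}$ times the norm of the initial state for all $t\ge 0$, with constants $M,\omega>0$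 independent of the initial state. *)

(* Defs.v *)
From HB Require Import structures.
From mathcomp Require Import all_boot all_order all_algebra.
From mathcomp Require Import generic_quotient ring_quotient complex.
From mathcomp Require Import all_classical all_reals all_analysis.
From mathcomp Require Import measurable_realfun ring lra.

Set Implicit Arguments.
Unset Strict Implicit.
Unset Printing Implicit Defensive.

Import Order.TTheory GRing.Theory Num.Theory.
Import numFieldNormedType.Exports.

Local Open Scope classical_set_scope.
Local Open Scope quotient_scope.
Local Open Scope ring_scope.

Section L2.
Context (R : realType).
Local Notation mu := (@lebesgue_measure R).

(* Endpoints are Lebesgue-null, so [0,1] and (0,1) give the same L^2 space.
   Values outside [0,1] are irrelevant: they are ignored by the quotient. *)
Definition sq_integrable : {pred R -> R} := fun f =>
  `[< measurable_fun (`[0%R, 1%R] : set (measurableTypeR R)) f /\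
      mu.-integrable `[0%R, 1%R] (fun x => (f x ^+ 2)%:E) >].

Lemma sq_integrable_submod_closed : submod_closed sq_integrable.
Proof.
split=> [|a f g /asboolP[mf if2] /asboolP[mg ig2]]; apply/asboolP; split.
- exact: measurable_cst.
- have -> : (fun x : R => (((0 : R -> R) x) ^+ 2)%:E) = cst 0%E.
    by apply/funext => x; rewrite expr0n.
  exact: integrable0.
- apply: measurable_funD => //; exact: measurable_funM.
- have i2 : mu.-integrable `[0%R, 1%R]
      (fun x => ((2 * a ^+ 2)%:E * (f x ^+ 2)%:E + 2%:E * (g x ^+ 2)%:E)%E).
    by apply: integrableD => //; exact: integrableZl.
  apply: le_integrable i2 => //.
    apply/measurable_EFinP; apply: measurable_funX.
    apply: measurable_funD => //; exact: measurable_funM.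
  move=> x _; rewrite /= lee_fin ger0_norm ?sqr_ge0// ler_normr; apply/orP; left.
  rewrite (_ : (a *: f + g) x = a * f x + g x)//.
  have := sqr_ge0 (a * f x - g x); lra.
Qed.

HB.instance Definition _ := GRing.isSubmodClosed.Build R (R -> R) sq_integrable
  sq_integrable_submod_closed.

Record L2fun := MkL2fun { L2fun_val :> R -> R; _ : L2fun_val \in sq_integrable }.

HB.instance Definition _ := [isSub for L2fun_val].
HB.instance Definition _ := [Choice of L2fun by <:].
HB.instance Definition _ := [SubChoice_isSubLmodule of L2fun by <:].

Definition ae01 (P : R -> Prop) : Prop :=
  {ae mu, forall x, x \in `[0%R, 1%R] -> P x}.

Lemma ae01W (P : R -> Prop) : (forall x, P x) -> ae01 P.
Proof. by move=> PT; apply: aeW => x _; exact: PT. Qed.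

Lemma ae01S (P Q : R -> Prop) : (forall x, P x -> Q x) -> ae01 P -> ae01 Q.
Proof.
move=> PQ; apply: (@filterS _ _ (ae_filter_ringOfSetsType mu)) => x Px x01.
exact: PQ (Px x01).
Qed.

Lemma ae01I (P Q : R -> Prop) : ae01 P -> ae01 Q -> ae01 (fun x => P x /\ Q x).
Proof.
apply: (@filterS2 _ _ (ae_filter_ringOfSetsType mu)) => x Px Qx x01.
by split; [exact: Px|exact: Qx].
Qed.

Definition L2null : {pred L2fun} := fun f => `[< ae01 (fun x => f x = 0) >].

Lemma L2null_zmod_closed : zmod_closed L2null.
Proof.
split=> [|f g]; first by apply/asboolP; apply: ae01W.
move=> /asboolP f0 /asboolP g0; apply/asboolP.
by apply: ae01S (ae01I f0 g0) => x [fx gx]; rewrite /= !fctE fx gx subrr.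
Qed.

HB.instance Definition _ :=
  GRing.isZmodClosed.Build L2fun L2null L2null_zmod_closed.

Definition L2 : Type := Quotient.quot L2null.

HB.instance Definition _ := GRing.Zmodule.on L2.
HB.instance Definition _ := EqQuotient.on L2.

Definition L2_fun (f : L2) : R -> R := (repr f : L2fun).
Definition L2_scale (a : R) (f : L2) : L2 := \pi_L2 (a *: (repr f : L2fun)).

Lemma L2null_scale a (f : L2fun) : f \in L2null -> a *: f \in L2null.
Proof.
move=> /asboolP f0; apply/asboolP.
by apply: ae01S f0 => x fx; rewrite /= fctE fx scaler0.
Qed.

Lemma L2_piE (f g : L2fun) : (\pi_L2 f = \pi_L2 g) <-> f - g \in L2null.
Proof. rewrite Quotient.idealrBE; exact: (rwP eqP). Qed.

Lemma L2_piZ a (f : L2fun) : \pi_L2 (a *: f) = L2_scale a (\pi_L2 f).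
Proof.
apply/L2_piE; rewrite -scalerBr; apply: L2null_scale.
by apply/L2_piE; rewrite reprK.
Qed.

Lemma L2_piD (f g : L2fun) : \pi_L2 (f + g) = \pi_L2 f + \pi_L2 g.
Proof. exact: Quotient.pi_add. Qed.

Fact L2_scaleA a b v : L2_scale a (L2_scale b v) = L2_scale (a * b) v.
Proof.
by elim/quotW: v => f; rewrite -(L2_piZ b f) -(L2_piZ a) -(L2_piZ _ f) scalerA.
Qed.

Fact L2_scale1 : left_id 1 L2_scale.
Proof. by elim/quotW => f; rewrite -L2_piZ scale1r. Qed.

Fact L2_scaleDr : right_distributive L2_scale +%R.
Proof.
move=> a; elim/quotW => f; elim/quotW => g.
by rewrite -L2_piD -(L2_piZ a f) -(L2_piZ a g) -(L2_piZ a) -L2_piD scalerDr.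
Qed.

Fact L2_scaleDl v : {morph L2_scale^~ v : a b / a + b}.
Proof.
move=> a b; elim/quotW: v => f.
by rewrite -(L2_piZ a f) -(L2_piZ b f) -(L2_piZ _ f) -L2_piD scalerDl.
Qed.

HB.instance Definition _ := GRing.Zmodule_isLmodule.Build R L2
  L2_scaleA L2_scale1 L2_scaleDr L2_scaleDl.

End L2.

Coercion L2_fun : L2 >-> Funclass.

Section L2_pointwise.
Context (R : realType).
Local Notation mu := (@lebesgue_measure R).
Implicit Types (f g : L2 R) (a : R).

Lemma L2_pi_ae (f : L2fun R) : ae01 (fun x => L2_fun (\pi_(L2 R) f) x = f x).
Proof.
have : \pi_(L2 R) (repr (\pi_(L2 R) f)) = \pi_(L2 R) f by rewrite reprK.
move=> /L2_piE/asboolP; apply: ae01S => x.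
by rewrite /= !fctE => /eqP; rewrite subr_eq0 => /eqP.
Qed.

Lemma L2_linE a f g : ae01 (fun x => L2_fun (a *: f + g) x = a * f x + g x).
Proof.
have hD := L2_pi_ae (a *: repr f + repr g).
have hZ := L2_pi_ae (a *: repr f).
by rewrite L2_piD L2_piZ !reprK in hD.
Qed.

Lemma L2_zeroE : ae01 (fun x => L2_fun (0 : L2 R) x = 0).
Proof.
have := L2_linE (-1) 0 0; rewrite scaler0 addr0.
by apply: ae01S => x ->; rewrite mulN1r addNr.
Qed.

Lemma L2_measurable f : measurable_fun (`[0%R, 1%R] : set (measurableTypeR R)) f.
Proof. by have /asboolP[] := valP (repr f). Qed.

Lemma L2_integrable f : mu.-integrable `[0%R, 1%R] (EFin \o f).
Proof.
have /asboolP[mf if2] := valP (repr f).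
have i1 : mu.-integrable `[0%R, 1%R]
    (fun x => ((L2_fun f x ^+ 2)%:E + (cst 1%:E) x)%E).
  apply: integrableD => //; apply/integrableP; split => //.
  under eq_integral do rewrite /= normr1.
  rewrite integral_cst// mul1e.
  have h : (mu `[0%R, 1%R] < +oo)%E.
    by rewrite lebesgue_measure_itv/= lte_fin ltr01 -EFinB ltry.
  exact: h.
apply: le_integrable i1 => //; first exact/measurable_EFinP.
move=> x _; rewrite /= lee_fin [leRHS]ger0_norm; last first.
  by rewrite addr_ge0// sqr_ge0.
have := sqr_ge0 (L2_fun f x - 1); have := sqr_ge0 (L2_fun f x + 1).
rewrite ler_norml; nra.
Qed.

End L2_pointwise.

Section H1.
Context (R : realType).
Local Notation mu := (@lebesgue_measure R).
Implicit Types (f g d e : L2 R) (u v : R -> R).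

(* f is represented a.e. by the function u, which is absolutely continuous on
   [0,1] with derivative d; the values of u outside [0,1] are irrelevant. *)
Definition ac_rep f u d :=
  ae01 (fun x => f x = u x) /\
  forall x, 0 <= x <= 1 -> u x = u 0 + \int[mu]_(t in `[0, x]) d t.

Definition H1_pred : {pred L2 R} := fun f => `[< exists u d, ac_rep f u d >].

Lemma int01_lin a d e x : 0 <= x <= 1 ->
  \int[mu]_(t in `[0, x]) L2_fun (a *: d + e) t =
  a * (\int[mu]_(t in `[0, x]) d t) + \int[mu]_(t in `[0, x]) e t.
Proof.
move=> /andP[x0 x1].
have sub : `[0, x] `<=` `[0%R, 1%R].
  by apply: subset_itvl; rewrite bnd_simp.
have i f : mu.-integrable `[0, x] (EFin \o f).
  exact: integrableS (L2_integrable f).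
have iad : mu.-integrable `[0, x] (EFin \o (fun t => a * d t)).
  exact: integrableZl (i d).
rewrite -RintegralZl// -RintegralD//.
congr fine; apply: ae_eq_integral => //.
- by have /integrableP[] := i (a *: d + e).
- have /integrableP[/measurable_EFinP md _] := iad.
  have /integrableP[/measurable_EFinP me _] := i e.
  by apply/measurable_EFinP; exact: measurable_funD.
apply: (@filterS _ _ (ae_filter_ringOfSetsType mu)) (L2_linE a d e).
move=> t h /sub t01.
by rewrite h//; exact/mem_set.
Qed.

Lemma ac_rep_lin a f g u v d e : ac_rep f u d -> ac_rep g v e ->
  ac_rep (a *: f + g) (fun x => a * u x + v x) (a *: d + e).
Proof.
move=> [fu uE] [gv vE]; split.
  by apply: ae01S (ae01I (L2_linE a f g) (ae01I fu gv)) => x [-> [-> ->]].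
move=> x x01; rewrite uE// vE// int01_lin//; ring.
Qed.

Lemma H1_submod_closed : submod_closed H1_pred.
Proof.
split=> [|a f g /asboolP[u [d fu]] /asboolP[v [e gv]]]; apply/asboolP; last first.
  by exists (fun x => a * u x + v x), (a *: d + e); exact: ac_rep_lin.
exists (fun=> 0), 0; split=> [|x x01]; first exact: L2_zeroE.
have := int01_lin (-1) 0 0 x01; rewrite scaler0 add0r mulN1r addNr => ->.
by rewrite addr0.
Qed.

HB.instance Definition _ :=
  GRing.isSubmodClosed.Build R (L2 R) H1_pred H1_submod_closed.

Record H1 := MkH1 { H1_val : L2 R; _ : H1_val \in H1_pred }.

HB.instance Definition _ := [isSub for H1_val].
HB.instance Definition _ := [Choice of H1 by <:].
HB.instance Definition _ := [SubChoice_isSubLmodule of H1 by <:].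

Lemma H1_repP (w : H1) : exists ud : (R -> R) * L2 R, ac_rep (H1_val w) ud.1 ud.2.
Proof. by case: w => f /= /asboolP[u [d fud]]; exists (u, d). Qed.

(* The continuous representative on [0,1] (used for traces) and the weak
   derivative; ac_rep determines the former on [0,1] and the latter in L^2. *)
Definition H1_fun (w : H1) : R -> R := (projT1 (cid (H1_repP w))).1.
Definition weak_deriv (w : H1) : L2 R := (projT1 (cid (H1_repP w))).2.

End H1.

Coercion H1_fun : H1 >-> Funclass.

(* Unbounded operators are given by their graphs: A z y means that z is in the
   domain of A and that y is its image. The norm N is explicit because the product
   spaces below carry an energy norm and not the maximum norm. *)

Section Spectrum.
Context (R : realType) (V : lmodType R).
Implicit Types (N : V -> R) (A : V -> V -> Prop) (l : R[i]) (z y : V * V).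

(* The complexification of V is V * V, with (u, v) standing for u + i v. *)
Definition cplx_scale l z : V * V :=
  (complex.Re l *: z.1 - complex.Im l *: z.2,
   complex.Im l *: z.1 + complex.Re l *: z.2).

Definition cplx_norm N z : R := Num.sqrt (N z.1 ^+ 2 + N z.2 ^+ 2).

Definition cplx_op A z y : Prop := A z.1 y.1 /\ A z.2 y.2.

Definition in_resolvent N A l : Prop :=
  (forall y, exists! z, exists2 Az, cplx_op A z Az & cplx_scale l z - Az = y) /\
  (exists C : R, forall z Az, cplx_op A z Az ->
     cplx_norm N z <= C * cplx_norm N (cplx_scale l z - Az)).

Definition spectrum N A l : Prop := ~ in_resolvent N A l.

End Spectrum.

Section Semigroup.
Context (R : realType) (V : lmodType R).
Implicit Types (N : V -> R) (A : V -> V -> Prop) (T : R -> V -> V).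

Definition bounded_linear N (f : V -> V) : Prop :=
  linear f /\ exists C : R, forall z, N (f z) <= C * N z.

Definition c0_semigroup N T : Prop :=
  [/\ forall t, 0 <= t -> bounded_linear N (T t),
      forall z, T 0 z = z,
      forall s t, 0 <= s -> 0 <= t -> forall z, T (s + t) z = T s (T t z) &
      forall z, N (T t z - z) @[t --> 0^'+] --> (0 : R)].

Definition generator N T : V -> V -> Prop := fun z y =>
  N (t^-1 *: (T t z - z) - y) @[t --> 0^'+] --> (0 : R).

(* A generator determines its semigroup, so this says that z' = A z is
   well-posed and that its mild solutions t |-> T t z0 decay uniformly. *)
Definition exponentially_stable N A : Prop :=
  exists T, [/\ c0_semigroup N T,
    forall z y, generator N T z y <-> A z y &
    exists M omega : R, [/\ 0 < M, 0 < omega &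
      forall z0 t, 0 <= t -> N (T t z0) <= M * expR (- (omega * t)) * N z0]].

End Semigroup.

Section Matrices.
Context (R : realType) (n : nat).
Implicit Types (A : 'M[R]_n) (b : 'cV[R]_n).

Definition entire_mx (c : nat -> R) A : 'M[R]_n :=
  limn (series (fun k => c k *: A ^+ k)).

Definition cosh_mx := entire_mx (fun k => if odd k then 0 else (k`!%:R)^-1).
Definition sinh_mx := entire_mx (fun k => if odd k then (k`!%:R)^-1 else 0).

(* sinh z / z is the sum over even k of z^k / (k+1)! *)
Definition sinhc_mx := entire_mx (fun k => if odd k then 0 else (k.+1`!%:R)^-1).

Definition mx_spectrum A (l : R[i]) : Prop :=
  eigenvalue (map_mx (real_complex R) A) l.

Definition hurwitz A : Prop := forall l, mx_spectrum A l -> complex.Re l < 0.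

(* Every state can be steered to every other one by X' = A X + u b. *)
Definition controllable A b : Prop :=
  forall X0 X1 : 'cV[R]_n, exists (tau : R) (u : R -> R) (X : R -> 'cV[R]_n),
    [/\ 0 < tau, continuous u, X 0 = X0, X tau = X1 &
        forall t : R, is_derive t (1 : R) X (A *m X t + u t *: b)].

End Matrices.

Section System.
Context (R : realType) (n : nat) (alpha beta : R).
Local Notation mu := (@lebesgue_measure R).

Local Notation wave_state := (H1 R * L2 R)%type.

Definition wave_norm (z : wave_state) : R :=
  Num.sqrt (\int[mu]_(x in `[0, 1]) (weak_deriv z.1 x ^+ 2 + z.2 x ^+ 2)
            + alpha * z.1 1 ^+ 2).

(* The common part of the wave operators, (f, g) |-> (g, f'') on
   {(f, g) in H^2 x H^1 : f'(0) = 0, f'(1) = - alpha f(1) - beta g(1) + r};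
   p is f' as an element of H^1, and the first component of y is g. *)
Definition wave_graph (r : R) (z y : wave_state) : Prop :=
  H1_val y.1 = z.2 /\
  exists p : H1 R,
    [/\ H1_val p = weak_deriv z.1, y.2 = weak_deriv p, p 0 = 0 &
        p 1 = - alpha * z.1 1 - beta * y.1 1 + r].

Definition A1_op : wave_state -> wave_state -> Prop := wave_graph 0.

Variables (A : 'M[R]_n) (B1 B2 B3 B4 : 'cV[R]_n).

Definition gain_Q : 'cV[R]_n :=
  invmx (A *m sinh_mx A + (alpha%:M + beta *: A) *m cosh_mx A) *m
  (A *m B4 + B3 +
   (cosh_mx A + (alpha%:M + beta *: A) *m sinhc_mx A) *m (A *m B2 + B1)).

Definition gain_L1 (x : R) : 'cV[R]_n :=
  - (sinh_mx (x *: A) *m (A *m B2 + B1)) + A *m cosh_mx (x *: A) *m gain_Q.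

Definition gain_L2 (x : R) : 'cV[R]_n :=
  - (x *: (sinhc_mx (x *: A) *m (A *m B2 + B1))) + cosh_mx (x *: A) *m gain_Q.

Definition gain_L3 : 'cV[R]_n := - B2.

Definition gain_L4 : 'cV[R]_n :=
  - (beta *: (sinhc_mx A *m (A *m B2 + B1))) + beta *: (cosh_mx A *m gain_Q) - B4.

Local Notation state := ('cV[R]_n * wave_state)%type.

Definition state_norm (z : state) : R :=
  Num.sqrt (\sum_(i < n) z.1 i 0 ^+ 2 + wave_norm z.2 ^+ 2).

Definition feedback (K : 'cV[R]_n) (z : state) : R :=
  let: (X, (w, v)) := z in
  (K^T *m (X + w 0 *: gain_L3 + w 1 *: gain_L4
           + \col_i (\int[mu]_(x in `[0, 1]) (gain_L1 x i 0 * w x))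
           + \col_i (\int[mu]_(x in `[0, 1]) (gain_L2 x i 0 * v x)))) 0 0.

(* On the graph, the first wave component of y is w_t, so that its traces give
   w_t(0, t) and w_t(1, t). *)
Definition closed_loop (K : 'cV[R]_n) (z y : state) : Prop :=
  let w := z.2.1 in let wt := y.2.1 in
  y.1 = A *m z.1 + w 0 *: B1 + wt 0 *: B2 + w 1 *: B3 + wt 1 *: B4 /\
  wave_graph (feedback K z) z.2 y.2.

End System.

(* Main.v *)
From HB Require Import structures.
From mathcomp Require Import all_boot all_order all_algebra.
From mathcomp Require Import generic_quotient ring_quotient complex.
From mathcomp Require Import all_classical all_reals all_analysis.
From mathcomp Require Import measurable_realfun ring lra.
Require Import Defs.

Set Implicit Arguments.
Unset Strict Implicit.
Unset Printing Implicit Defensive.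

Import Order.TTheory GRing.Theory Num.Theory.
Import numFieldNormedType.Exports.

Local Open Scope classical_set_scope.
Local Open Scope quotient_scope.
Local Open Scope ring_scope.

(* With Lam(w, w_t) = L3 w(0) + L4 w(1) + int L1 w + int L2 w_t, the gains are such
   that Y = X + Lam(w, w_t) solves the finite-dimensional equation
   Y' = (A + L2(1) K^T) Y, while w solves the damped wave equation driven at x = 1
   by the feedback u = K^T Y, which decays exponentially because A + L2(1) K^T is
   Hurwitz. By d'Alembert's formula the wave equation is a difference equation
   coupled to a scalar ODE for w(1, t). The energy identity together with an
   observability estimate over a time interval of length 4 makes the energy
   contract up to the input, so w decays as well, and so does X = Y - Lam(w, w_t).
   The matrix inverted in Q is invertible since otherwise its left kernel, which
   is stable under A, would contain a complex eigenrow of A, giving an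
   eigenfunction of A1 for an eigenvalue of A. *)

(** * Integrals over intervals *)

(** The gains are what makes [Y] obey a closed equation. Differentiating Lam along the wave and
    integrating by parts twice leaves interior terms and end terms. The interior ones cancel if L1 =
    A L2 and L2'' = A^2 L2, those at 0 if L2'(0) = -(A B2 + B1) and L3 = -B2, the one in w_t(1) if
    L4 = beta L2(1) - B4; the one in w(1) leaves a linear equation for Q = L2(0). Mild solutions
    have no pointwise derivatives. A wave state becomes an L^2 function on [-1, 1] together with
    w(1), evolution becomes translation along one function, and the generator is read off from L^2
    limits of difference quotients. The reflection coefficient (1 - beta) / (1 + beta) has modulus
    below 1, but the recursion also contains alpha w(1) and does not contract by itself; hence the
    energy. Energy is dissipated through w_t(1) only, so w(1) must be recovered from w_t(1): a
    signal leaving x = 1 is back after time 2, and comparing departure with return for all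
    departures in [0, 2] takes the window [0, 4]. *)

Section Integrals.
Context (R : realType).
Local Notation mu := (@lebesgue_measure R).
Implicit Types (f g h : R -> R) (a b c t : R).

Definition L1loc f := measurable_fun [set: R] f /\
  forall a b, mu.-integrable `[a, b] (EFin \o f).

Definition L2loc f := measurable_fun [set: R] f /\
  forall a b, mu.-integrable `[a, b] (EFin \o (fun x => f x ^+ 2)).

(** Not oriented: the value is 0 when [b < a]. The oriented primitive is [prim] below. *)
Definition ig a b f : R := \int[mu]_(x in `[a, b]) f x.

Lemma L1locS f a b : L1loc f -> mu.-integrable `[a, b] (EFin \o f).
Proof. by case. Qed.

Lemma L1locD f g : L1loc f -> L1loc g -> L1loc (fun x => f x + g x).
Proof.
move=> [mf fi] [mg gi]; split; first exact: measurable_funD.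
by move=> a b; refine (integrableD _ (fi a b) (gi a b)).
Qed.

Lemma L1locZ c f : L1loc f -> L1loc (fun x => c * f x).
Proof.
move=> [mf fi]; split; first exact: measurable_funM.
by move=> a b; refine (integrableZl _ c (fi a b)).
Qed.

Lemma L1locN f : L1loc f -> L1loc (fun x => - f x).
Proof.
by move=> /(L1locZ (-1)); under eq_fun do rewrite mulN1r.
Qed.

Lemma L1locB f g : L1loc f -> L1loc g -> L1loc (fun x => f x - g x).
Proof. by move=> fi gi; apply: L1locD => //; exact: L1locN. Qed.

Lemma L1loc_le f g : measurable_fun [set: R] f -> L1loc g ->
  (forall x, `|f x| <= g x) -> L1loc f.
Proof.
move=> mf [mg gi] fg; split=> // a b; apply: le_integrable (gi a b) => //.
  by apply/measurable_EFinP; exact: measurable_funTS.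
by move=> x _; rewrite /= lee_fin (le_trans (fg x))// ler_norm.
Qed.

Lemma L1loc_abs f : L1loc f -> L1loc (fun x => `|f x|).
Proof.
move=> [mf fi]; split; first exact: measurableT_comp.
by move=> a b; apply: integrable_norm.
Qed.

Lemma cont_measurable f : continuous f -> measurable_fun [set: R] f.
Proof. exact: continuous_measurable_fun. Qed.

Lemma cont_L1loc f : continuous f -> L1loc f.
Proof.
move=> cf; split; first exact: cont_measurable.
move=> a b; apply: continuous_compact_integrable; first exact: segment_compact.
exact: continuous_subspaceT.
Qed.

Lemma cont_L2loc f : continuous f -> L2loc f.
Proof.
move=> cf; split; first exact: cont_measurable.
have : continuous (fun x => f x ^+ 2).
  by move=> x; exact: (continuousM (cf x) (cf x)).
by move=> /cont_L1loc[].
Qed.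

Lemma L2loc_sqr f : L2loc f -> L1loc (fun x => f x ^+ 2).
Proof. by move=> [mf fi]; split=> //; exact: measurable_funX. Qed.

Lemma L2loc_mul f g : L2loc f -> L2loc g -> L1loc (fun x => f x * g x).
Proof.
move=> hf hg; have i2 := L1locD (L2loc_sqr hf) (L2loc_sqr hg).
case: hf hg => [mf _] [mg _].
apply: L1loc_le i2 _; first exact: measurable_funM.
move=> x; rewrite ler_norml; have := sqr_ge0 (f x - g x).
by have := sqr_ge0 (f x + g x); nra.
Qed.

Lemma L2loc_L1 f : L2loc f -> L1loc f.
Proof.
move=> hf; have h1 : L2loc (fun=> 1) by apply: cont_L2loc => x; exact: cvg_cst.
by have := L2loc_mul h1 hf; under eq_fun do rewrite mul1r.
Qed.

Lemma L2loc_le f g : measurable_fun [set: R] f -> L1loc g ->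
  (forall x, f x ^+ 2 <= g x) -> L2loc f.
Proof.
move=> mf gi fg; split=> //.
suff [] : L1loc (fun x => f x ^+ 2) by [].
by apply: L1loc_le gi _; [exact: measurable_funX|move=> x; rewrite ger0_norm// sqr_ge0].
Qed.

Lemma L2locZ c f : L2loc f -> L2loc (fun x => c * f x).
Proof.
move=> hf; apply: L2loc_le (L1locZ (c ^+ 2) (L2loc_sqr hf)) _.
  by apply: measurable_funM => //; case: hf.
by move=> x; rewrite exprMn.
Qed.

Lemma L2locD f g : L2loc f -> L2loc g -> L2loc (fun x => f x + g x).
Proof.
move=> hf hg.
apply: L2loc_le (L1locD (L1locZ 2 (L2loc_sqr hf)) (L1locZ 2 (L2loc_sqr hg))) _.
  by apply: measurable_funD; [case: hf|case: hg].
move=> x; have := sqr_ge0 (f x - g x); lra.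
Qed.

Lemma L2locN f : L2loc f -> L2loc (fun x => - f x).
Proof. by move=> /(L2locZ (-1)); under eq_fun do rewrite mulN1r. Qed.

Lemma L2locB f g : L2loc f -> L2loc g -> L2loc (fun x => f x - g x).
Proof. by move=> fi gi; apply: L2locD => //; exact: L2locN. Qed.

Lemma igD a b f g : L1loc f -> L1loc g ->
  ig a b (fun x => f x + g x) = ig a b f + ig a b g.
Proof. by move=> [_ fi] [_ gi]; exact: RintegralD. Qed.

Lemma igB a b f g : L1loc f -> L1loc g ->
  ig a b (fun x => f x - g x) = ig a b f - ig a b g.
Proof. by move=> [_ fi] [_ gi]; exact: RintegralB. Qed.

Lemma igZ a b c f : L1loc f -> ig a b (fun x => c * f x) = c * ig a b f.
Proof. by move=> [_ fi]; exact: RintegralZl. Qed.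

Lemma ig_cst a b c : a <= b -> ig a b (fun=> c) = c * (b - a).
Proof.
move=> ab; rewrite /ig Rintegral_cst//= lebesgue_measure_itv/= lte_fin.
by move: ab; rewrite le_eqVlt => /predU1P[->|->//]; rewrite ltxx subrr.
Qed.

Lemma ig_eq a b f g : (forall x, a <= x <= b -> f x = g x) ->
  ig a b f = ig a b g.
Proof.
by move=> fg; apply: eq_Rintegral => x; rewrite inE/= in_itv/=; exact: fg.
Qed.

Lemma ig_le a b f g : L1loc f -> L1loc g ->
  (forall x, a <= x <= b -> f x <= g x) -> ig a b f <= ig a b g.
Proof.
move=> [_ fi] [_ gi] fg; exact: le_Rintegral.
Qed.

Lemma ig_ge0 a b f : (forall x, a <= x <= b -> 0 <= f x) -> 0 <= ig a b f.
Proof.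
by move=> f0; apply: Rintegral_ge0 => x/=; rewrite in_itv/=; exact: f0.
Qed.

Lemma ig_norm a b f : L1loc f -> `|ig a b f| <= ig a b (fun x => `|f x|).
Proof. by move=> [_ fi]; exact: le_normr_Rintegral. Qed.

Lemma ig_gt a b f : b < a -> ig a b f = 0.
Proof. by move=> ba; rewrite /ig set_itv_ge ?Rintegral_set0// bnd_simp -ltNge. Qed.

Lemma igxx a f : ig a a f = 0.
Proof. by rewrite /ig set_itv1 Rintegral_set1. Qed.

Lemma ig_split a b c f : L1loc f -> a <= b <= c -> ig a c f = ig a b f + ig b c f.
Proof.
move=> [_ fi] /andP[ab bc]; apply/eqP; rewrite addrC -subr_eq; apply/eqP.
rewrite /ig (@Rintegral_itvB _ f (BLeft a) (BRight c) b)//=.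
rewrite Rintegral_itv_obnd_cbnd//; apply: integrableS (fi b c) => //.
exact: subset_itv_oc_cc.
Qed.

Definition aeon a b (P : R -> Prop) := {ae mu, forall x, a <= x <= b -> P x}.

Lemma aeon2 a b P Q S : (forall x, a <= x <= b -> P x -> Q x -> S x) ->
  aeon a b P -> aeon a b Q -> aeon a b S.
Proof.
move=> PQ; apply: (@filterS2 _ _ (ae_filter_ringOfSetsType mu)) => x Px Qx xab.
by apply: PQ => //; [exact: Px|exact: Qx].
Qed.

Lemma aeonS a b P Q : (forall x, a <= x <= b -> P x -> Q x) ->
  aeon a b P -> aeon a b Q.
Proof.
move=> PQ; apply: (@filterS _ _ (ae_filter_ringOfSetsType mu)) => x Px xab.
by apply: PQ => //; exact: Px.
Qed.

Lemma aeon_sub a b c d P : c <= a -> b <= d -> aeon c d P -> aeon a b P.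
Proof.
move=> ca bd; apply: (@filterS _ _ (ae_filter_ringOfSetsType mu)) => x Px /andP[ax xb].
by apply: Px; rewrite (le_trans ca)// (le_trans xb).
Qed.

Lemma ig_ae a b f g : L1loc f -> L1loc g ->
  aeon a b (fun x => f x = g x) -> ig a b f = ig a b g.
Proof.
move=> [mf fi] [mg gi] fg; congr fine; apply: ae_eq_integral => //.
- by apply/measurable_EFinP; exact: measurable_funTS.
- by apply/measurable_EFinP; exact: measurable_funTS.
apply: (@filterS _ _ (ae_filter_ringOfSetsType mu)) fg => x h /=.
by rewrite in_itv/= => /h ->.
Qed.

Lemma ig_eq0_ae a b f : L1loc f -> (forall x, a <= x <= b -> 0 <= f x) ->
  ig a b f = 0 -> aeon a b (fun x => f x = 0).
Proof.
move=> [mf fi] f0 fe.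
have h : (\int[mu]_(x in `[a, b]) `|(EFin \o f) x| = 0)%E.
  have -> : (\int[mu]_(x in `[a, b]) `|(EFin \o f) x| =
    \int[mu]_(x in `[a, b]) (f x)%:E)%E.
    apply: eq_integral => x; rewrite inE/= in_itv/= => xab.
    by rewrite ger0_norm// f0.
  rewrite -[LHS]fineK; last exact: integrable_fin_num.
  by congr (_%:E).
have mab : measurable_fun `[a, b] (EFin \o f).
  by apply/measurable_EFinP; exact: measurable_funTS.
have /(_ h) := iffLR (ae_eq_integral_abs mu (measurable_itv `[a, b]) mab).
apply: (@filterS _ _ (ae_filter_ringOfSetsType mu)) => x hx xab.
by have := hx; rewrite /= in_itv/= => /(_ xab) [].
Qed.

(** A variance is nonnegative: with [m] the mean of [f] on [[a, b]], the integral of [(f - m) ^+ 2]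
    is expanded. *)
Lemma ig_CS a b f : a <= b -> L2loc f ->
  (ig a b f) ^+ 2 <= (b - a) * ig a b (fun x => f x ^+ 2).
Proof.
move=> ab hf; have hf1 := L2loc_L1 hf; have hf2 := L2loc_sqr hf.
have [->|nab] := eqVneq a b; first by rewrite !igxx expr0n/= mulr0.
have ba : 0 < b - a by rewrite subr_gt0 lt_neqAle nab.
set m := ig a b f / (b - a).
have h1 : L1loc (fun=> m ^+ 2) by apply: cont_L1loc => x; exact: cvg_cst.
have : 0 <= ig a b (fun x => (f x ^+ 2 - (2 * m) * f x) + m ^+ 2).
  by apply: ig_ge0 => x _; have := sqr_ge0 (f x - m); lra.
rewrite igD//; last by apply: L1locB => //; exact: L1locZ.
rewrite igB//; last exact: L1locZ.
rewrite igZ// ig_cst//.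
have -> : ig a b f = m * (b - a) by rewrite /m divfK// gt_eqF.
set S := ig a b _; nra.
Qed.

End Integrals.

(** * Translation, reflection, Fubini on a triangle and integration by parts *)

Section ChangeOfVariable.
Context (R : realType).
Local Notation mu := (@lebesgue_measure R).
Implicit Types (f g h : R -> R) (a b c t : R).

Section MeasurePreserving.
Variable phi : measurableTypeR R -> measurableTypeR R.
Hypothesis mphi : measurable_fun [set: measurableTypeR R] phi.
Hypothesis phi_mu : forall A : set (measurableTypeR R), measurable A ->
  mu (phi @^-1` A) = mu A.
Variables (a b a' b' : R).
Hypothesis phiD : phi @^-1` `[a', b'] = `[a, b]%classic.

Let ms : {mfun measurableTypeR R >-> measurableTypeR R} :=
  HB.pack phi (isMeasurableFun.Build _ _ _ _ _ mphi).

Lemma integral_mp (f : R -> \bar R) : measurable_fun [set: R] f ->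
  (forall x, 0 <= f x)%E ->
  (\int[mu]_(x in `[a, b]) f (phi x) = \int[mu]_(x in `[a', b']) f x)%E.
Proof.
move=> mf f0; transitivity (\int[pushforward mu ms]_(x in `[a', b']) f x)%E.
  by rewrite ge0_integral_pushforward ?phiD//; exact: measurable_funTS.
by apply: eq_measure_integral => A mA _; exact: phi_mu.
Qed.

Lemma integrable_mp f : L1loc f -> mu.-integrable `[a, b] (EFin \o (fun x => f (phi x))).
Proof.
move=> [mf fi]; apply/integrableP; split.
  by apply/measurable_EFinP/measurable_funTS; exact: measurableT_comp mf mphi.
have /integrableP[_] := fi a' b'; rewrite -integral_mp//.
by apply: measurableT_comp => //; apply/measurable_EFinP.
Qed.

Lemma ig_mp f : L1loc f -> ig a b (fun x => f (phi x)) = ig a' b' f.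
Proof.
move=> hf; rewrite /ig /Rintegral; congr fine.
transitivity (\int[pushforward mu ms]_(x in `[a', b']) (EFin \o f) x)%E; last first.
  by apply: eq_measure_integral => A mA _; exact: phi_mu.
rewrite integral_pushforward ?phiD//.
  by apply/measurable_EFinP; case: hf.
exact: integrable_mp.
Qed.

Lemma aeon_mp (P : R -> Prop) : aeon a' b' P -> aeon a b (fun x => P (phi x)).
Proof.
move=> [N [mN N0 PN]]; exists (phi @^-1` N); split.
- by rewrite -[X in measurable X]setTI; exact: mphi.
- by rewrite phi_mu.
- move=> x /= h; apply: PN => /= h'; apply: h => xab; apply: h'.
  have : (phi @^-1` `[a', b']) x by rewrite phiD /= in_itv.
  by rewrite /= in_itv.
Qed.

End MeasurePreserving.

Let shift t (x : measurableTypeR R) : measurableTypeR R := x + t.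

Lemma measurable_shift t : measurable_fun [set: measurableTypeR R] (shift t).
Proof. by apply: measurable_funD => //; exact: measurable_id. Qed.

(** By uniqueness of Lebesgue measure it suffices to compare both sides on half-open intervals. *)
Lemma lebesgue_shift t (A : set (measurableTypeR R)) : measurable A ->
  mu (shift t @^-1` A) = mu A.
Proof.
move=> mA; apply/esym.
pose ms : {mfun measurableTypeR R >-> measurableTypeR R} :=
  HB.pack (shift t) (isMeasurableFun.Build _ _ _ _ _ (measurable_shift t)).
apply: (@lebesgue_measure_unique _ (pushforward mu ms)) => // _ [[u v] _ <-].
transitivity (mu `]u - t, v - t]%classic); last first.
  by congr (mu _); apply/seteqP; split => x /=; rewrite !in_itv/= ltrBlDr lerBrDr.
by rewrite !lebesgue_measure_itv/= !lte_fin ltrD2r -!EFinB opprB addrA subrK.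
Qed.

Lemma preimage_shift t a b : shift t @^-1` `[a + t, b + t] = `[a, b]%classic.
Proof. by apply/seteqP; split => x /=; rewrite !in_itv/= !lerD2r. Qed.

Lemma measurable_shiftf f t : measurable_fun [set: R] f ->
  measurable_fun [set: R] (fun x => f (x + t)).
Proof. by move=> mf; apply: measurableT_comp mf (measurable_shift t). Qed.

Lemma L1loc_shift f t : L1loc f -> L1loc (fun x => f (x + t)).
Proof.
move=> hf; split; first by apply: measurable_shiftf; case: hf.
move=> a b.
exact: (integrable_mp (measurable_shift t) (@lebesgue_shift t) (preimage_shift t a b)).
Qed.

Lemma L2loc_shift f t : L2loc f -> L2loc (fun x => f (x + t)).
Proof.
move=> hf; split; first by apply: measurable_shiftf; case: hf.
by have [] := L1loc_shift t (L2loc_sqr hf).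
Qed.

Lemma ig_shift a b f t : L1loc f -> ig a b (fun x => f (x + t)) = ig (a + t) (b + t) f.
Proof. by move=> h; exact: (ig_mp (measurable_shift t) (@lebesgue_shift t) (preimage_shift t a b) h). Qed.

Lemma aeon_shift a b t (P : R -> Prop) :
  aeon (a + t) (b + t) P -> aeon a b (fun x => P (x + t)).
Proof. by move=> h; exact: (aeon_mp (measurable_shift t) (@lebesgue_shift t) (preimage_shift t a b) h). Qed.

Let oppf (x : measurableTypeR R) : measurableTypeR R := - x.

Lemma measurable_oppf : measurable_fun [set: measurableTypeR R] oppf.
Proof. by apply: measurableT_comp => //; exact: measurable_id. Qed.

Lemma lebesgue_opp (A : set (measurableTypeR R)) : measurable A ->
  mu (oppf @^-1` A) = mu A.
Proof.
move=> mA; apply/esym.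
pose ms : {mfun measurableTypeR R >-> measurableTypeR R} :=
  HB.pack oppf (isMeasurableFun.Build _ _ _ _ _ measurable_oppf).
apply: (@lebesgue_measure_unique _ (pushforward mu ms)) => // _ [[u v] _ <-].
transitivity (mu `[- v, - u[%classic); last first.
  by congr (mu _); apply/seteqP; split => x /=; rewrite !in_itv/= ltrNr lerNl andbC.
by rewrite !lebesgue_measure_itv/= !lte_fin ltrN2 -!EFinB opprK addrC.
Qed.

Lemma preimage_opp a b : oppf @^-1` `[- b, - a] = `[a, b]%classic.
Proof. by apply/seteqP; split => x /=; rewrite !in_itv/= !lerN2 andbC. Qed.

Lemma measurable_oppff f : measurable_fun [set: R] f ->
  measurable_fun [set: R] (fun x => f (- x)).
Proof. by move=> mf; apply: measurableT_comp mf measurable_oppf. Qed.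

Lemma L1loc_opp f : L1loc f -> L1loc (fun x => f (- x)).
Proof.
move=> hf; split; first by apply: measurable_oppff; case: hf.
move=> a b; exact: (integrable_mp measurable_oppf lebesgue_opp (preimage_opp a b)).
Qed.

Lemma L2loc_opp f : L2loc f -> L2loc (fun x => f (- x)).
Proof.
move=> hf; split; first by apply: measurable_oppff; case: hf.
by have [] := L1loc_opp (L2loc_sqr hf).
Qed.

Lemma ig_opp a b f : L1loc f -> ig a b (fun x => f (- x)) = ig (- b) (- a) f.
Proof. by move=> h; exact: (ig_mp measurable_oppf lebesgue_opp (preimage_opp a b) h). Qed.

Lemma aeon_opp a b (P : R -> Prop) :
  aeon (- b) (- a) P -> aeon a b (fun x => P (- x)).
Proof. by move=> h; exact: (aeon_mp measurable_oppf lebesgue_opp (preimage_opp a b) h). Qed.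

(** To the left of [a], and for the left limit at [a], continuity rests on the convention that
    reversed bounds give 0. *)
Lemma ig_continuous a f : L1loc f -> continuous (fun x => ig a x f).
Proof.
move=> hf x.
have h b : a < b -> {within `[a, b], continuous (fun x => ig a x f)}.
  move=> ab; apply: parameterized_integral_continuous; first exact: ltW.
  by case: hf.
have near0 : x < a -> \forall y \near x, ig a y f = 0.
  by move=> xa; near=> y; apply: ig_gt; near: y; exact: lt_nbhsl.
have [xa|ax|->] := ltgtP x a.
- apply/cvgrPdist_lt => e e0; near=> y.
  by rewrite ig_gt// (near (near0 xa) y)// subrr normr0.
- have ax1 : a < x + 1 by rewrite (lt_trans ax)// ltrDl.
  have /(continuous_within_itvP _ ax1)[+ _ _] := h _ ax1.
  by apply; rewrite in_itv/= ax ltrDl ltr01.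
- have a1 : a < a + 1 by rewrite ltrDl.
  have /(continuous_within_itvP _ a1)[_ + _] := h _ a1 => ha.
  apply/left_right_continuousP; split => //.
  apply/cvgrPdist_lt => e e0; near=> y.
  by rewrite igxx ig_gt// subrr normr0.
Unshelve. all: by end_near. Qed.

Lemma ig_continuousl b f : L1loc f -> continuous (fun x => ig x b f).
Proof.
move=> hf; rewrite (_ : (fun x => _) = fun x => ig (- b) (- x) (fun y => f (- y))).
  move=> x; apply: (@continuous_comp _ _ _ -%R (fun y => ig (- b) y (fun y => f (- y)))).
    exact: opp_continuous.
  by apply: ig_continuous; exact: L1loc_opp.
by apply/funext => x; rewrite ig_opp// !opprK.
Qed.

Lemma cont_bounded f a b : continuous f ->
  exists M, 0 < M /\ forall x, a <= x <= b -> `|f x| <= M.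
Proof.
move=> cf; have [ab|ba] := leP a b; last first.
  exists 1; split=> // x /andP[h1 h2].
  by have := le_trans h1 h2; rewrite leNgt ba.
have cf' : {within `[a, b], continuous (fun x => `|f x|)}.
  apply: continuous_subspaceT => x.
  by apply: cvg_norm; exact: cf.
have [c _ hc] := EVT_max ab cf'.
exists (`|f c| + 1); split; first by rewrite ltr_wpDl.
by move=> x xab; rewrite (le_trans (hc x _)) ?in_itv// lerDl.
Qed.

Lemma L1locM_cont f g : L1loc f -> continuous g -> L1loc (fun x => f x * g x).
Proof.
move=> [mf fi] cg; split.
  by apply: measurable_funM => //; exact: cont_measurable.
move=> a b; have [M [M0 gM]] := cont_bounded a b cg.
have hM : mu.-integrable `[a, b] (EFin \o (fun x => M * f x)).
  by refine (integrableZl _ M (fi a b)).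
apply: le_integrable hM => //.
  apply/measurable_EFinP/measurable_funTS/measurable_funM => //.
  exact: cont_measurable.
move=> x; rewrite /= in_itv/= => xab; rewrite lee_fin !normrM mulrC.
by rewrite ler_wpM2r// (le_trans (gM x xab))// ler_norm.
Qed.

Lemma L2locM_cont f g : L2loc f -> continuous g -> L2loc (fun x => f x * g x).
Proof.
move=> hf cg; split.
  by apply: measurable_funM; [case: hf|exact: cont_measurable].
have cg2 : continuous (fun x => g x ^+ 2).
  by move=> x; exact: (continuousM (cg x) (cg x)).
have [_ h] := L1locM_cont (L2loc_sqr hf) cg2.
move=> a b; have := h a b; rewrite (_ : (fun x => f x ^+ 2 * g x ^+ 2) = fun x => (f x * g x) ^+ 2)//.
by apply/funext => x; rewrite exprMn.
Qed.

Lemma FTC2 F f a b : (forall x, is_derive x (1 : R) F (f x)) -> continuous f ->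
  a <= b -> F b = F a + ig a b f.
Proof.
move=> dF cf; rewrite le_eqVlt => /predU1P[->|ab]; first by rewrite igxx addr0.
have cF : continuous F.
  move=> x; apply: differentiable_continuous; apply/derivable1_diffP.
  by have [] := dF x.
rewrite /ig /Rintegral (@continuous_FTC2 _ f F)//=.
- by ring.
- exact: continuous_subspaceT.
- split.
  + by move=> x _; have [] := dF x.
  + by apply: cvg_at_right_filter; exact: cF.
  + by apply: cvg_at_left_filter; exact: cF.
- by move=> x _; rewrite derive1E; have [_ ->] := dF x.
Qed.

Let trunc f a b x := f x * (a <= x <= b)%R%:R.

Lemma measurable_trunc f a b : measurable_fun [set: R] f ->
  measurable_fun [set: R] (trunc f a b).
Proof.
move=> mf; have -> : trunc f a b = fun x => f x * \1_(`[a, b]%classic : set R) x.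
  by apply/funext => x; rewrite /trunc indicE mem_setE in_itv.
by apply: measurable_funM => //; exact: measurable_indic.
Qed.

Lemma trunc_integral f a b :
  (\int[mu]_x (trunc f a b x)%:E = \int[mu]_(x in `[a, b]) (f x)%:E)%E.
Proof.
rewrite [RHS]integral_mkcond; apply: eq_integral => x _.
by rewrite patchE mem_setE in_itv/= /trunc; case: ifPn; rewrite ?mulr1 ?mulr0.
Qed.

Lemma trunc_integrable f a b : L1loc f -> mu.-integrable [set: R] (EFin \o trunc f a b).
Proof.
move=> [mf fi]; apply/integrableP; split.
  by apply/measurable_EFinP; exact: measurable_trunc.
have /integrableP[_] := fi a b; rewrite [X in (X < _)%E]integral_mkcond.
apply: le_lt_trans; rewrite le_eqVlt; apply/orP; left; apply/eqP.
apply: eq_integral => x _; rewrite patchE mem_setE in_itv/= /trunc.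
by case: ifPn; rewrite ?mulr1 ?mulr0 ?normr0.
Qed.

(** Both sides integrate [f x * g y] over the triangle [a <= x <= y <= b], in the two possible
    orders; [H] is this integrand extended by 0 to the plane. *)
Lemma Fubini_triangle f g a b : L1loc f -> L1loc g ->
  ig a b (fun x => f x * ig x b g) = ig a b (fun y => g y * ig a y f).
Proof.
move=> hf hg.
have [mf _] := hf; have [mg _] := hg.
pose F := trunc f a b; pose G := trunc g a b.
pose H (z : R * R) := (F z.1 * G z.2 * (z.1 <= z.2)%R%:R)%:E.
have mH : measurable_fun [set: R * R] H.
  apply/measurable_EFinP; apply: measurable_funM.
    by apply: measurable_funM; apply: measurableT_comp => //; exact: measurable_trunc.
  have -> : (fun z : R * R => ((z.1 <= z.2)%R%:R : R)) = \1_[set z : R * R | z.1 <= z.2].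
    by apply/funext => z; rewrite indicE; congr ((nat_of_bool _)%:R); apply/idP/idP; rewrite inE.
  apply: measurable_indic.
  rewrite (_ : [set z : R * R | z.1 <= z.2] = (fun z : R * R => z.2 - z.1) @^-1` `[0, +oo[%classic).
    rewrite -[X in measurable X]setTI.
    apply: measurable_funB => //.
  by apply/seteqP; split => z /=; rewrite in_itv/= andbT subr_ge0.
have iH : (mu \x mu)%E.-integrable [set: R * R] H.
  apply/integrable12ltyP => //.
  have iG := trunc_integrable a b hg.
  have iF := trunc_integrable a b hf.
  set cG := (\int[mu]_y `|(EFin \o G) y|)%E.
  have cGlt : (cG < +oo)%E by have /integrableP[] := iG.
  have cG0 : (0 <= cG)%E by apply: integral_ge0.
  have cGf : cG \is a fin_num by rewrite ge0_fin_numE.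
  (* Dropping the indicator of the triangle bounds the double integral by the product of two L^1
     norms. *)
  apply: (@le_lt_trans _ _ (\int[mu]_x (`|F x|%:E * cG))%E).
    apply: ge0_le_integral => //.
    - by move=> x _; apply: integral_ge0.
    - apply: (@measurable_fun_fubini_tonelli_F _ _ _ _ R mu (fun z => `|H z|)%E) => //.
      exact: measurableT_comp.
    - apply: emeasurable_funM => //; apply/measurable_EFinP.
      by apply: measurableT_comp => //; exact: measurable_trunc.
    - move=> x _; rewrite /cG -ge0_integralZl//; last first.
        apply: measurableT_comp => //; apply/measurable_EFinP.
        exact: measurable_trunc.
      apply: ge0_le_integral => //.
      + apply: measurableT_comp => //.
        exact: measurableT_comp mH (measurable_pair1 x).
      + apply: emeasurable_funM => //; apply: measurableT_comp => //.
        by apply/measurable_EFinP; exact: measurable_trunc.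
      + move=> y _; rewrite /H /= lee_fin !normrM.
        by rewrite ler_piMr ?mulr_ge0//; case: (x <= y); rewrite ?normr1 ?normr0.
  rewrite ge0_integralZr//; last first.
    apply/measurable_EFinP; apply: measurableT_comp => //.
    exact: measurable_trunc.
  apply: lte_mul_pinfty => //; first exact: integral_ge0.
    by rewrite ge0_fin_numE ?integral_ge0//; have /integrableP[] := iF.
have := Fubini iH.
rewrite /ig /Rintegral.
have -> : (\int[mu]_x \int[mu]_y H (x, y) = \int[mu]_(x in `[a, b]) (f x * ig x b g)%:E)%E.
  rewrite [RHS]integral_mkcond; apply: eq_integral => x _.
  rewrite patchE mem_setE in_itv/=; case: ifPn => [xab|xab].
    transitivity (\int[mu]_y (f x * trunc g x b y)%:E)%E.
      apply: eq_integral => y _; rewrite /H/= /F /G /trunc xab mulr1.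
      congr (_%:E); rewrite -!mulrA; congr (_ * (_ * _)).
      rewrite -natrM mulnb; congr ((nat_of_bool _)%:R).
      case/andP: xab => ax xb.
      by apply/idP/idP => [/andP[/andP[_ ->] ->]//|/andP[xy ->]]; rewrite (le_trans ax)// xy.
    rewrite (_ : (fun y => (f x * trunc g x b y)%:E) = (fun y => (f x)%:E * (trunc g x b y)%:E)%E)//.
    rewrite integralZl//; last exact: trunc_integrable.
    rewrite trunc_integral EFinM /ig /Rintegral fineK//.
    by apply: integrable_fin_num => //; case: hg.
  by rewrite integral0_eq// => y _; rewrite /H /= /F /trunc (negbTE xab) mulr0 !mul0r.
have -> : (\int[mu]_y \int[mu]_x H (x, y) = \int[mu]_(y in `[a, b]) (g y * ig a y f)%:E)%E.
  rewrite [RHS]integral_mkcond; apply: eq_integral => y _.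
  rewrite patchE mem_setE in_itv/=; case: ifPn => [yab|yab].
    transitivity (\int[mu]_x (g y * trunc f a y x)%:E)%E.
      apply: eq_integral => x _; rewrite /H/= /F /G /trunc yab mulr1.
      congr (_%:E); rewrite [f x * _ * _]mulrC -!mulrA; congr (_ * (_ * _)).
      rewrite -natrM mulnb; congr ((nat_of_bool _)%:R).
      case/andP: yab => ay yb.
      by apply/idP/idP => [/andP[/andP[-> _] ->]//|/andP[-> xy]]; rewrite xy (le_trans xy).
    rewrite (_ : (fun x => (g y * trunc f a y x)%:E) = (fun x => (g y)%:E * (trunc f a y x)%:E)%E)//.
    rewrite integralZl//; last exact: trunc_integrable.
    rewrite trunc_integral EFinM /ig /Rintegral fineK//.
    by apply: integrable_fin_num => //; case: hf.
  by rewrite integral0_eq// => x _; rewrite /H /= /G /trunc (negbTE yab) mulr0 mulr0 mul0r.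
by move=> ->.
Qed.

(** [F] and [G] are only primitives of integrable functions, so there is no pointwise product rule.
    Fubini on the triangle replaces it: the two iterated integrals of [f] and [g] add up to the
    product of their integrals. *)
Lemma ig_parts F G f g a b : a <= b -> L1loc f -> L1loc g ->
  (forall x, a <= x <= b -> F x = F a + ig a x f) ->
  (forall x, a <= x <= b -> G x = G a + ig a x g) ->
  F b * G b = F a * G a + ig a b (fun x => f x * G x + F x * g x).
Proof.
move=> ab hf hg FE GE.
have cf : continuous (fun x => ig a x f) by exact: ig_continuous.
have cg : continuous (fun x => ig a x g) by exact: ig_continuous.
have hfg := L1locM_cont hf cg; have hgf := L1locM_cont hg cf.
have -> : ig a b (fun x => f x * G x + F x * g x) =
  ig a b (fun x => (G a * f x + F a * g x) + (f x * ig a x g + g x * ig a x f)).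
  by apply: ig_eq => x xab; rewrite FE// GE//; ring.
rewrite igD; [|by apply: L1locD; exact: L1locZ|exact: L1locD].
rewrite igD; [|exact: L1locZ|exact: L1locZ].
rewrite igD// !igZ//.
rewrite -(Fubini_triangle a b hf hg) -igD//; last first.
  by apply: L1locM_cont => //; exact: ig_continuousl.
rewrite (FE b) ?lexx ?ab// (GE b) ?lexx ?ab//.
have -> : ig a b (fun x => f x * ig a x g + f x * ig x b g) = ig a b (fun x => ig a b g * f x).
  apply: ig_eq => x xab; rewrite -mulrDr mulrC; congr (_ * _).
  by rewrite -ig_split.
by rewrite igZ//; ring.
Qed.

End ChangeOfVariable.

(** * Lebesgue differentiation, and continuity of translations in L^2 *)

Section Primitives.
Context (R : realType).
Local Notation mu := (@lebesgue_measure R).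
Implicit Types (f g h : R -> R) (a b c t e : R).

(** At most one of the two integrals is nonzero, so this is the primitive vanishing at 0, with the
    right sign on both sides of 0. *)
Definition prim f x := ig 0 x f - ig x 0 f.

Lemma igE a b f : L1loc f -> a <= b -> ig a b f = prim f b - prim f a.
Proof.
move=> hf ab; rewrite /prim.
have [a0|a0] := leP 0 a.
  rewrite (@ig_split _ 0 a b)// ?a0//.
  have z c : 0 <= c -> ig c 0 f = 0.
    by rewrite le_eqVlt => /predU1P[<-|/ig_gt//]; rewrite igxx.
  by rewrite !z ?(le_trans a0 ab)//; ring.
have z c : c <= 0 -> ig 0 c f = 0.
  by rewrite le_eqVlt => /predU1P[->|/ig_gt//]; rewrite igxx.
rewrite (z a) ?(ltW a0)//.
have [b0|b0] := leP 0 b.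
  rewrite (@ig_split _ a 0 b) ?(ltW a0)//.
  by move: b0; rewrite le_eqVlt => /predU1P[<-|/ig_gt ->]; rewrite ?igxx; ring.
rewrite (z b) ?(ltW b0)// (@ig_split _ a b 0) ?ab ?(ltW b0)//; ring.
Qed.

Lemma prim_continuous f : L1loc f -> continuous (prim f).
Proof.
by move=> hf x; apply: cvgB; [exact: ig_continuous|exact: ig_continuousl].
Qed.

Lemma L1loc_locally f : L1loc f -> locally_integrable [set: R] f.
Proof.
move=> [mf fi]; split => //; first exact: openT.
move=> K _ cK; have [M [_ KM]] := compact_bounded cK.
have /integrableP[_] := fi (- (M + 1)) (M + 1).
apply: le_lt_trans; apply: ge0_subset_integral => //.
- exact: compact_measurable.
- by apply/measurable_EFinP; apply: measurableT_comp => //; exact: measurable_funTS.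
- move=> x Kx; rewrite /= in_itv/= -ler_norml; apply: (KM (M + 1)) => //.
  by rewrite ltrDl.
Qed.

(** One-sided, because difference quotients occur later only in the limit [t --> 0^'+] of
    semigroups. *)
Lemma FTC1_ae f : L1loc f ->
  {ae mu, forall x, h^-1 * (prim f (x + h) - prim f x) @[h --> 0^'+] --> f x}.
Proof.
move=> hf; have := lebesgue_differentiation (L1loc_locally hf).
apply: (@filterS _ _ (ae_filter_ringOfSetsType mu)) => x fx.
have xu : x < x + 1 by rewrite ltrDl.
have ax : (BLeft (x - 1)%R < BRight x)%E by rewrite /= lte_fin gtrBl.
have [/cvg_ex[l +] <-] := FTC1_lebesgue_pt xu (L1locS (x - 1) (x + 1) hf) ax fx.
move=> dF; have -> : (fun y : R => \int[mu]_(t in `[x - 1, y]) f t)^`()%classic x = l.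
  by rewrite derive1E; apply/cvg_lim => //; exact: dF.
apply: cvg_trans (cvg_dnbhs_at_right dF).
apply: near_eq_cvg; near=> h.
have h0 : 0 < h by [].
rewrite /= [h%:A]mulr1 [h + x]addrC -/(ig _ _ _) -/(ig _ _ _) !igE//; [|lra|lra].
by congr (_ * _); ring.
Unshelve. all: by end_near. Qed.

Lemma ig_dominated (f_ : nat -> R -> R) f g a b :
  (forall n, L1loc (f_ n)) -> L1loc f -> L1loc g ->
  (forall x, a <= x <= b -> f_ n x @[n --> \oo] --> f x) ->
  (forall n x, a <= x <= b -> `|f_ n x| <= g x) ->
  ig a b (f_ n) @[n --> \oo] --> ig a b f.
Proof.
move=> mf_ mf mg cvf dom.
suff h : ((\int[mu]_(x in `[a, b]) (f_ n x)%:E)%E @[n --> \oo] --> (fine (\int[mu]_(x in `[a, b]) (f x)%:E)%E)%:E).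
  exact: (fine_cvg h).
rewrite fineK; last by apply: integrable_fin_num => //; case: mf.
apply: (@dominated_cvg _ _ _ mu `[a, b]%classic _ (fun n x => (f_ n x)%:E) (EFin \o f) (EFin \o g)) => //.
- move=> n; apply/measurable_EFinP/measurable_funTS.
  by case: (mf_ n).
- by move=> x /=; rewrite in_itv/= => xab; apply: cvg_EFin; [exact: nearW|exact: cvf].
- by case: mg.
Qed.

Lemma ig0 a b : ig a b (fun=> 0 : R) = 0.
Proof. by rewrite /ig Rintegral_cst//= mul0r. Qed.

Definition clip m x : R := Num.max (- m) (Num.min m x).

Lemma clip_id m x : `|x| <= m -> clip m x = x.
Proof.
rewrite ler_norml => /andP[h1 h2]; rewrite /clip.
by rewrite (min_idPr h2) (max_idPr h1).
Qed.

(** Unfolding [clip] nests one comparison inside another. Only comparisons whose right operand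
    contains no conditional are split, so the inner one is resolved first. *)
Local Ltac split_min := repeat match goal with |- context [if ?a < ?b then _ else _] =>
  lazymatch b with context [if _ then _ else _] => fail | _ => case: (ltP a b) => ? end end.

Lemma clip_lip m x y : 0 <= m -> `|clip m x - clip m y| <= `|x - y|.
Proof.
rewrite /clip /Order.max /Order.min ler_norml => m0; case: (ger0P (x - y)) => h;
  split_min; lra.
Qed.

Lemma clip_bound m x : 0 <= m -> `|clip m x| <= m.
Proof.
rewrite /clip /Order.max /Order.min ler_norml => m0; split_min; lra.
Qed.

Lemma clip_sub m x : 0 <= m -> `|x - clip m x| <= `|x|.
Proof.
rewrite /clip /Order.max /Order.min ler_norml => m0; case: (ger0P x) => h;
  split_min; lra.
Qed.

Lemma clip_continuous m : 0 <= m -> continuous (clip m).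
Proof.
move=> m0 x; apply/cvgrPdist_lt => e e0; near=> y.
apply: le_lt_trans (clip_lip _ _ m0) _; near: y.
have /cvgrPdist_lt : y @[y --> x] --> x by exact: cvg_id.
by apply.
Unshelve. all: by end_near. Qed.

(** Truncating [f] at a large height [M] costs little in L^2 by dominated convergence. The
    truncation is approximated in L^1 by a continuous function, which is truncated as well: for
    functions bounded by [M], the squared difference is at most [2 * M] times the difference, so L^1
    closeness gives L^2 closeness. *)
Lemma L2_continuous_approx f a b e : L2loc f -> 0 < e ->
  exists g, continuous g /\ ig a b (fun x => (f x - g x) ^+ 2) <= e.
Proof.
move=> hf e0; have mf : measurable_fun [set: R] f by case: hf.
have mclip m : 0 <= m -> measurable_fun [set: R] (fun x => clip m (f x)).
  by move=> m0; apply: measurableT_comp mf; apply: cont_measurable; exact: clip_continuous.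
have hd m : 0 <= m -> L2loc (fun x => f x - clip m (f x)).
  move=> m0; apply: L2loc_le (L2loc_sqr hf) _; first by apply: measurable_funB => //; exact: mclip.
  by move=> x; rewrite -[leLHS]real_normK ?num_real// -[leRHS]real_normK ?num_real// lerXn2r ?nnegrE// clip_sub.
have [m hm] : exists m : nat, ig a b (fun x => (f x - clip m.+1%:R (f x)) ^+ 2) <= e / 4.
  have : ig a b (fun x => (f x - clip n.+1%:R (f x)) ^+ 2) @[n --> \oo] --> ig a b (fun=> 0).
    apply: (@ig_dominated _ _ (fun x => f x ^+ 2)).
    - by move=> n; apply: L2loc_sqr; exact: hd.
    - by apply: cont_L1loc => x; exact: cst_continuous.
    - exact: L2loc_sqr.
    - move=> x _; apply: (@cvg_near_cst) => //; near=> n.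
      rewrite clip_id ?subrr ?expr0n//=.
      near: n; exists (Num.truncn `|f x|) => // n /= hn.
      have /truncn_itv/andP[_ /ltW h] := normr_ge0 (f x).
      by rewrite (le_trans h)// ler_nat ltnS.
    - move=> n x _; rewrite ger0_norm ?sqr_ge0//.
      by rewrite -[leLHS]real_normK ?num_real// -[leRHS]real_normK ?num_real// lerXn2r ?nnegrE// clip_sub.
  have e4 : 0 < e / 4 by rewrite divr_gt0.
  move=> /cvgrPdist_le/(_ _ e4)[N _ /(_ N)]/(_ (leqnn N)) /= hN.
  exists N; move: hN; rewrite ig0.
  by rewrite sub0r normrN; apply: le_trans; exact: ler_norm.
set M : R := m.+1%:R in hm; have M0 : 0 < M by rewrite /M ltr0n.
have hcM : L2loc (fun x => clip M (f x)).
  have -> : (fun x => clip M (f x)) = fun x => f x - (f x - clip M (f x)).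
    by apply/funext => x; rewrite subKr.
  by apply: L2locB => //; apply: hd; exact: ltW.
have hc1 := L2loc_L1 hcM.
have [|/= g0_ [cg0 _ hg0]] := @approximation_continuous_integrable R `[a, b]%classic (fun x => clip M (f x)) (measurable_itv _) _ (L1locS a b hc1).
  by apply: compact_finite_measure; exact: segment_compact.
(* Multiplied by [2 * M] this error becomes [e / 4]; two such quarters, each doubled by the square
   of a sum, stay within [e]. *)
have [g0 [cg hg]] : exists g0, continuous g0 /\ ig a b (fun x => `|clip M (f x) - g0 x|) <= e / (8 * M).
  have e8 : 0 < e / (8 * M) by rewrite divr_gt0// mulr_gt0.
  have /fine_cvgP[_ /cvgrPdist_le/(_ _ e8)[N _ /(_ N)]/(_ (leqnn N)) /= hN] := hg0.
  exists (g0_ N); split => //; move: hN; rewrite sub0r normrN.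
  by apply: le_trans; exact: ler_norm.
have cg' : continuous (fun x => clip M (g0 x)).
  by move=> x; apply: continuous_comp; [exact: cg|apply: clip_continuous; exact: ltW].
exists (fun x => clip M (g0 x)); split => //.
have hcg := cont_L2loc cg'.
have hcd : L2loc (fun x => clip M (f x) - clip M (g0 x)) by exact: L2locB.
have hfd : L2loc (fun x => f x - clip M (f x)) by apply: hd; exact: ltW.
have habs : L1loc (fun x => `|clip M (f x) - g0 x|).
  by apply/L1loc_abs/L1locB => //; exact: cont_L1loc.
have h1 : ig a b (fun x => (clip M (f x) - clip M (g0 x)) ^+ 2) <= e / 4.
  apply: (@le_trans _ _ (ig a b (fun x => (2 * M) * `|clip M (f x) - g0 x|))).
    apply: ig_le; [exact: L2loc_sqr|exact: L1locZ|move=> x _].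
    rewrite -real_normK ?num_real// expr2 ler_pM//; last first.
      by rewrite -{1}(clip_id (clip_bound (f x) (ltW M0))); apply: clip_lip; exact: ltW.
    rewrite (le_trans (ler_normB _ _))// mulr_natl mulr2n lerD//; apply: clip_bound; exact: ltW.
  rewrite igZ//; apply: le_trans (ler_wpM2l _ hg) _; first by rewrite mulr_ge0// ltW.
  rewrite le_eqVlt; apply/orP; left; apply/eqP; field.
  by rewrite gt_eqF.
apply: (@le_trans _ _ (ig a b (fun x => 2 * (f x - clip M (f x)) ^+ 2 + 2 * (clip M (f x) - clip M (g0 x)) ^+ 2))).
  apply: ig_le.
  - by apply: L2loc_sqr; exact: L2locB.
  - by apply: L1locD; apply: L1locZ; exact: L2loc_sqr.
  - move=> x _; set p := f x - clip M (f x); set q := clip M (f x) - clip M (g0 x).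
    have -> : f x - clip M (g0 x) = p + q by rewrite /p /q; ring.
    have := sqr_ge0 (p - q); lra.
rewrite igD; [|by apply: L1locZ; exact: L2loc_sqr|by apply: L1locZ; exact: L2loc_sqr].
rewrite !igZ; [|exact: L2loc_sqr|exact: L2loc_sqr].
lra.
Unshelve. all: by end_near. Qed.

(** True for a continuous [g] by bounded convergence, then for [f] by approximation. The
    approximation is taken on [[a, b + 1]] because translates by [t <= 1] look beyond [b]; each of
    the three errors is [e / 9] since a square of three terms costs a factor 3. *)
Lemma L2_shift_small f a b e : L2loc f -> 0 < e ->
  exists d, 0 < d /\ forall t, 0 <= t <= d ->
    ig a b (fun x => (f (x + t) - f x) ^+ 2) <= e.
Proof.
move=> hf e0; have e9 : 0 < e / 9 by rewrite divr_gt0.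
have [g [cg hg]] := L2_continuous_approx a (b + 1) hf e9.
have hg2 := cont_L2loc cg.
have hfg : L2loc (fun x => f x - g x) by exact: L2locB.
have [d [d0 hd]] : exists d, 0 < d /\ forall t, 0 <= t <= d ->
    ig a b (fun x => (g (x + t) - g x) ^+ 2) <= e / 9.
  (* The negation yields a sequence of shifts tending to 0, to which dominated convergence for
     sequences applies. *)
  apply: contrapT => /forallNP nd.
  have {}nd n : exists t, 0 <= t <= n.+1%:R^-1 /\ e / 9 < ig a b (fun x => (g (x + t) - g x) ^+ 2).
    have /not_andP[|/existsNP[t /not_implyP[ht /negP]]] := nd n.+1%:R^-1.
      by rewrite invr_gt0 ltr0n.
    by rewrite -ltNge => h; exists t.
  have [t_ ht] := choice nd.
  have t0 : t_ n @[n --> \oo] --> (0 : R).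
    apply: (@squeeze_cvgr _ _ _ _ (fun=> 0) (fun n => n.+1%:R^-1)).
    - by apply: nearW => n; have [] := ht n.
    - exact: cvg_cst.
    - exact: cvg_harmonic.
  have [M [M0 gM]] := cont_bounded a (b + 1) cg.
  have : ig a b (fun x => (g (x + t_ n) - g x) ^+ 2) @[n --> \oo] --> ig a b (fun=> 0).
    apply: (@ig_dominated _ _ (fun x => (2 * M) ^+ 2)).
    - by move=> n; apply: L2loc_sqr; apply: L2locB => //; exact: L2loc_shift.
    - by apply: cont_L1loc => x; exact: cst_continuous.
    - by apply: cont_L1loc => x; exact: cst_continuous.
    - move=> x _; have h : g (x + t_ n) - g x @[n --> \oo] --> g (x + 0) - g x.
        apply: cvgB; last exact: cvg_cst.
        by apply: continuous_cvg; [exact: cg|apply: cvgD => //; exact: cvg_cst].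
      by have := cvgM h h; rewrite addr0 subrr mulr0; exact.
    - move=> n x /andP[ax xb]; have [/andP[t1 t2] _] := ht n.
      rewrite ger0_norm ?sqr_ge0// -[leLHS]real_normK ?num_real// lerXn2r ?nnegrE ?mulr_ge0//; [exact: ltW|].
      apply: le_trans (ler_normB _ _) _; rewrite mulr_natl mulr2n lerD// gM//; last first.
        by rewrite ax (le_trans xb)// lerDl.
      rewrite (le_trans ax) ?lerDl//= lerD// (le_trans t2)// invf_le1//.
      by rewrite ler1n.
  move=> /cvgrPdist_lt/(_ _ e9)[N _ /(_ N)]/(_ (leqnn N)) /=.
  rewrite ig0.
  rewrite sub0r normrN => /(le_lt_trans (ler_norm _)).
  by have [_] := ht N; move=> /lt_trans/[apply]; rewrite ltxx.
exists (Num.min d 1); split; first by rewrite lt_min d0 ltr01.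
move=> t /andP[t0]; rewrite le_min => /andP[td t1].
have [ab|ba] := leP a b; last by rewrite ig_gt// ltW.
have hg1 : ig a b (fun x => (f x - g x) ^+ 2) <= e / 9.
  apply: le_trans hg; rewrite (@ig_split _ a b (b + 1) _ (L2loc_sqr hfg)); last by apply/andP; split; lra.
  by rewrite lerDl; apply: ig_ge0 => x _; exact: sqr_ge0.
have hg3 : ig a b (fun x => (f (x + t) - g (x + t)) ^+ 2) <= e / 9.
  rewrite (@ig_shift _ a b (fun x => (f x - g x) ^+ 2)); last exact: L2loc_sqr.
  have i2 := L2loc_sqr hfg.
  apply: le_trans hg; rewrite (@ig_split _ a (a + t) (b + 1) _ i2); last by apply/andP; split; lra.
  rewrite (@ig_split _ (a + t) (b + t) (b + 1) _ i2); last by apply/andP; split; lra.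
  by rewrite addrCA lerDl addr_ge0//; apply: ig_ge0 => x _; exact: sqr_ge0.
have i1 : L1loc (fun x => 3 * (f (x + t) - g (x + t)) ^+ 2).
  by apply: L1locZ; apply: (L1loc_shift t (L2loc_sqr hfg)).
have i2 : L1loc (fun x => 3 * (f x - g x) ^+ 2) by apply: L1locZ; exact: L2loc_sqr.
have i3 : L1loc (fun x => (g (x + t) - g x) ^+ 2).
  by apply: L2loc_sqr; apply: L2locB => //; exact: L2loc_shift.
apply: (@le_trans _ _ (ig a b (fun x => 3 * (f (x + t) - g (x + t)) ^+ 2 +
    3 * (f x - g x) ^+ 2 + 3 * (g (x + t) - g x) ^+ 2))).
  apply: ig_le.
  - by apply: L2loc_sqr; apply: L2locB => //; exact: L2loc_shift.
  - by apply: L1locD; [exact: L1locD|exact: L1locZ].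
  move=> x _; set p := f (x + t) - g (x + t); set q := f x - g x; set r := g (x + t) - g x.
  have -> : f (x + t) - f x = p - q + r by rewrite /p /q /r; ring.
  have := sqr_ge0 (p + q); have := sqr_ge0 (p - r); have := sqr_ge0 (q + r); nra.
rewrite igD; [|exact: L1locD|exact: L1locZ].
rewrite igD// !igZ//; first by have := hd t; rewrite t0 td => /(_ isT); lra.
- exact: L2loc_sqr.
- exact: (L1loc_shift t (L2loc_sqr hfg)).
Qed.

(** The moving average minus [f x] is the mean over [s] of [f (x + s) - f x]. By Cauchy-Schwarz its
    square is at most the mean of the squares, and Tonelli turns the integral in [x] into a mean
    over [s] of quantities at most [e]. *)
Lemma ig_average f a b t e : L2loc f -> 0 < t -> 0 <= e ->
  (forall s, 0 <= s <= t -> ig a b (fun x => (f (x + s) - f x) ^+ 2) <= e) ->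
  ig a b (fun x => (t^-1 * ig x (x + t) f - f x) ^+ 2) <= e.
Proof.
move=> hf t0 e0 he; have hf1 := L2loc_L1 hf.
have mf : measurable_fun [set: R] f by case: hf.
have hF : L2loc (fun x => t^-1 * ig x (x + t) f - f x).
  apply: L2locB => //; apply: L2locZ.
  rewrite (_ : (fun x => _) = fun x => prim f (x + t) - prim f x); last first.
    by apply/funext => x; rewrite igE// lerDl ltW.
  apply: L2locB; last exact/cont_L2loc/prim_continuous.
  exact: (L2loc_shift t (cont_L2loc (prim_continuous hf1))).
have hF2 := L2loc_sqr hF.
pose H (z : R * R) := (t^-1 * ((f (z.1 + z.2) - f z.1) ^+ 2 * \1_(`[a, b]%classic : set R) z.1 *
   \1_(`[0, t]%classic : set R) z.2))%:E.
have mH : measurable_fun [set: R * R] H.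
  apply/measurable_EFinP; apply: measurable_funM => //.
  apply: measurable_funM; last first.
    by apply: measurableT_comp => //; exact: measurable_indic.
  apply: measurable_funM; last first.
    by apply: measurableT_comp => //; exact: measurable_indic.
  apply: measurable_funX; apply: measurable_funB.
    by apply: measurableT_comp mf _; exact: measurable_funD.
  by apply: measurableT_comp mf _.
have H0 z : (0 <= H z)%E.
  rewrite /H lee_fin !indicE; apply: mulr_ge0; first by rewrite invr_ge0 ltW.
  by apply: mulr_ge0 => //; apply: mulr_ge0 => //; exact: sqr_ge0.
have h1 : (\int[mu]_(x in `[a, b]) ((t^-1 * ig x (x + t) f - f x) ^+ 2)%:E <=
  \int[mu]_x \int[mu]_s H (x, s))%E.
  rewrite integral_mkcond; apply: ge0_le_integral => //.
  - by move=> x _; rewrite patchE; case: ifP => // _; rewrite lee_fin sqr_ge0.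
  - apply/(measurable_restrictT _ _).1 => //; apply/measurable_EFinP/measurable_funTS.
    by case: hF2.
  - exact: (@measurable_fun_fubini_tonelli_F _ _ _ _ R mu H).
  - move=> x _; rewrite patchE mem_setE; case: ifPn => xab; last first.
      by apply: integral_ge0.
    have hfx : L2loc (fun s => f (x + s) - f x).
      apply: L2locB; last by apply: cont_L2loc => y; exact: cst_continuous.
      by under eq_fun do rewrite addrC; exact: L2loc_shift.
    have i2 := L2loc_sqr hfx.
    have -> : (\int[mu]_s H (x, s) = (t^-1 * ig 0 t (fun s => (f (x + s) - f x) ^+ 2))%:E)%E.
      transitivity (\int[mu]_(s in `[0%R, t]) (t^-1 * (f (x + s) - f x) ^+ 2)%:E)%E.
        rewrite [RHS]integral_mkcond; apply: eq_integral => s _.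
        rewrite patchE /H /= !indicE !mem_setE xab mulr1.
        by case: ifPn; rewrite ?mulr1 ?mulr0.
      rewrite -igZ// /ig /Rintegral fineK//.
      by apply: integrable_fin_num => //; case: (L1locZ t^-1 i2).
    rewrite lee_fin.
    have -> : t^-1 * ig x (x + t) f - f x = t^-1 * ig 0 t (fun s => f (x + s) - f x).
      rewrite igB; first last.
        - by apply: cont_L1loc => y; exact: cst_continuous.
        - by under eq_fun do rewrite addrC; exact: L1loc_shift.
      rewrite ig_cst ?(ltW t0)// subr0.
      have -> : ig 0 t (fun s => f (x + s)) = ig x (x + t) f.
        under [X in ig _ _ X]eq_fun do rewrite addrC.
        by rewrite ig_shift// add0r addrC.
      by field; rewrite gt_eqF.
    rewrite exprMn; have := ig_CS (ltW t0) hfx; rewrite subr0 => h.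
    apply: (@le_trans _ _ (t^-1 ^+ 2 * (t * ig 0 t (fun s => (f (x + s) - f x) ^+ 2)))).
      by rewrite ler_wpM2l ?sqr_ge0.
    by rewrite le_eqVlt; apply/orP; left; apply/eqP; field; rewrite gt_eqF.
have h2 : (\int[mu]_x \int[mu]_s H (x, s) <= e%:E)%E.
  rewrite fubini_tonelli//.
  apply: (@le_trans _ _ (\int[mu]_(s in `[0%R, t]) (t^-1 * e)%:E)%E); last first.
    rewrite integral_cst//= lebesgue_measure_itv/= lte_fin t0 oppr0 adde0 -EFinM lee_fin.
    by rewrite mulrAC mulVf ?mul1r// gt_eqF.
  rewrite [leRHS]integral_mkcond; apply: ge0_le_integral => //.
  - by move=> s _; apply: integral_ge0.
  - exact: (@measurable_fun_fubini_tonelli_G _ _ _ _ R mu H).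
  - by apply/(measurable_restrictT _ _).1 => //; exact: measurable_cst.
  - move=> s _; rewrite patchE mem_setE; case: ifPn => st; last first.
      rewrite integral0_eq// => x _; rewrite /H /= !indicE (_ : (s \in `[0, t]%classic) = false) ?mulr0//; last by rewrite mem_setE; exact: negbTE.
    have hfs : L2loc (fun x => f (x + s) - f x) by apply: L2locB => //; exact: L2loc_shift.
    have i2 := L2loc_sqr hfs.
    have -> : (\int[mu]_x H (x, s) = (t^-1 * ig a b (fun x => (f (x + s) - f x) ^+ 2))%:E)%E.
      rewrite -igZ// /ig /Rintegral fineK; last first.
        by apply: integrable_fin_num => //; case: (L1locZ t^-1 i2).
      rewrite [RHS]integral_mkcond; apply: eq_integral => x _.
      rewrite patchE /H /= !indicE !mem_setE st mulr1.
      by case: ifPn; rewrite ?mulr1 ?mulr0.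
    by rewrite lee_fin ler_wpM2l ?invr_ge0 ?(ltW t0)// he//; move: st; rewrite in_itv.
rewrite /ig /Rintegral -lee_fin fineK.
  exact: le_trans h1 h2.
by apply: integrable_fin_num => //; case: hF2.
Qed.

End Primitives.

(** * Scalar derivatives and a Gronwall inequality with decaying source *)

Section Derivatives.
Context (R : realType).
Implicit Types (f g : R -> R) (x a b : R).

Lemma derD f g x a b : is_derive x (1 : R) f a -> is_derive x (1 : R) g b ->
  is_derive x (1 : R) (fun y => f y + g y) (a + b).
Proof. by move=> h1 h2; exact: (is_deriveD h1 h2). Qed.

Lemma derM f g x a b : is_derive x (1 : R) f a -> is_derive x (1 : R) g b ->
  is_derive x (1 : R) (fun y => f y * g y) (a * g x + f x * b).
Proof.
move=> h1 h2; apply: is_derive_eq (is_deriveM h1 h2) _.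
by rewrite /GRing.scale/= addrC mulrC.
Qed.

Lemma derZ f x (k : R) a : is_derive x (1 : R) f a -> is_derive x (1 : R) (fun y => k * f y) (k * a).
Proof. by move=> h; exact: (is_deriveZ k h). Qed.

Lemma der_sum n (f : 'I_n -> R -> R) x (a : 'I_n -> R) :
  (forall i, is_derive x (1 : R) (f i) (a i)) ->
  is_derive x (1 : R) (fun y => \sum_i f i y) (\sum_i a i).
Proof.
move=> h; rewrite (_ : (fun y => _) = \sum_i f i); first exact: is_derive_sum.
by apply/funext => y; rewrite fct_sumE.
Qed.

Lemma der_exp (k x : R) : is_derive x (1 : R) (fun y => expR (k * y)) (k * expR (k * x)).
Proof.
have h : is_derive x (1 : R) (fun y : R => k * y) (k * 1) by exact: derZ.
apply: is_derive_eq (is_derive1_comp (is_derive_expR _) h) _.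
by rewrite mulr1 mulrC.
Qed.

Lemma der_cont f (f' : R -> R) : (forall x, is_derive x (1 : R) f (f' x)) -> continuous f.
Proof.
move=> df x; apply: differentiable_continuous; apply/derivable1_diffP.
by have [] := df x.
Qed.

Lemma der_noninc f (f' : R -> R) : (forall x, is_derive x (1 : R) f (f' x)) ->
  (forall x, 0 <= x -> f' x <= 0) -> forall t, 0 <= t -> f t <= f 0.
Proof.
move=> df f0 t t0; rewrite -subr_le0.
have [|c] := @MVT_segment R f f' 0 t t0 (fun x _ => df x).
  by apply: continuous_subspaceT; exact: der_cont df.
rewrite in_itv/= => /andP[c0 _] ->.
by rewrite subr0 mulr_le0_ge0// f0.
Qed.

(** The function [expR (v * x) * f x] plus a multiple of [expR (- (w - v) * x)] is nonincreasing.
    Halving the minimum keeps [w - v] at least [w / 2], which covers the resonant case [rho = w].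
    The value of [v] is part of the conclusion so that the rate is visibly independent of [f]. *)
Lemma gronwall_decay f (f' : R -> R) (rho D w : R) : 0 < rho -> 0 < w -> 0 <= D ->
  (forall x, is_derive x (1 : R) f (f' x)) -> (forall x, 0 <= f x) ->
  (forall x, 0 <= x -> f' x <= - rho * f x + D * expR (- w * x)) ->
  exists v : R, [/\ 0 < v, v = Num.min rho w / 2 & forall t, 0 <= t ->
    f t <= expR (- v * t) * (f 0 + D / (w / 2))].
Proof.
move=> rho0 w0 D0 df f0 hf; set v := Num.min rho w / 2.
have m0 : 0 < Num.min rho w by rewrite lt_min rho0.
have mr : Num.min rho w <= rho by rewrite ge_min lexx.
have mw : Num.min rho w <= w by rewrite ge_min lexx orbT.
have v0 : 0 < v by rewrite divr_gt0.
have vr : v <= rho by rewrite /v; lra.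
have vw : w / 2 <= w - v by rewrite /v; lra.
have w2 : 0 < w - v by lra.
exists v; split => // t t0.
pose g x := expR (v * x) * f x + D / (w - v) * expR (- (w - v) * x).
pose g' x := (v * expR (v * x) * f x + expR (v * x) * f' x) + D / (w - v) * (- (w - v) * expR (- (w - v) * x)).
have dg x : is_derive x (1 : R) g (g' x).
  by apply: derD; [apply: derM => //; exact: der_exp|apply: derZ; exact: der_exp].
have g'0 x : 0 <= x -> g' x <= 0.
  move=> x0; rewrite /g'.
  have -> : D / (w - v) * (- (w - v) * expR (- (w - v) * x)) = - (expR (v * x) * (D * expR (- w * x))).
    rewrite (_ : expR (- (w - v) * x) = expR (v * x) * expR (- w * x)); last by rewrite -expRD; congr expR; ring.
    by field; rewrite gt_eqF.
  have -> : v * expR (v * x) * f x = expR (v * x) * (v * f x) by ring.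
  rewrite -mulrDr -mulrBr pmulr_rle0 ?expR_gt0//.
  have := hf x x0; have := ler_wpM2r (f0 x) vr; lra.
have := der_noninc dg g'0 t0; rewrite /g !mulr0 expR0 !mul1r mulr1 => h.
have h1 : 0 <= D / (w - v) * expR (- (w - v) * t) by rewrite mulr_ge0 ?expR_ge0// divr_ge0// ltW.
have h2 : D / (w - v) <= D / (w / 2).
  by rewrite ler_wpM2l// lef_pV2 ?posrE// divr_gt0.
rewrite mulNr expRN -ler_pdivrMl ?invr_gt0 ?expR_gt0// invrK; lra.
Qed.

End Derivatives.

(** * The wave equation as a difference equation *)

Section Delay.
Context (R : realType) (al be : R).
Hypotheses (al0 : 0 < al) (be0 : 0 < be).
Implicit Types (psi a u : R -> R).

(* A wave w driven at x = 1 by w_x = - al w - be w_t + u is encoded by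
   a t = w(1,t) and by one function psi carrying both Riemann invariants:
   psi (t + x) = w_t + w_x and psi (t - x) = w_t - w_x at (x,t), which agree at
   x = 0 since w_x(0,t) = 0. Then slope is w_t(1,t), and the boundary condition
   at x = 1 becomes the recursion in delay_sol. *)
Definition slope psi a u (s : R) : R := (1 + be)^-1 * (psi (s - 1) - al * a s + u s).

Definition delay_sol u psi a :=
  [/\ L2loc psi, continuous a,
      forall t, 0 <= t -> a t = a 0 + ig 0 t (slope psi a u) &
      forall t, 0 <= t -> psi (t + 1) =
        (1 - be) / (1 + be) * psi (t - 1) + 2 / (1 + be) * (u t - al * a t)].

(** Half the squared wave norm: w_t^2 + w_x^2 is half the sum of the squares of the two invariants,
    and at time [t] these fill the interval from [t - 1] to [t + 1]. *)
Definition energy psi a (t : R) :=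
  4^-1 * ig (t - 1) (t + 1) (fun x => psi x ^+ 2) + al / 2 * a t ^+ 2.

Let be1 : 1 + be != 0. Proof. by rewrite gt_eqF// addr_gt0. Qed.

Lemma slope_L2 psi a u : continuous u -> L2loc psi -> continuous a ->
  L2loc (slope psi a u).
Proof.
move=> cu hp ca; apply: L2locZ; apply: L2locD; last exact: cont_L2loc.
apply: L2locB; last by apply: L2locZ; exact: cont_L2loc.
exact: (L2loc_shift (-1) hp).
Qed.

(** Here and in [slope_out]: the invariants w_t - w_x arriving at x = 1 and w_t + w_x leaving it,
    with w_x eliminated by the boundary condition. *)
Lemma slope_in psi a u s :
  psi (s - 1) = (1 + be) * slope psi a u s + al * a s - u s.
Proof. by rewrite /slope; field. Qed.

Lemma slope_out u psi a s : delay_sol u psi a -> 0 <= s ->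
  psi (s + 1) = (1 - be) * slope psi a u s - al * a s + u s.
Proof. by move=> [_ _ _ h] /h ->; rewrite /slope; field. Qed.

Lemma energy_ge0 psi a t : 0 <= energy psi a t.
Proof.
apply: addr_ge0; apply: mulr_ge0; rewrite ?sqr_ge0 ?invr_ge0 ?divr_ge0 ?(ltW al0)//.
by apply: ig_ge0 => x _; exact: sqr_ge0.
Qed.

(** Energy crosses x = 1 only, at the rate w_t w_x, which is a quarter of the difference of the
    squares of the outgoing and the incoming invariant. The part [- al * a * slope] of this rate is
    compensated by the growth of [al / 2 * a ^+ 2]. *)
Lemma energyE u psi a T : continuous u -> delay_sol u psi a -> 0 <= T ->
  energy psi a T = energy psi a 0 +
    ig 0 T (fun s => u s * slope psi a u s - be * slope psi a u s ^+ 2).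
Proof.
move=> cu hs T0; have [hp ca ha hpsi] := hs.
have hb := slope_L2 cu hp ca; set b := slope psi a u in hb *.
have hb1 := L2loc_L1 hb; have hb2 := L2loc_sqr hb.
have haE x : 0 <= x <= T -> a x = a 0 + ig 0 x b by move=> /andP[x0 _]; exact: ha.
have hp2 := L2loc_sqr hp.
have hab : L1loc (fun s => b s * a s) by exact: L1locM_cont.
have hbu : L1loc (fun s => u s * b s).
  by under eq_fun do rewrite mulrC; exact: L1locM_cont.
have h1 : a T ^+ 2 = a 0 ^+ 2 + 2 * ig 0 T (fun s => b s * a s).
  rewrite !expr2 (ig_parts T0 hb1 hb1 haE haE) -igZ//; congr (_ + _).
  by apply: ig_eq => x _; ring.
have hm : L1loc (fun s => psi (s - 1) ^+ 2) by exact: (L1loc_shift (-1) hp2).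
have hpl : L1loc (fun s => psi (s + 1) ^+ 2) by exact: (L1loc_shift 1 hp2).
have h2 : ig (T - 1) (T + 1) (fun x => psi x ^+ 2) =
   ig (0 - 1) (0 + 1) (fun x => psi x ^+ 2) +
   ig 0 T (fun s => psi (s + 1) ^+ 2 - psi (s - 1) ^+ 2).
  rewrite igB// (@ig_shift _ 0 T (fun x => psi x ^+ 2))//.
  rewrite (@ig_shift _ 0 T (fun x => psi x ^+ 2))//.
  by rewrite !igE//; [ring|lra..].
have h3 : 4^-1 * ig 0 T (fun s => psi (s + 1) ^+ 2 - psi (s - 1) ^+ 2) +
   al * ig 0 T (fun s => b s * a s) = ig 0 T (fun s => u s * b s - be * b s ^+ 2).
  rewrite -(igZ _ _ _ (L1locB hpl hm)) -(igZ _ _ _ hab) -igD; [|by apply: L1locZ; exact: L1locB|exact: L1locZ].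
  apply: ig_eq => s /andP[s0 _].
  rewrite (slope_in psi a u) (slope_out hs s0) -/b.
  by field.
by rewrite -h3 /energy h1 h2; field.
Qed.

(** As a function of [b], the rate [u * b - be * b ^+ 2] is largest at [b = u / (2 * be)], with
    value [u ^+ 2 / (4 * be)]. *)
Lemma energy_bound u psi a T : continuous u -> delay_sol u psi a -> 0 <= T ->
  energy psi a T <= energy psi a 0 + (4 * be)^-1 * ig 0 T (fun s => u s ^+ 2).
Proof.
move=> cu hs T0; have [hp ca ha hpsi] := hs.
have hb := slope_L2 cu hp ca; have hb2 := L2loc_sqr hb.
have hu2 := L2loc_sqr (cont_L2loc cu).
rewrite (energyE cu hs T0) lerD2l -igZ//; apply: ig_le.
- apply: L1locB; last exact: L1locZ.
  under eq_fun do rewrite mulrC; apply: L1locM_cont cu; exact: L2loc_L1.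
- exact: L1locZ.
move=> s _; set b := slope psi a u s.
rewrite -subr_ge0.
have -> : (4 * be)^-1 * u s ^+ 2 - (u s * b - be * b ^+ 2) = be * (b - u s / (2 * be)) ^+ 2.
  by field; rewrite gt_eqF.
by rewrite mulr_ge0 ?sqr_ge0 ?ltW.
Qed.

(* Eliminating psi (s + 1) between slope_out at s and slope_in at s + 2 expresses
   a s through the slope b and the input u alone: see keyA below. *)
Lemma observability : exists C : R, 0 < C /\ forall u psi a, continuous u ->
  delay_sol u psi a -> energy psi a 0 <=
    C * (ig 0 4 (fun s => slope psi a u s ^+ 2) + ig 0 4 (fun s => u s ^+ 2)).
Proof.
(* [C1] squares the five-term identity [keyA] (factor 5) and divides by [(2 * al) ^+ 2]; [C2]
   squares the three-term identity [slope_in] (factor 3) and inserts [C1] for the integral of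
   [a ^+ 2]. *)
pose C1 : R := 5 / (4 * al ^+ 2) * ((1 - be) ^+ 2 + (1 + be) ^+ 2 + 4 * al ^+ 2 + 2).
pose C2 : R := 3 * ((1 + be) ^+ 2 + al ^+ 2 * C1 + 1).
have C10 : 0 < C1.
  apply: mulr_gt0; first by rewrite divr_gt0 ?mulr_gt0 ?exprn_gt0.
  have := sqr_ge0 (1 - be); have := sqr_ge0 (1 + be); have := sqr_ge0 al; lra.
have C20 : 0 < C2.
  have h : 0 <= al ^+ 2 * C1 by rewrite mulr_ge0 ?sqr_ge0// ltW.
  have := sqr_ge0 (1 + be); rewrite /C2; lra.
exists (4^-1 * C2 + al / 2 * (C1 + 4)); split.
  by rewrite addr_gt0// mulr_gt0 ?divr_gt0// addr_gt0.
move=> u psi a cu hs; have [hp ca ha hpsi] := hs.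
have hb := slope_L2 cu hp ca; set b := slope psi a u in hb *.
have hb1 := L2loc_L1 hb; have hb2 := L2loc_sqr hb.
have hu2 := L2loc_sqr (cont_L2loc cu); have ha2 := L2loc_sqr (cont_L2loc ca).
have hp2 := L2loc_sqr hp.
set B := ig 0 4 (fun s => b s ^+ 2); set U := ig 0 4 (fun s => u s ^+ 2).
have hcst (c : R) : L1loc (fun=> c) by apply: cont_L1loc => x; exact: cst_continuous.
have sq0 f x y : 0 <= ig x y (fun s => f s ^+ 2 : R).
  by apply: ig_ge0 => s _; exact: sqr_ge0.
have sub f x y : L1loc (fun s => f s ^+ 2) -> 0 <= x -> x <= y -> y <= 4 ->
    ig x y (fun s => f s ^+ 2) <= ig 0 4 (fun s => f s ^+ 2 : R).
  move=> hf x0 xy y4; rewrite (@ig_split _ 0 x 4 _ hf); last by rewrite x0 (le_trans xy).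
  rewrite (@ig_split _ x y 4 _ hf) ?xy//.
  by have := sq0 f 0 x; have := sq0 f y 4; lra.
have B0 : 0 <= B by exact: sq0.
have U0 : 0 <= U by exact: sq0.
have hI s : 0 <= s <= 2 -> (ig s (s + 2) b) ^+ 2 <= 2 * B.
  move=> /andP[s0 s2]; apply: le_trans (ig_CS _ hb) _; first lra.
  have -> : s + 2 - s = 2 by ring.
  by rewrite ler_wpM2l// sub//; lra.
have keyA s : 0 <= s <= 2 -> 2 * al * a s = (1 - be) * b s - (1 + be) * b (s + 2)
    - al * ig s (s + 2) b + u s + u (s + 2).
  move=> /andP[s0 s2].
  have e1 := slope_out hs s0; have e2 := slope_in psi a u (s + 2).
  have e3 : a (s + 2) = a s + ig s (s + 2) b.
    rewrite ha ?addr_ge0// (ha s)// -/b (@ig_split _ 0 s (s + 2)) ?addrA//.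
    by apply/andP; split; lra.
  have e4 : s + 2 - 1 = s + 1 by ring.
  rewrite e4 in e2; rewrite e2 e3 -/b in e1; lra.
have hA : ig 0 2 (fun s => a s ^+ 2) <= C1 * (B + U).
  apply: (@le_trans _ _ (ig 0 2 (fun s => 5 / (4 * al ^+ 2) * ((1 - be) ^+ 2 * b s ^+ 2 +
     (1 + be) ^+ 2 * b (s + 2) ^+ 2 + u s ^+ 2 + u (s + 2) ^+ 2 + 2 * al ^+ 2 * B)))).
    apply: ig_le => //.
      apply: L1locZ; apply: L1locD => //; apply: L1locD; last exact: (L1loc_shift 2 hu2).
      apply: L1locD => //; apply: L1locD; first exact: L1locZ.
      apply: L1locZ; exact: (L1loc_shift 2 hb2).
    move=> s s02; have := keyA s s02; have := hI s s02.
    set I := ig s _ _; set x1 := b s; set x2 := b (s + 2); set x3 := u s; set x4 := u (s + 2) => hI' hk.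
    rewrite mulrAC ler_pdivlMr ?mulr_gt0 ?exprn_gt0//.
    have -> : a s ^+ 2 * (4 * al ^+ 2) = (2 * al * a s) ^+ 2 by ring.
    rewrite hk; set y1 := (1 - be) * x1; set y2 := (1 + be) * x2; set y3 := al * I.
    have -> : (1 - be) ^+ 2 * x1 ^+ 2 = y1 ^+ 2 by rewrite /y1; ring.
    have -> : (1 + be) ^+ 2 * x2 ^+ 2 = y2 ^+ 2 by rewrite /y2; ring.
    have y3l : y3 ^+ 2 <= 2 * al ^+ 2 * B.
      by have := ler_wpM2l (sqr_ge0 al) hI'; rewrite /y3 exprMn; lra.
    apply: (@le_trans _ _ (5 * (y1 ^+ 2 + y2 ^+ 2 + x3 ^+ 2 + x4 ^+ 2 + y3 ^+ 2))); last lra.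
    have := sqr_ge0 (y1 + y2); have := sqr_ge0 (y1 + y3); have := sqr_ge0 (y1 - x3).
    have := sqr_ge0 (y1 - x4); have := sqr_ge0 (y2 - y3); have := sqr_ge0 (y2 + x3).
    have := sqr_ge0 (y2 + x4); have := sqr_ge0 (y3 + x3); have := sqr_ge0 (y3 + x4).
    have := sqr_ge0 (x3 - x4); lra.
  have hbs : L1loc (fun s => b (s + 2) ^+ 2) by exact: (L1loc_shift 2 hb2).
  have hus : L1loc (fun s => u (s + 2) ^+ 2) by exact: (L1loc_shift 2 hu2).
  rewrite igZ; last first.
    by apply: L1locD => //; apply: L1locD => //; apply: L1locD => //; apply: L1locD; exact: L1locZ.
  rewrite igD//; last by apply: L1locD => //; apply: L1locD => //; apply: L1locD; exact: L1locZ.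
  rewrite igD//; last by apply: L1locD => //; apply: L1locD; exact: L1locZ.
  rewrite igD//; last by apply: L1locD; exact: L1locZ.
  rewrite igD; [|exact: L1locZ|exact: L1locZ].
  rewrite !igZ// ig_cst// (@ig_shift _ 0 2 (fun s => b s ^+ 2))// (@ig_shift _ 0 2 (fun s => u s ^+ 2))//.
  rewrite /C1 -[leRHS]mulrA ler_wpM2l//; first by rewrite divr_ge0// mulr_ge0// sqr_ge0.
  have g1 := sub b 0 2 hb2; have g2 := sub b (0 + 2) (2 + 2) hb2.
  have g3 := sub u 0 2 hu2; have g4 := sub u (0 + 2) (2 + 2) hu2.
  have {}g1 : ig 0 2 (fun s => b s ^+ 2) <= B by apply: g1; lra.
  have {}g2 : ig (0 + 2) (2 + 2) (fun s => b s ^+ 2) <= B by apply: g2; lra.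
  have {}g3 : ig 0 2 (fun s => u s ^+ 2) <= U by apply: g3; lra.
  have {}g4 : ig (0 + 2) (2 + 2) (fun s => u s ^+ 2) <= U by apply: g4; lra.
  have k1 := ler_wpM2l (sqr_ge0 (1 - be)) g1.
  have k2 := ler_wpM2l (sqr_ge0 (1 + be)) g2.
  have k3 : 0 <= ((1 - be) ^+ 2 + (1 + be) ^+ 2 + 4 * al ^+ 2) * U.
    apply: mulr_ge0 => //.
    by have := sqr_ge0 (1 - be); have := sqr_ge0 (1 + be); have := sqr_ge0 al; lra.
  lra.
have hB : ig (0 - 1) (0 + 1) (fun s => psi s ^+ 2) <= C2 * (B + U).
  have -> : ig (0 - 1) (0 + 1) (fun s => psi s ^+ 2) = ig 0 2 (fun s => psi (s - 1) ^+ 2).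
    by rewrite (@ig_shift _ 0 2 (fun s => psi s ^+ 2))//; congr (ig _ _ _); ring.
  apply: (@le_trans _ _ (ig 0 2 (fun s => 3 * ((1 + be) ^+ 2 * b s ^+ 2 + al ^+ 2 * a s ^+ 2 + u s ^+ 2)))).
    apply: ig_le.
    - exact: (L1loc_shift (-1) hp2).
    - by apply: L1locZ; apply: L1locD => //; apply: L1locD; exact: L1locZ.
    - move=> s _; rewrite (slope_in psi a u) -/b.
      rewrite -!exprMn; set x := (1 + be) * b s; set y := al * a s; set z := u s.
      have := sqr_ge0 (x - y); have := sqr_ge0 (x + z); have := sqr_ge0 (y + z); nra.
  rewrite igZ; last by apply: L1locD => //; apply: L1locD; exact: L1locZ.
  rewrite igD//; last by apply: L1locD; exact: L1locZ.
  rewrite igD ?igZ//; [|exact: L1locZ|exact: L1locZ].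
  have g1 : ig 0 2 (fun s => b s ^+ 2) <= B by apply: sub => //; lra.
  have g3 : ig 0 2 (fun s => u s ^+ 2) <= U by apply: sub => //; lra.
  have k1 := ler_wpM2l (sqr_ge0 (1 + be)) g1.
  have k2 := ler_wpM2l (sqr_ge0 al) hA.
  have k3 : 0 <= (1 + be) ^+ 2 * U by rewrite mulr_ge0 ?sqr_ge0.
  rewrite /C2; lra.
(* Averaging over [[0, 2]]: there [a 0] differs from [a s] by an integral of the slope, whose square
   is at most [2 * B]. *)
have hC : a 0 ^+ 2 <= (C1 + 4) * (B + U).
  have : ig 0 2 (fun=> a 0 ^+ 2) <= ig 0 2 (fun s => 2 * a s ^+ 2 + 4 * B).
    apply: ig_le => //; first by apply: L1locD => //; exact: L1locZ.
    move=> s /andP[s0 s2].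
    have -> : a 0 = a s - ig 0 s b by rewrite (ha s)// addrK.
    have h := ig_CS s0 hb; rewrite subr0 in h.
    have {}h : (ig 0 s b) ^+ 2 <= 2 * B.
      apply: le_trans h _; apply: ler_pM => //; apply: sub => //; lra.
    have := sqr_ge0 (a s + ig 0 s b); lra.
  rewrite ig_cst// igD// ?igZ ?ig_cst//; last exact: L1locZ.
  by rewrite subr0; lra.
rewrite /energy.
have k := ler_wpM2l (ltW (divr_gt0 al0 (ltr0n R 2))) hC.
lra.
Qed.

(** Half of the dissipation absorbs the input through [u * b <= u ^+ 2 / (2 * be) + be / 2 * b ^+
    2]; by observability the other half dominates a fixed fraction of the initial energy, up to the
    input. Enlarging the observability constant to [D = C + be] ensures that [q] is nonnegative. *)
Lemma energy_contract : exists q C : R, [/\ 0 <= q < 1, 0 <= C &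
  forall u psi a, continuous u -> delay_sol u psi a ->
    energy psi a 4 <= q * energy psi a 0 + C * ig 0 4 (fun s => u s ^+ 2)].
Proof.
have [C [C0 hC]] := observability.
pose D := C + be; have D0 : 0 < D by rewrite addr_gt0.
exists (1 - be / (2 * D)), (be / 2 + (2 * be)^-1); split.
- have D2 : 0 < 2 * D by rewrite mulr_gt0.
  apply/andP; split; last by rewrite gtrBl divr_gt0.
  have h2 : 0 < be by []. have h : be <= 2 * (C + be) by lra.
  by rewrite subr_ge0 ler_pdivrMr// mul1r.
- by apply: addr_ge0; rewrite ?invr_ge0 ?divr_ge0 ?mulr_ge0 ?(ltW be0).
move=> u psi a cu hs; have [hp ca ha hpsi] := hs.
have hb := slope_L2 cu hp ca; set b := slope psi a u in hb *.
have hb1 := L2loc_L1 hb; have hb2 := L2loc_sqr hb.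
have hu2 := L2loc_sqr (cont_L2loc cu).
have ho := hC u psi a cu hs; rewrite -/b in ho.
set B := ig 0 4 (fun s => b s ^+ 2) in ho *; set U := ig 0 4 (fun s => u s ^+ 2) in ho *.
have T4 : 0 <= 4 :> R by [].
rewrite (energyE cu hs T4) -/b.
have h1 : ig 0 4 (fun s => u s * b s - be * b s ^+ 2) <= (2 * be)^-1 * U - be / 2 * B.
  rewrite -!igZ// -igB; [|exact: L1locZ|exact: L1locZ]; apply: ig_le.
  - apply: L1locB; last exact: L1locZ.
    by under eq_fun do rewrite mulrC; exact: L1locM_cont.
  - by apply: L1locB; exact: L1locZ.
  - move=> s _; rewrite -subr_ge0.
    set v := u s; set w := b s.
    have -> : (2 * be)^-1 * v ^+ 2 - be / 2 * w ^+ 2 - (v * w - be * w ^+ 2) =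
       be / 2 * (w - v / be) ^+ 2 by field; rewrite gt_eqF.
    by rewrite mulr_ge0 ?sqr_ge0 ?divr_ge0 ?ltW.
set E0 := energy psi a 0 in ho *.
have B0 : 0 <= B by apply: ig_ge0 => s _; exact: sqr_ge0.
have U0 : 0 <= U by apply: ig_ge0 => s _; exact: sqr_ge0.
have ho' : E0 <= D * (B + U).
  by apply: le_trans ho _; rewrite ler_wpM2r ?addr_ge0// /D lerDl ltW.
have : be / (2 * D) * E0 <= be / 2 * (B + U).
  have -> : be / 2 * (B + U) = be / (2 * D) * (D * (B + U)) by field; rewrite gt_eqF.
  by rewrite ler_wpM2l// divr_ge0 ?mulr_ge0 ?ltW.
lra.
Qed.

Lemma delay_shift u psi a t : continuous u -> delay_sol u psi a -> 0 <= t ->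
  delay_sol (fun s => u (s + t)) (fun s => psi (s + t)) (fun s => a (s + t)).
Proof.
move=> cu [hp ca ha hpsi] t0; split.
- exact: L2loc_shift.
- move=> s; apply: (@continuous_comp _ _ _ (fun s => s + t) a); last exact: ca.
  by apply: cvgD; [exact: cvg_id|exact: cvg_cst].
- move=> s s0; rewrite add0r ha ?addr_ge0// (ha t)//.
  have hb := L2loc_L1 (slope_L2 cu hp ca).
  rewrite (@ig_split _ 0 t (s + t))// ?t0 ?lerDr// -addrA; congr (_ + (_ + _)).
  rewrite -[X in ig X _ _](add0r t) -ig_shift//; apply: ig_eq => x _.
  by rewrite /slope (addrAC x t).
- by move=> s s0; rewrite addrAC hpsi ?addr_ge0// (addrAC s t).
Qed.

Lemma energy_shift psi a s t : L2loc psi ->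
  energy (fun x => psi (x + t)) (fun x => a (x + t)) s = energy psi a (s + t).
Proof.
move=> hp; rewrite /energy; congr (_ * _ + _).
rewrite (@ig_shift _ _ _ (fun x => psi x ^+ 2)); last exact: L2loc_sqr.
by rewrite ![s + _ + t]addrAC.
Qed.

Lemma delay_lin c u psi a u' psi' a' : continuous u -> continuous u' ->
  delay_sol u psi a -> delay_sol u' psi' a' ->
  delay_sol (fun s => c * u s + u' s) (fun s => c * psi s + psi' s)
    (fun s => c * a s + a' s).
Proof.
move=> cu cu' [hp ca ha hpsi] [hp' ca' ha' hpsi']; split.
- by apply: L2locD => //; exact: L2locZ.
- move=> s; apply: cvgD; last exact: ca'.
  by apply: cvgM; [exact: cvg_cst|exact: ca].
- move=> t t0; rewrite ha// ha'//.
  have hb := L2loc_L1 (slope_L2 cu hp ca).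
  have hb' := L2loc_L1 (slope_L2 cu' hp' ca').
  transitivity (c * a 0 + a' 0 + ig 0 t (fun s => c * slope psi a u s + slope psi' a' u' s)).
    by rewrite igD//; [rewrite igZ//; ring|exact: L1locZ].
  by congr (_ + _); apply: ig_eq => x _; rewrite /slope; ring.
- by move=> t t0; rewrite hpsi// hpsi'//; ring.
Qed.

(** The difference of the two solutions has zero input and zero initial energy, so [energy_bound]
    keeps its energy at 0, and both parts of the energy vanish. *)
Lemma delay_unique u psi a psi' a' t : continuous u ->
  delay_sol u psi a -> delay_sol u psi' a' ->
  a 0 = a' 0 -> aeon (-1) 1 (fun x => psi x = psi' x) -> 0 <= t ->
  a t = a' t /\ aeon (t - 1) (t + 1) (fun x => psi x = psi' x).
Proof.
move=> cu hs hs' a00 pp t0.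
have := delay_lin (-1) cu cu hs hs'.
set v := fun s => _; set p := fun s => _; set w := fun s => _ => h.
have v0 : v = fun=> 0 by apply/funext => s; rewrite /v; ring.
have cv : continuous v by rewrite v0 => s; exact: cst_continuous.
have [hp _ _ _] := h; have hp2 := L2loc_sqr hp.
have hcst (c : R) : L1loc (fun=> c) by apply: cont_L1loc => x; exact: cst_continuous.
have E00 : energy p w 0 = 0.
  rewrite /energy /w a00 (_ : -1 * a' 0 + a' 0 = 0); last ring.
  rewrite (_ : ig _ _ _ = 0); first by rewrite expr0n/=; ring.
  transitivity (ig (0 - 1) (0 + 1) (fun=> 0 : R)); last exact: ig0.
  apply: ig_ae => //.
  rewrite sub0r add0r; apply: aeonS pp => x _; rewrite /p => ->.
  by rewrite (_ : _ + _ = 0) ?expr0n//; ring.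
have := energy_bound cv h t0; rewrite E00 (_ : ig 0 t _ = 0); last first.
  by transitivity (ig 0 t (fun=> 0 : R)); [apply: ig_eq => x _; rewrite v0 expr0n|exact: ig0].
rewrite mulr0 addr0 -/p -/w => Et.
have e1 : 0 <= ig (t - 1) (t + 1) (fun x => p x ^+ 2).
  by apply: ig_ge0 => x _; exact: sqr_ge0.
have e2 : 0 <= al / 2 * w t ^+ 2 by rewrite mulr_ge0 ?sqr_ge0 ?divr_ge0 ?ltW.
rewrite /energy in Et; split.
  have /eqP : al / 2 * w t ^+ 2 = 0 by lra.
  rewrite mulf_eq0 mulf_eq0 invr_eq0 pnatr_eq0 (gt_eqF al0)/= expf_eq0/= /w => /eqP; lra.
have /ig_eq0_ae : ig (t - 1) (t + 1) (fun x => p x ^+ 2) = 0 by lra.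
move=> /(_ hp2 (fun x _ => sqr_ge0 _)); apply: aeonS => x _ /eqP.
by rewrite expf_eq0/= /p => /eqP; lra.
Qed.

(** The system is linear and autonomous, so it may be integrated in time. The last two hypotheses
    are the slope equation and the recursion at time 0, where [ka] is the value of the primitive at
    -1. *)
Lemma delay_primitive u u' psi' a' (ka w0 : R) : continuous u -> continuous u' ->
  (forall t, 0 <= t -> u t = u 0 + ig 0 t u') -> delay_sol u' psi' a' ->
  a' 0 = (1 + be)^-1 * (ka - al * w0 + u 0) ->
  ka + ig (-1) 1 psi' = (1 - be) / (1 + be) * ka + 2 / (1 + be) * (u 0 - al * w0) ->
  delay_sol u (fun x => ka + ig (-1) x psi') (fun t => w0 + ig 0 t a').
Proof.
move=> cu cu' uE [hp ca ha hpsi] bc1 bc2.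
have hp1 := L2loc_L1 hp; have hca := cont_L1loc ca; have hcu := cont_L1loc cu'.
have cc (c : R) (f : R -> R) : continuous f -> continuous (fun x => c + f x).
  by move=> cf x; apply: cvgD; [exact: cvg_cst|exact: cf].
have hpm : L1loc (fun s => psi' (s - 1)) by exact: L1loc_shift.
have hpp : L1loc (fun s => psi' (s + 1)) by exact: L1loc_shift.
have im t : 0 <= t -> ig (-1) (t - 1) psi' = ig 0 t (fun s => psi' (s - 1)).
  by move=> t0; rewrite ig_shift// sub0r.
split.
- by apply: cont_L2loc; apply: (cc ka (fun x => ig (-1) x psi')); exact: ig_continuous.
- by apply: (cc w0 (fun x => ig 0 x a')); exact: ig_continuous.
- move=> t t0; rewrite igxx addr0; congr (_ + _).
  apply: ig_eq => s /andP[s0 _]; rewrite (ha s)// bc1 /slope im// (uE s)//.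
  rewrite igZ; last by apply: L1locD => //; apply: L1locB => //; exact: L1locZ.
  rewrite igD//; last by apply: L1locB => //; exact: L1locZ.
  by rewrite igB ?igZ//; [ring|exact: L1locZ].
- move=> t t0; rewrite (@ig_split _ (-1) 1 (t + 1))//; last by apply/andP; split; lra.
  rewrite addrA bc2 im// (uE t)//.
  have -> : ig 1 (t + 1) psi' = ig 0 t (fun s => psi' (s + 1)) by rewrite ig_shift// add0r.
  have -> : ig 0 t (fun s => psi' (s + 1)) = ig 0 t (fun s =>
     (1 - be) / (1 + be) * psi' (s - 1) + 2 / (1 + be) * (u' s - al * a' s)).
    by apply: ig_eq => s /andP[s0 _]; exact: hpsi.
  rewrite igD; [|exact: L1locZ|by apply: L1locZ; apply: L1locB => //; exact: L1locZ].
  rewrite igZ// igZ; last by apply: L1locB => //; exact: L1locZ.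
  by rewrite igB ?igZ//; [ring|exact: L1locZ].
Qed.

End Delay.

(** * Existence for the delay system by the method of steps *)

Section Existence.
Context (R : realType) (al be : R).
Hypotheses (be0 : 0 < be).
Variables (phi u : R -> R) (w0 : R).
Hypotheses (hphi : L2loc phi) (cu : continuous u).
Implicit Types psi : R -> R.

Let be1 : 1 + be != 0. Proof. by rewrite gt_eqF// addr_gt0. Qed.
Let c := al / (1 + be).

(* Given psi on [-1, 1 + 2k), variation of constants gives the trace on
   [0, 2 + 2k) and the recursion then gives psi on [-1, 3 + 2k). *)
Let forcing psi s := expR (c * s) * ((1 + be)^-1 * (psi (s - 1) + u s)).
Let trace psi t := expR (- c * t) * (w0 + ig 0 t (forcing psi)).

Let expc_cont (k : R) : continuous (fun y => expR (k * y)).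
Proof. exact: (der_cont (der_exp k)). Qed.

Let forcing_L1 psi : L2loc psi -> L1loc (forcing psi).
Proof.
move=> hp; rewrite /forcing; under eq_fun do rewrite mulrC.
apply: L1locM_cont; last exact: expc_cont.
apply: L1locZ; apply: L2loc_L1; apply: L2locD; last exact: cont_L2loc.
exact: (L2loc_shift (-1) hp).
Qed.

Let trace_cont psi : L2loc psi -> continuous (trace psi).
Proof.
move=> hp x; apply: cvgM; first exact: expc_cont.
by apply: cvgD; [exact: cvg_cst|exact/ig_continuous/forcing_L1].
Qed.

(** The product rule for the exponential times the integral of [forcing], in integrated form since
    [forcing] is merely integrable. *)
Let traceE psi t : L2loc psi -> 0 <= t ->
  trace psi t = trace psi 0 + ig 0 t (slope al be psi (trace psi) u).
Proof.
move=> hp t0; have hf := forcing_L1 hp.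
have hc : L1loc (fun x => - c * expR (- c * x)).
  by apply: L1locZ; apply: cont_L1loc; exact: expc_cont.
have e1 x : 0 <= x <= t -> expR (- c * x) = expR (- c * 0) + ig 0 x (fun y => - c * expR (- c * y)).
  move=> /andP[x0 _]; apply: (FTC2 (der_exp (- c)) _ x0).
  by move=> y; apply: cvgM; [exact: cvg_cst|exact: expc_cont].
have e2 x : 0 <= x <= t -> w0 + ig 0 x (forcing psi) = w0 + ig 0 0 (forcing psi) + ig 0 x (forcing psi).
  by move=> _; rewrite igxx addr0.
rewrite /trace (ig_parts t0 hc hf e1 e2); congr (_ + _).
apply: ig_eq => x _; rewrite /slope /forcing /trace.
have -> : expR (- c * x) = (expR (c * x))^-1 by rewrite mulNr expRN.
set I := ig _ _ _; rewrite /c; field.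
by rewrite be1 gt_eqF ?expR_gt0.
Qed.

Let step psi y := if y < 1 then phi y else
  (1 - be) / (1 + be) * psi (y - 2) + 2 / (1 + be) * (u (y - 1) - al * trace psi (y - 1)).

Let step_L2 psi : L2loc psi -> L2loc (step psi).
Proof.
move=> hp; pose g y := (1 - be) / (1 + be) * psi (y - 2) + 2 / (1 + be) * (u (y - 1) - al * trace psi (y - 1)).
have hg : L2loc g.
  apply: L2locD; first by apply: L2locZ; exact: (L2loc_shift (-2) hp).
  apply: L2locZ; apply: L2locB; first exact: (L2loc_shift (-1) (cont_L2loc cu)).
  by apply: L2locZ; exact: (L2loc_shift (-1) (cont_L2loc (trace_cont hp))).
apply: L2loc_le (L1locD (L2loc_sqr hphi) (L2loc_sqr hg)) _.
  apply: measurable_fun_ifT; [exact: measurable_fun_ltr|by case: hphi|by case: hg].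
by move=> y; rewrite /step -/(g y); case: ifP => _; rewrite ?lerDl ?lerDr sqr_ge0.
Qed.

(** The recursion looks back by 2, directly and through the trace at [x - 1]. Hence every
    application of [step] makes two more units of time final, and the iterates stabilise
    pointwise. *)
Let step_causal psi psi' y : (forall x, x <= y -> psi x = psi' x) ->
  forall x, x <= y + 2 -> step psi x = step psi' x.
Proof.
move=> h x xy; rewrite /step; case: ifP => // _; rewrite h; last lra.
congr (_ + _ * (_ - _ * (_ * (_ + _)))); apply: ig_eq => s /andP[_ sx].
by rewrite /forcing h//; lra.
Qed.

Let psik k := iter k step phi.

Let psik_L2 k : L2loc (psik k).
Proof. by elim: k => [//|k ih]; exact: step_L2. Qed.

Let psikS k x : x < 1 + 2 * k%:R -> psik k.+1 x = psik k x.
Proof.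
elim: k x => [|k ih] x; first by rewrite mulr0 addr0 /= /step => ->.
rewrite -natr1 => xk; apply: (@step_causal _ _ (x - 2)); last by rewrite subrK.
by move=> y yx; apply: ih; lra.
Qed.

Let psik_stable k j x : x < 1 + 2 * k%:R -> (k <= j)%N -> psik j x = psik k x.
Proof.
move=> xk /subnK <-; elim: (j - k)%N => [//|m ih].
rewrite addSn psikS//; apply: lt_le_trans xk _.
by rewrite lerD2l ler_wpM2l// ler_nat leq_addl.
Qed.

(** At [x] every iterate of index [k] with [x < 1 + 2 * k] has its final value, and the integer part
    of [|x|] is such an index. *)
Let psi x := psik (Num.truncn `|x|) x.

Let psiE k x : x < 1 + 2 * k%:R -> psi x = psik k x.
Proof.
move=> xk; rewrite /psi; set m := Num.truncn _.
have xm : x < 1 + 2 * m%:R.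
  have /truncn_itv/andP[_] := normr_ge0 x; rewrite -/m -natr1 => h.
  have := ler_norm x; have : 0 <= m%:R :> R by []; lra.
have [km|/ltnW mk] := leqP k m; first exact: psik_stable.
by apply/esym; exact: psik_stable.
Qed.

Let bound (x : R) : x < 1 + 2 * (Num.truncn `|x|)%:R.
Proof.
have /truncn_itv/andP[_] := normr_ge0 x; rewrite -natr1 => h.
have := ler_norm x; have : 0 <= (Num.truncn `|x|)%:R :> R by []; lra.
Qed.

Let psi_step x : psi x = step psi x.
Proof.
have b := bound x; set k := Num.truncn _ in b.
rewrite (@psiE k.+1); last by rewrite -natr1; lra.
apply: (@step_causal _ _ (x - 2)); last by rewrite subrK.
by move=> y yx; rewrite (@psiE k)//; lra.
Qed.

Let psi_L2 : L2loc psi.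
Proof.
split.
  apply: (@measurable_fun_cvg _ _ _ _ psik) => //.
    by move=> k; case: (psik_L2 k).
  move=> x _; apply: cvg_near_cst; near=> k.
  rewrite (@psik_stable (Num.truncn `|x|))//.
  by near: k; exists (Num.truncn `|x|).
move=> a b; have [_ /(_ a b)] := psik_L2 (Num.truncn `|b|).
apply: eq_integrable => // x; rewrite inE/= in_itv/= => /andP[_ xb] /=.
by rewrite (@psiE (Num.truncn `|b|))// (le_lt_trans xb)// bound.
Unshelve. all: by end_near. Qed.

Lemma delay_existence : exists psi a,
  [/\ delay_sol al be u psi a, a 0 = w0 & aeon (-1) 1 (fun x => psi x = phi x)].
Proof.
exists psi, (trace psi); split.
- split.
  + exact: psi_L2.
  + exact: (trace_cont psi_L2).
  + by move=> t t0; exact: (traceE psi_L2).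
  + move=> t t0; rewrite psi_step /step ltNge (_ : 1 <= t + 1) ?lerDr//=.
    by rewrite (_ : t + 1 - 2 = t - 1) ?addrK//; ring.
- by rewrite /trace igxx addr0 mulr0 expR0 mul1r.
(* At 1 itself [step] already uses the recursion, so agreement with [phi] is lost at that one
   point. *)
- exists [set 1]; split; [exact: measurable_set1|exact: lebesgue_measure_set1|].
  move=> x /= h; apply: contrapT => /eqP x1; apply: h => /andP[_ xl].
  by rewrite psi_step /step lt_neqAle x1 xl.
Qed.

End Existence.

(** * Exponential decay of the energy, and difference quotients at time 0 *)

Section Asymptotics.
Context (R : realType) (al be : R).
Hypotheses (al0 : 0 < al) (be0 : 0 < be).
Implicit Types (psi a u f chi : R -> R).

Let be1 : 1 + be != 0. Proof. by rewrite gt_eqF// addr_gt0. Qed.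

(** On successive windows of length 4, [energy_contract] gives a linear recursion whose source
    decays by the factor [r] per window. Any [rho] below 1 that exceeds both [q] and [r] is then a
    rate. *)
Lemma energy_decay (om : R) : 0 < om -> exists M w : R, [/\ 0 < M, 0 < w &
  forall u psi a (k : R), continuous u -> delay_sol al be u psi a -> 0 <= k ->
   (forall t, 0 <= t -> u t ^+ 2 <= k * expR (- (om * t))) ->
   forall t, 0 <= t ->
     energy al psi a t <= M * expR (- (w * t)) * (energy al psi a 0 + k)].
Proof.
move=> om0; have [q [C [/andP[q0 q1] C0 hC]]] := energy_contract al0 be0.
pose r := expR (- (om * 4)).
have r1 : r < 1 by rewrite -expR0 ltr_expR oppr_lt0 mulr_gt0.
have r0 : 0 < r by exact: expR_gt0.
pose m := Num.max q r.
have qm : q <= m by rewrite le_max lexx.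
have rm : r <= m by rewrite le_max lexx orbT.
have m1 : m < 1 by rewrite gt_max q1.
pose rho := (1 + m) / 2.
have rho1 : rho < 1 by rewrite /rho; lra.
have qrho : q < rho by rewrite /rho; lra.
have rrho : r < rho by rewrite /rho; lra.
have rho0 : 0 < rho by lra.
(* Chosen so that [q * D + 4 * C = rho * D], which closes the induction for
   [rho ^+ j * (E0 + D * k)]; [4 * k * r ^+ j] bounds the input on the window of index [j]. *)
pose D := 4 * C / (rho - q).
have D0 : 0 <= D by rewrite divr_ge0 ?mulr_ge0// subr_ge0 ltW.
have DE : q * D + 4 * C = rho * D by rewrite /D; field; rewrite subr_eq0 gt_eqF.
have lrho : ln rho < 0 by apply: ln_lt0; rewrite rho0.
exists (rho^-1 * (1 + D + be^-1)), (- ln rho / 4); split.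
- rewrite mulr_gt0 ?invr_gt0// addr_gt0 ?invr_gt0//; lra.
- by rewrite divr_gt0// oppr_gt0.
move=> u psi a k cu hs k0 hu t t0.
have hu2 := L2loc_sqr (cont_L2loc cu).
have [hp _ _ _] := hs.
have hcst (c : R) : L1loc (fun=> c) by apply: cont_L1loc => x; exact: cst_continuous.
have cut (j : nat) : continuous (fun s : R => u (s + 4 * j%:R)).
  move=> s; apply: (@continuous_comp _ _ _ (fun s : R => s + 4 * j%:R) u); last exact: cu.
  by apply: cvgD; [exact: cvg_id|exact: cvg_cst].
have rE (j : nat) : r ^+ j = expR (- (om * (4 * j%:R))).
  by rewrite /r -expRM_natl; congr expR; ring.
have hui (j : nat) s : 0 <= s <= 4 -> ig 0 s (fun x => u (x + 4 * j%:R) ^+ 2) <= 4 * k * r ^+ j.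
  move=> /andP[s0 s4]; apply: (@le_trans _ _ (ig 0 s (fun=> k * r ^+ j))).
    apply: ig_le => //; first exact: (L1loc_shift _ hu2).
    move=> x /andP[x0 _]; have j0 : 0 <= 4 * j%:R :> R by rewrite mulr_ge0.
    apply: le_trans (hu _ _) _; first exact: addr_ge0.
    by rewrite ler_wpM2l// rE ler_expR lerN2 ler_wpM2l ?(ltW om0)// lerDr.
  rewrite ig_cst// subr0.
  have h : 0 <= k * r ^+ j by rewrite mulr_ge0// exprn_ge0// ltW.
  by have := ler_wpM2l h s4; lra.
set E0 := energy al psi a 0.
have E00 : 0 <= E0 by exact: energy_ge0.
have main (j : nat) : energy al psi a (4 * j%:R) <= rho ^+ j * (E0 + D * k).
  elim: j => [|j ih].
    by rewrite mulr0 expr0 mul1r lerDl mulr_ge0.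
  have j0 : 0 <= 4 * j%:R :> R by rewrite mulr_ge0.
  have := hC _ _ _ (cut j) (delay_shift cu hs j0).
  rewrite !energy_shift// add0r.
  rewrite (_ : 4 + 4 * j%:R = 4 * j.+1%:R); last by rewrite -[j.+1%:R]natr1; ring.
  move=> /le_trans; apply.
  have h1 := ler_wpM2l q0 ih.
  have h2 := ler_wpM2l C0 (hui j 4 _); rewrite lexx ler0n in h2; have {}h2 := h2 isT.
  have h3 : r ^+ j <= rho ^+ j by rewrite lerXn2r ?nnegrE// ltW.
  have h4 : C * (4 * k) * r ^+ j <= C * (4 * k) * rho ^+ j.
    by rewrite ler_wpM2l// !mulr_ge0.
  have h5 : 0 <= rho ^+ j by rewrite exprn_ge0 // ltW.
  have h6 : 0 <= (rho - q) * (rho ^+ j * E0).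
    by rewrite !mulr_ge0// subr_ge0 ltW.
  rewrite exprS.
  have -> : rho * rho ^+ j * (E0 + D * k) =
    rho * rho ^+ j * E0 + (rho * D) * (rho ^+ j * k) by ring.
  rewrite -DE; lra.
pose j := Num.truncn (t / 4).
have /andP[j1 j2] : j%:R <= t / 4 < j.+1%:R.
  by apply: truncn_itv; rewrite divr_ge0.
pose s := t - 4 * j%:R.
have s04 : 0 <= s <= 4 by rewrite /s; move: j2; rewrite -[j.+1%:R]natr1 => j2; apply/andP; split; lra.
have s0 : 0 <= s by case/andP: s04.
have j0 : 0 <= 4 * j%:R :> R by rewrite mulr_ge0.
(* On the incomplete last window there is no contraction, and the crude energy bound is enough. *)
have := energy_bound be0 (cut j) (delay_shift cu hs j0) s0.
rewrite !energy_shift// add0r (_ : s + 4 * j%:R = t); last by rewrite /s subrK.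
move=> /le_trans; apply.
have be40 : 0 <= (4 * be)^-1 by rewrite invr_ge0 mulr_ge0// ltW.
have h2 := ler_wpM2l be40 (hui j s s04).
have h3 : r ^+ j <= rho ^+ j by rewrite lerXn2r ?nnegrE// ltW.
have be4 : (4 * be)^-1 * (4 * k * r ^+ j) <= be^-1 * (k * rho ^+ j).
  have -> : (4 * be)^-1 * (4 * k * r ^+ j) = be^-1 * (k * r ^+ j) by field; rewrite gt_eqF.
  by rewrite ler_wpM2l ?invr_ge0 ?ler_wpM2l// ltW.
have h5 : 0 <= rho ^+ j by rewrite exprn_ge0 // ltW.
apply: (@le_trans _ _ (rho ^+ j * ((1 + D + be^-1) * (E0 + k)))).
  have := main j; have : 0 <= rho ^+ j * ((D + be^-1) * E0 + k).
    rewrite mulr_ge0// addr_ge0// mulr_ge0// addr_ge0// invr_ge0; exact: ltW.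
  move: be4 h2; lra.
set W := (1 + D + be^-1) * (E0 + k).
have bei : 0 <= be^-1 by rewrite invr_ge0 ltW.
have W0 : 0 <= W by apply: mulr_ge0; lra.
(* Rounding [t / 4] down to [j] costs one factor [rho^-1]. *)
suff hr : rho ^+ j <= rho^-1 * expR (- (- ln rho / 4 * t)).
  by have := ler_wpM2r W0 hr; rewrite /W; lra.
rewrite -{1 2}(lnK (x := rho)) ?posrE// -expRN -expRM_natl -expRD ler_expR.
have : 0 <= (j%:R + 1 - t / 4) * (- ln rho).
  by apply: mulr_ge0; [rewrite -[j.+1%:R]natr1 in j2; lra|lra].
lra.
Qed.

Lemma aeon_exists (a b : R) (P : R -> Prop) : a < b -> aeon a b P ->
  exists x, a <= x <= b /\ P x.
Proof.
move=> ab [N [mN N0 PN]]; apply: contrapT => /forallNP h.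
have sub : `[a, b]%classic `<=` N.
  move=> x /=; rewrite in_itv/= => xab; apply: PN => /= hx.
  by apply: (h x); split => //; exact: hx.
have : (@lebesgue_measure R `[a, b]%classic <= 0)%E.
  by rewrite -N0 le_measure// inE.
rewrite lebesgue_measure_itv/= lte_fin ab -EFinB lee_fin; lra.
Qed.

Lemma average_cvg f : continuous f -> t^-1 * ig 0 t f @[t --> (0:R)^'+] --> f 0.
Proof.
move=> cf; apply/cvgrPdist_le => e e0.
have /cvgrPdist_le/(_ e e0)[d /= d0 hd] := cf 0.
near=> t; have t0 : 0 < t by [].
have td : t < d by near: t; exact: nbhs_right_lt.
have hf := cont_L1loc cf.
have -> : f 0 - t^-1 * ig 0 t f = t^-1 * ig 0 t (fun s => f 0 - f s).
  rewrite igB//; last by apply: cont_L1loc => x; exact: cst_continuous.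
  by rewrite ig_cst ?(ltW t0)//; field; rewrite gt_eqF.
have h0 : L1loc (fun s => f 0 - f s).
  by apply: L1locB => //; apply: cont_L1loc => x; exact: cst_continuous.
rewrite normrM [`|t^-1|]ger0_norm ?invr_ge0 ?(ltW t0)// ler_pdivrMl//.
apply: le_trans (ig_norm _ _ h0) _.
apply: (@le_trans _ _ (ig 0 t (fun=> e))).
  apply: ig_le; [exact: L1loc_abs|by apply: cont_L1loc => x; exact: cst_continuous|].
  move=> x /andP[x0 xt]; apply: hd => /=.
  by rewrite sub0r normrN ger0_norm// (le_lt_trans xt).
by rewrite ig_cst ?(ltW t0)// subr0 mulrC.
Unshelve. all: by end_near. Qed.

Lemma delay_strong_cont u psi a : delay_sol al be u psi a ->
  ig (-1) 1 (fun x => (psi (x + t) - psi x) ^+ 2) @[t --> (0:R)^'+] --> (0:R) /\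
  a t - a 0 @[t --> (0:R)^'+] --> (0:R).
Proof.
move=> [hp ca _ _]; split.
  apply/cvgrPdist_le => e e0; have [d [d0 hd]] := L2_shift_small (-1) 1 hp e0.
  near=> t; rewrite sub0r normrN ger0_norm; last by apply: ig_ge0 => x _; exact: sqr_ge0.
  apply: hd; rewrite ltW//=; near: t; exact: nbhs_right_le.
have h : a t - a 0 @[t --> (0:R)^'+] --> a 0 - a 0.
  by apply: cvgB; [apply: cvg_at_right_filter; exact: ca|exact: cvg_cst].
by move: h; rewrite subrr.
Unshelve. all: by end_near. Qed.

(** Difference quotients of a primitive are moving averages of its derivative, and these converge in
    L^2 because translations are continuous there. *)
Lemma primitive_deriv psi psi' (ka : R) : L2loc psi' ->
  (forall x, psi x = ka + ig (-1) x psi') ->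
  ig (-1) 1 (fun x => (t^-1 * (psi (x + t) - psi x) - psi' x) ^+ 2) @[t --> (0:R)^'+] --> (0:R).
Proof.
move=> hp psiE; have hp1 := L2loc_L1 hp.
apply/cvgrPdist_le => e e0; have [d [d0 hd]] := L2_shift_small (-1) 1 hp e0.
near=> t; have t0 : 0 < t by [].
rewrite sub0r normrN ger0_norm; last by apply: ig_ge0 => x _; exact: sqr_ge0.
rewrite (_ : ig _ _ _ = ig (-1) 1 (fun x => (t^-1 * ig x (x + t) psi' - psi' x) ^+ 2)).
  apply: ig_average => //; first exact: ltW.
  move=> s /andP[s0 st]; apply: hd; rewrite s0 (le_trans st)//=.
  by near: t; exact: nbhs_right_le.
apply: ig_eq => x /andP[x1 _]; rewrite !psiE.
rewrite (@ig_split _ (-1) x (x + t))//; last by rewrite x1 lerDl ltW.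
by congr ((_ * _ - _) ^+ 2); ring.
Unshelve. all: by end_near. Qed.

(** Converse of [delay_primitive]. L^2 convergence of the quotients says nothing about point values,
    so one works with the quotients [Q t] of the primitive of [psi]. Their increments converge to
    those of the primitive of [chi] by Cauchy-Schwarz; convergence at one Lebesgue point of [psi]
    then gives it on all of [[-1, 1]], in particular at the ends, where the equations are to be
    taken to the limit. *)
Lemma delay_deriv u psi a chi (g1 : R) : continuous u -> delay_sol al be u psi a ->
  L2loc chi ->
  ig (-1) 1 (fun x => (t^-1 * (psi (x + t) - psi x) - chi x) ^+ 2) @[t --> (0:R)^'+] --> (0:R) ->
  t^-1 * (a t - a 0) @[t --> (0:R)^'+] --> g1 ->
  exists ka : R, [/\ aeon (-1) 1 (fun x => psi x = ka + ig (-1) x chi),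
    g1 = (1 + be)^-1 * (ka - al * a 0 + u 0) &
    ka + ig (-1) 1 chi = (1 - be) / (1 + be) * ka + 2 / (1 + be) * (u 0 - al * a 0)].
Proof.
move=> cu hs hc hpsi hg; have [hp ca ha hpe] := hs.
have hp1 := L2loc_L1 hp; have hc1 := L2loc_L1 hc.
pose Q t x := t^-1 * (prim psi (x + t) - prim psi x).
pose X x := ig (-1) x chi.
have diff c d : -1 <= c -> c <= d -> d <= 1 ->
    Q t d - Q t c @[t --> (0:R)^'+] --> X d - X c.
  move=> c1 cd d1.
  have hsq : Num.sqrt (2 * ig (-1) 1 (fun x => (t^-1 * (psi (x + t) - psi x) - chi x) ^+ 2)) @[t --> (0:R)^'+] --> (0:R).
    have h2 : 2 * ig (-1) 1 (fun x => (t^-1 * (psi (x + t) - psi x) - chi x) ^+ 2) @[t --> (0:R)^'+] --> (2 * 0 : R).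
      by apply: cvgM => //; exact: cvg_cst.
    have := continuous_cvg _ (@sqrt_continuous R _) h2.
    by rewrite mulr0 sqrtr0; apply.
  apply/cvgrPdist_le => e e0; move/cvgrPdist_le : hsq => /(_ e e0) hsq.
  near=> t; have t0 : 0 < t by [].
  have : `|0 - Num.sqrt (2 * ig (-1) 1 (fun x => (t^-1 * (psi (x + t) - psi x) - chi x) ^+ 2))| <= e.
    by near: t.
  rewrite sub0r normrN ger0_norm ?sqrtr_ge0//; apply: le_trans.
  have hq : L2loc (fun x => t^-1 * (psi (x + t) - psi x) - chi x).
    by apply: L2locB => //; apply: L2locZ; apply: L2locB => //; exact: L2loc_shift.
  have hq2 := L2loc_sqr hq.
  have -> : X d - X c - (Q t d - Q t c) = - ig c d (fun x => t^-1 * (psi (x + t) - psi x) - chi x).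
    have hpt : L1loc (fun x => psi (x + t)) by exact: L1loc_shift.
    rewrite igB//; last by apply: L1locZ; exact: L1locB.
    rewrite igZ; last exact: L1locB.
    rewrite igB// ig_shift// /X (@ig_split _ (-1) c d)//; last by rewrite c1.
    rewrite (@igE _ (c + t)) ?(@igE _ c d psi) ?lerD2r// /Q; ring.
  rewrite normrN -sqrtr_sqr ler_wsqrtr//.
  apply: le_trans (ig_CS cd hq) _.
  have s0 (x y : R) : 0 <= ig x y (fun x => (t^-1 * (psi (x + t) - psi x) - chi x) ^+ 2).
    by apply: ig_ge0 => z _; exact: sqr_ge0.
  apply: ler_pM => //; [lra|lra|].
  rewrite (@ig_split _ (-1) c 1 _ hq2) ?c1 ?(le_trans cd)//.
  rewrite (@ig_split _ c d 1 _ hq2) ?cd//.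
  by have := s0 (-1) c; have := s0 d 1; lra.
have leb := FTC1_ae hp1.
(* A Lebesgue point fixes the constant of integration [ka]. *)
have [c [/andP[c1 c2] hcc]] : exists c, -1 <= c <= 1 /\ Q t c @[t --> (0:R)^'+] --> psi c.
  apply: aeon_exists; first lra.
  by apply: (@filterS _ _ (ae_filter_ringOfSetsType (@lebesgue_measure R))) leb => x h _.
pose ka := psi c - X c.
have Qc d : -1 <= d <= 1 -> Q t d @[t --> (0:R)^'+] --> ka + X d.
  move=> /andP[d1 d2]; have [cd|dc] := leP c d.
    have -> : (fun t => Q t d) = (fun t => (Q t d - Q t c) + Q t c).
      by apply/funext => t; rewrite subrK.
    have -> : ka + X d = (X d - X c) + psi c by rewrite /ka; ring.
    by apply: cvgD => //; exact: diff.
  have -> : (fun t => Q t d) = (fun t => Q t c - (Q t c - Q t d)).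
    by apply/funext => t; rewrite subKr.
  have -> : ka + X d = psi c - (X c - X d) by rewrite /ka; ring.
  by apply: cvgB => //; apply: diff => //; exact: ltW.
have Qm1 : Q t (-1) @[t --> (0:R)^'+] --> ka.
  by have := Qc (-1); rewrite /X igxx addr0; apply; lra.
have Q1 : Q t 1 @[t --> (0:R)^'+] --> ka + X 1 by apply: Qc; lra.
have cua : continuous (fun t => u t - al * a t).
  move=> x; apply: cvgB; first exact: cu.
  by apply: cvgM; [exact: cvg_cst|exact: ca].
have avg := average_cvg cua.
have hua := cont_L1loc cua.
have hpm : L1loc (fun s => psi (s - 1)) by exact: L1loc_shift.
have Qm1E t : 0 < t -> Q t (-1) = t^-1 * ig 0 t (fun s => psi (s - 1)).
  move=> t0; rewrite ig_shift// sub0r igE//; last lra.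
  by rewrite /Q (addrC (-1)).
exists ka; split.
- apply: (@filterS _ _ (ae_filter_ringOfSetsType (@lebesgue_measure R))) leb => x h x1.
  exact: (cvg_unique _ h (Qc x x1)).
(* For [t > 0] the quotient of [a] is the average of the slope over [[0, t]], a combination of
   [Q t (-1)] and of the average of [u - al * a], whose limits are known. *)
- apply: (cvg_unique _ hg) => //.
  have -> : (1 + be)^-1 * (ka - al * a 0 + u 0) = (1 + be)^-1 * (ka + (u 0 - al * a 0)) by ring.
  apply: (@cvg_trans _ ((1 + be)^-1 * (Q t (-1) + t^-1 * ig 0 t (fun s => u s - al * a s)) @[t --> (0:R)^'+])); last first.
    by apply: cvgM; [exact: cvg_cst|exact: cvgD].
  apply: near_eq_cvg; near=> t; have t0 : 0 < t by [].
  rewrite Qm1E// ha ?ltW// -mulrDr -igD// mulrCA -igZ; last exact: L1locD.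
  rewrite [a 0 + _]addrC addrK; congr (_ * _); apply: ig_eq => s _; rewrite /slope; ring.
(* Averaging the recursion over [[0, t]] expresses [Q t 1] through [Q t (-1)]. *)
- apply: (cvg_unique _ Q1) => //.
  apply: (@cvg_trans _ ((1 - be) / (1 + be) * Q t (-1) + 2 / (1 + be) * (t^-1 * ig 0 t (fun s => u s - al * a s)) @[t --> (0:R)^'+])); last first.
    apply: cvgD; first by apply: cvgM => //; exact: cvg_cst.
    by apply: cvgM; [exact: cvg_cst|].
  apply: near_eq_cvg; near=> t; have t0 : 0 < t by [].
  rewrite Qm1E// mulrCA [X in _ + X = _]mulrCA -mulrDr.
  rewrite -(igZ _ _ _ hpm) -(igZ _ _ _ hua) -igD; [|exact: L1locZ|exact: L1locZ].
  rewrite /Q; congr (_ * _).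
  rewrite (_ : prim psi (1 + t) - prim psi 1 = ig 0 t (fun s => psi (s + 1))); last first.
    by rewrite ig_shift// add0r igE//; [rewrite (addrC t)|lra].
  by apply: ig_eq => s /andP[s0 _]; rewrite hpe.
Unshelve. all: by end_near. Qed.

End Asymptotics.

(** * Riemann invariants *)

Section Encoding.
Context (R : realType).
Local Notation mu := (@lebesgue_measure R).
Local Notation wave_state := (H1 R * L2 R)%type.
Implicit Types (f g d : L2 R) (w : H1 R) (phi : R -> R) (z y : wave_state).

Lemma ae01P (P : R -> Prop) : ae01 P <-> aeon 0 1 P.
Proof.
by split; apply: (@filterS _ _ (ae_filter_ringOfSetsType mu)) => x h xab;
  apply: h; move: xab; rewrite in_itv.
Qed.

Lemma aeon_neq (a b c : R) : aeon a b (fun x => x <> c).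
Proof.
exists [set c]; split; [exact: measurable_set1|exact: lebesgue_measure_set1|].
by move=> x /= h; apply: contrapT => xc; apply: h.
Qed.

Lemma aeon_abs (P : R -> Prop) : aeon 0 1 P -> aeon (-1) 1 (fun x => P `|x|).
Proof.
move=> h; have h' : aeon (-1) 0 (fun x => P (- x)).
  by apply: aeon_opp; rewrite oppr0 opprK.
move: h h'; apply: (@filterS2 _ _ (ae_filter_ringOfSetsType mu)) => x h1 h2 /andP[xl xr].
by case: ger0P => x0; [apply: h1; rewrite x0|apply: h2; rewrite xl ltW].
Qed.

(** Lebesgue differentiation; the point [b] is set aside because a right-hand quotient there leaves
    the interval. *)
Lemma ig_zero_ae (a b : R) (e : R -> R) : L1loc e ->
  (forall x, a <= x <= b -> ig a x e = 0) -> aeon a b (fun x => e x = 0).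
Proof.
move=> he h; have := aeon_neq a b b.
apply: (@filterS2 _ _ (ae_filter_ringOfSetsType mu)) (FTC1_ae he) => x hx + /andP[ax xb].
rewrite ax xb => /(_ isT) /eqP xb'; have {xb'}xltb : x < b by rewrite lt_neqAle xb'.
apply: (cvg_unique _ hx) => //; apply: cvg_near_cst; near=> t.
have t0 : 0 < t by [].
have tb : x + t <= b by rewrite -lerBrDl; near: t; apply: nbhs_right_le; rewrite subr_gt0.
rewrite -igE//; last by rewrite lerDl ltW.
have := h (x + t); rewrite tb (le_trans ax) ?lerDl ?ltW// => /(_ isT).
rewrite (@ig_split _ a x (x + t))//; last by rewrite ax lerDl ltW.
by rewrite h ?ax ?xb// add0r => ->; rewrite mulr0.
Unshelve. all: by end_near. Qed.

Lemma cont_zero_ae (a b : R) (D : R -> R) : a < b -> continuous D ->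
  aeon a b (fun x => D x = 0) -> forall x, a <= x <= b -> D x = 0.
Proof.
move=> ab cD hD x /andP[ax xb]; apply/eqP; apply: contraT => Dx.
have Dx0 : 0 < `|D x| by rewrite normr_gt0.
have /cvgrPdist_lt/(_ _ Dx0)[e /= e0 he] := cD x.
pose c := Num.max a (x - e / 2); pose d := Num.min b (x + e / 2).
have e2 : 0 < e / 2 by rewrite divr_gt0.
have cd : c < d.
  have h1 : a < x + e / 2 by lra.
  have h2 : x - e / 2 < b by lra.
  have h3 : x - e / 2 < x + e / 2 by lra.
  by rewrite /c /d gt_max !lt_min ab h1 h2 h3.
have hcd : aeon c d (fun x => D x = 0).
  by apply: aeon_sub hD; rewrite /c /d ?le_max ?ge_min lexx.
have [s [/andP[]]] := aeon_exists cd hcd.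
rewrite /c /d ge_max le_min => /andP[_ s1] /andP[_ s2] Ds.
have /= := he s; rewrite Ds subr0 ltxx; apply.
by rewrite /= ltr_distl; apply/andP; split; lra.
Qed.

(* L2_fun and H1_fun are arbitrary outside [0,1]. *)
Definition ext (f : R -> R) (x : R) : R := if 0 <= x <= 1 then f x else 0.

Lemma extE (f : R -> R) x : 0 <= x <= 1 -> ext f x = f x.
Proof. by rewrite /ext => ->. Qed.

Lemma ext_L2loc f : L2loc (ext f).
Proof.
have /asboolP[mf if2] := valP (repr f).
have extE' : ext f = (f : R -> R) \_ `[0, 1].
  by apply/funext => x; rewrite /ext patchE mem_setE in_itv.
have me : measurable_fun [set: R] (ext f).
  by rewrite extE'; apply/(measurable_restrictT _ _).1.
split=> // a b; apply/integrableP; split.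
  by apply/measurable_EFinP/measurable_funTS/measurable_funX.
have /integrableP[_] := if2; apply: le_lt_trans.
have -> : (\int[mu]_(x in `[0%R, 1%R]) `|((repr f : L2fun R) x ^+ 2)%:E| =
           \int[mu]_x `|(ext f x ^+ 2)%:E|)%E.
  rewrite integral_mkcond; apply: eq_integral => x _.
  rewrite patchE mem_setE in_itv/= /ext; case: ifP => // _.
  by rewrite expr0n normr0.
apply: ge0_subset_integral => //.
by apply: measurableT_comp => //; apply/measurable_EFinP/measurable_funX.
Qed.

Lemma L2_ext f g : ae01 (fun x => f x = g x) -> f = g.
Proof.
move=> h; rewrite -(reprK f) -(reprK g); apply/L2_piE/asboolP.
by apply: ae01S h => x; rewrite /= !fctE /L2_fun => ->; rewrite subrr.
Qed.

Lemma L2loc_sq_integrable phi : L2loc phi -> phi \in @sq_integrable R.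
Proof.
move=> [mp ip]; apply/asboolP; split; first exact: measurable_funTS.
exact: ip.
Qed.

(** The default 0 is taken only when [phi] is not square integrable; every use supplies
    [L2loc phi]. *)
Definition mkL2 phi : L2 R := \pi_(L2 R) (insubd (0 : L2fun R) phi).

Lemma mkL2E phi : L2loc phi -> ae01 (fun x => mkL2 phi x = phi x).
Proof.
move=> hp; have := L2_pi_ae (insubd (0 : L2fun R) phi).
have -> // : (insubd (0 : L2fun R) phi : R -> R) = phi.
by rewrite val_insubd L2loc_sq_integrable.
Qed.

Lemma H1_ac w : ac_rep (H1_val w) w (weak_deriv w).
Proof. exact: (projT2 (cid (H1_repP w))). Qed.

Lemma ac_repE f (u : R -> R) d : ac_rep f u d ->
  forall x, 0 <= x <= 1 -> u x = u 0 + ig 0 x (ext d).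
Proof.
move=> [_ h] x x01; rewrite h//; congr (_ + _); apply: ig_eq => t /andP[t0 tx].
by rewrite extE// t0 (le_trans tx)//; case/andP: x01.
Qed.

Lemma ac_rep_unique f (u v : R -> R) d e : ac_rep f u d -> ac_rep f v e ->
  (forall x, 0 <= x <= 1 -> u x = v x) /\ d = e.
Proof.
move=> hu hv; have uE := ac_repE hu; have vE := ac_repE hv.
have hd1 := L2loc_L1 (ext_L2loc d); have he1 := L2loc_L1 (ext_L2loc e).
have uv : forall x, 0 <= x <= 1 -> u x = v x.
  pose D x := (u 0 + ig 0 x (ext d)) - (v 0 + ig 0 x (ext e)).
  have cD : continuous D.
    by move=> x; apply: cvgB; (apply: cvgD; [exact: cvg_cst|exact: ig_continuous]).
  have D0 : aeon 0 1 (fun x => D x = 0).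
    have [/ae01P fu _] := hu; have [/ae01P fv _] := hv.
    apply: aeon2 fu fv => x x01 e1 e2.
    by rewrite /D -uE// -vE// -e1 -e2 subrr.
  move=> x x01; have := cont_zero_ae ltr01 cD D0 x01.
  by rewrite /D -uE// -vE// => /eqP; rewrite subr_eq0 => /eqP.
split => //; apply: L2_ext; apply/ae01P.
have h0 x : 0 <= x <= 1 -> ig 0 x (fun t => ext d t - ext e t) = 0.
  move=> x01; rewrite igB//; have := uv x x01; rewrite uE// vE// (uv 0) ?lexx ?ler01//.
  by move=> /addrI ->; rewrite subrr.
have := ig_zero_ae (L1locB hd1 he1) h0.
by apply: aeonS => x x01 /eqP; rewrite subr_eq0 !extE// => /eqP.
Qed.

Lemma H1_unique w (u : R -> R) d : ac_rep (H1_val w) u d ->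
  (forall x, 0 <= x <= 1 -> w x = u x) /\ weak_deriv w = d.
Proof. exact: ac_rep_unique (H1_ac w). Qed.

Lemma H1E w x : 0 <= x <= 1 -> w x = w 0 + ig 0 x (ext (weak_deriv w)).
Proof. exact: ac_repE (H1_ac w) x. Qed.

Lemma H1E1 w x : 0 <= x <= 1 -> w x = w 1 - ig x 1 (ext (weak_deriv w)).
Proof.
move=> x01; rewrite (H1E w x01) (@H1E w 1) ?lexx ?ler01//.
rewrite (@ig_split _ 0 x 1)//; last exact: L2loc_L1 (ext_L2loc _).
ring.
Qed.

Lemma H1_ext w w' : w 1 = w' 1 -> weak_deriv w = weak_deriv w' -> w = w'.
Proof.
move=> h1 hd; suff e : H1_val w = H1_val w' by exact: val_inj.
apply: L2_ext; apply/ae01P.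
have [/ae01P fu _] := H1_ac w; have [/ae01P fv _] := H1_ac w'.
by apply: aeon2 fu fv => x x01 e1 e2; rewrite e1 e2 (H1E1 w x01) (H1E1 w' x01) h1 hd.
Qed.

(** Anchored at 1 and not at 0, because w(1) is the trace that the norm and the delay system
    record. *)
Definition mkH1_fun (c : R) d x := c - ig x 1 (ext d).

Lemma mkH1_fun_cont c d : continuous (mkH1_fun c d).
Proof.
move=> x; apply: cvgB; first exact: cvg_cst.
by apply: ig_continuousl; exact: L2loc_L1 (ext_L2loc _).
Qed.

Lemma mkH1_ac c d : ac_rep (mkL2 (mkH1_fun c d)) (mkH1_fun c d) d.
Proof.
split; first by apply: mkL2E; apply: cont_L2loc; exact: mkH1_fun_cont.
move=> x x01; rewrite /mkH1_fun.
have hd := L2loc_L1 (ext_L2loc d).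
rewrite (@ig_split _ 0 x 1)//.
rewrite (_ : \int[mu]_(t in `[0, x]) d t = ig 0 x (ext d)); first ring.
apply/esym; apply: ig_eq => t /andP[t0 tx].
by rewrite extE// t0 (le_trans tx)//; case/andP: x01.
Qed.

Lemma mkH1_pred c d : mkL2 (mkH1_fun c d) \in @H1_pred R.
Proof. by apply/asboolP; exists (mkH1_fun c d), d; exact: mkH1_ac. Qed.

Definition mkH1 (c : R) d : H1 R := MkH1 (mkH1_pred c d).

Lemma mkH1E c d x : 0 <= x <= 1 -> mkH1 c d x = c - ig x 1 (ext d).
Proof. exact: (H1_unique (w := mkH1 c d) (mkH1_ac c d)).1. Qed.

Lemma mkH11 c d : mkH1 c d 1 = c.
Proof. by rewrite mkH1E ?lexx ?ler01// igxx subr0. Qed.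

Lemma mkH1_wd c d : weak_deriv (mkH1 c d) = d.
Proof. exact: (H1_unique (w := mkH1 c d) (mkH1_ac c d)).2. Qed.

Lemma H1_lin c w w' : (forall x, 0 <= x <= 1 -> (c *: w + w') x = c * w x + w' x) /\
  weak_deriv (c *: w + w') = c *: weak_deriv w + weak_deriv w'.
Proof. by apply: H1_unique; exact: (ac_rep_lin c (H1_ac w) (H1_ac w')). Qed.

(* The even part of enc z is the velocity and its odd part is the slope w'. *)
Definition enc z x := ext z.2 `|x| + (if 0 <= x then 1 else -1) * ext (weak_deriv z.1) `|x|.

Lemma enc_L2 z : L2loc (enc z).
Proof.
have [v2 p2] := (ext_L2loc z.2, ext_L2loc (weak_deriv z.1)).
have [mv _] := v2; have [mp _] := p2.
pose e x := (ext z.2 x + ext (weak_deriv z.1) x); pose o x := (ext z.2 (- x) - ext (weak_deriv z.1) (- x)).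
have he : L2loc e by exact: L2locD.
have ho : L2loc o by apply: L2locB; exact: L2loc_opp.
have -> : enc z = fun x => if 0 <= x then e x else o x.
  apply/funext => x; rewrite /enc /e /o; case: ger0P => x0; first by rewrite mul1r.
  by rewrite mulN1r.
apply: L2loc_le (L1locD (L2loc_sqr he) (L2loc_sqr ho)) _.
  by apply: measurable_fun_ifT; [exact: measurable_fun_ler|case: he|case: ho].
by move=> x; case: ifP => _; rewrite ?lerDl ?lerDr sqr_ge0.
Qed.

Definition odd_part phi (x : R) := 2^-1 * (phi x - phi (- x)).
Definition even_part phi (x : R) := 2^-1 * (phi x + phi (- x)).

Lemma odd_L2 phi : L2loc phi -> L2loc (odd_part phi).
Proof. by move=> h; apply: L2locZ; apply: L2locB => //; exact: L2loc_opp. Qed.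

Lemma even_L2 phi : L2loc phi -> L2loc (even_part phi).
Proof. by move=> h; apply: L2locZ; apply: L2locD => //; exact: L2loc_opp. Qed.

(** Inverse of [enc]: the odd part of [phi] determines w only up to a constant, which the trace [a]
    supplies. *)
Definition dec phi (a : R) : wave_state := (mkH1 a (mkL2 (odd_part phi)), mkL2 (even_part phi)).

Lemma dec1 phi a : (dec phi a).1 1 = a.
Proof. exact: mkH11. Qed.

Lemma aeon01_sub (P : R -> Prop) : aeon (-1) 1 P -> aeon 0 1 (fun x => P x /\ P (- x)).
Proof.
move=> h; have h1 : aeon 0 1 P by apply: aeon_sub h => //; lra.
have h2 : aeon 0 1 (fun x => P (- x)).
  by apply: aeon_opp; apply: aeon_sub h => //; lra.
by apply: aeon2 h1 h2.
Qed.

Lemma dec_ext phi phi' a : L2loc phi -> L2loc phi' ->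
  aeon (-1) 1 (fun x => phi x = phi' x) -> dec phi a = dec phi' a.
Proof.
move=> hp hp' /aeon01_sub h; rewrite /dec.
have -> : mkL2 (odd_part phi) = mkL2 (odd_part phi').
  apply: L2_ext; apply/ae01P.
  have /ae01P e1 := mkL2E (odd_L2 hp); have /ae01P e2 := mkL2E (odd_L2 hp').
  apply: aeon2 h (aeon2 (fun x _ p q => conj p q) e1 e2) => x _ [h1 h2] [-> ->].
  by rewrite /odd_part h1 h2.
congr (_, _); apply: L2_ext; apply/ae01P.
have /ae01P e1 := mkL2E (even_L2 hp); have /ae01P e2 := mkL2E (even_L2 hp').
apply: aeon2 h (aeon2 (fun x _ p q => conj p q) e1 e2) => x _ [h1 h2] [-> ->].
by rewrite /even_part h1 h2.
Qed.

Lemma dec_parts phi a : L2loc phi ->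
  aeon 0 1 (fun x => weak_deriv (dec phi a).1 x = odd_part phi x /\ (dec phi a).2 x = even_part phi x).
Proof.
move=> hp; rewrite /= mkH1_wd.
have /ae01P e1 := mkL2E (odd_L2 hp); have /ae01P e2 := mkL2E (even_L2 hp).
exact: aeon2 e1 e2.
Qed.

Lemma enc_dec phi a : L2loc phi -> aeon (-1) 1 (fun x => enc (dec phi a) x = phi x).
Proof.
move=> hp; have := aeon_abs (dec_parts a hp).
apply: aeonS => x /andP[xl xr] [h1 h2].
have x1 : 0 <= `|x| <= 1 by rewrite normr_ge0 ler_norml xl.
rewrite /enc !extE// h1 h2 /odd_part /even_part.
by case: ger0P => x0; rewrite ?opprK; field.
Qed.

Lemma dec_enc z : dec (enc z) (z.1 1) = z.
Proof.
case: z => w v; rewrite /dec; congr (_, _).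
  apply: H1_ext; first exact: mkH11.
  rewrite mkH1_wd; apply: L2_ext; apply/ae01P.
  have /ae01P := mkL2E (odd_L2 (enc_L2 (w, v))).
  apply: aeon2 (aeon_neq 0 1 0) => x x01 /eqP x0 ->.
  have xp : 0 < x by rewrite lt_neqAle eq_sym x0; case/andP: x01.
  rewrite /odd_part /enc normrN oppr_ge0 (ltW xp) leNgt xp/= gtr0_norm//.
  by rewrite !extE//=; field.
apply: L2_ext; apply/ae01P.
have /ae01P := mkL2E (even_L2 (enc_L2 (w, v))).
apply: aeon2 (aeon_neq 0 1 0) => x x01 /eqP x0 ->.
have xp : 0 < x by rewrite lt_neqAle eq_sym x0; case/andP: x01.
rewrite /even_part /enc normrN oppr_ge0 (ltW xp) leNgt xp/= gtr0_norm//.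
by rewrite !extE//=; field.
Qed.

Lemma dec_lin c phi a phi' a' : L2loc phi -> L2loc phi' ->
  dec (fun x => c * phi x + phi' x) (c * a + a') = c *: dec phi a + dec phi' a'.
Proof.
move=> hp hp'; have hs : L2loc (fun x => c * phi x + phi' x).
  by apply: L2locD => //; exact: L2locZ.
have e := aeon2 (fun x _ p q => conj p q) (dec_parts (c * a + a') hs)
  (aeon2 (fun x _ p q => conj p q) (dec_parts a hp) (dec_parts a' hp')).
have [l1 l2] := H1_lin c (dec phi a).1 (dec phi' a').1.
apply/pair_equal_spec; split => /=.
  apply: H1_ext.
    by rewrite l1 ?lexx ?ler01// !mkH11.
  rewrite l2; apply: L2_ext; apply/ae01P.
  have /ae01P := L2_linE c (weak_deriv (dec phi a).1) (weak_deriv (dec phi' a').1).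
  apply: aeon2 e => x _ [[e0 _] [[h1 _] [h2 _]]] e3.
  rewrite [LHS]e0 [RHS]e3 [X in c * X + _]h1 [X in _ + X]h2.
  by rewrite /odd_part; ring.
apply: L2_ext; apply/ae01P.
have /ae01P := L2_linE c (dec phi a).2 (dec phi' a').2.
apply: aeon2 e => x _ [[_ e0] [[_ h1] [_ h2]]] e3.
by rewrite [LHS]e0 [RHS]e3 h1 h2 /even_part; ring.
Qed.

Lemma enc_lin c z z' : aeon (-1) 1 (fun x => enc (c *: z + z') x = c * enc z x + enc z' x).
Proof.
rewrite -{1}(dec_enc z) -{1}(dec_enc z') -dec_lin; [|exact: enc_L2|exact: enc_L2].
by apply: enc_dec; apply: L2locD; [apply: L2locZ|]; exact: enc_L2.
Qed.

Lemma tr1_lin c z z' : (c *: z + z').1 1 = c * z.1 1 + z'.1 1.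
Proof. by rewrite (H1_lin c z.1 z'.1).1// ler01 lexx. Qed.

(** Adding the values at [x] and [- x] cancels the cross terms: (v + p)^2 + (v - p)^2 = 2 (v^2 +
    p^2). *)
Lemma wave_norm_sqr al z : 0 < al ->
  wave_norm al z = Num.sqrt (2^-1 * ig (-1) 1 (fun x => enc z x ^+ 2) + al * z.1 1 ^+ 2).
Proof.
move=> al0; rewrite /wave_norm; congr (Num.sqrt (_ + _)).
have hz := L2loc_sqr (enc_L2 z).
pose v := ext z.2; pose p := ext (weak_deriv z.1).
have hv := L2loc_sqr (ext_L2loc z.2); have hp := L2loc_sqr (ext_L2loc (weak_deriv z.1)).
transitivity (ig 0 1 (fun x => p x ^+ 2 + v x ^+ 2)).
  by apply: ig_eq => x x01; rewrite /p /v !extE.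
rewrite (@ig_split _ (-1) 0 1)//; last by apply/andP; split; lra.
have -> : ig (-1) 0 (fun x => enc z x ^+ 2) = ig 0 1 (fun x => enc z (- x) ^+ 2).
  by rewrite (@ig_opp _ 0 1 (fun x => enc z x ^+ 2))// oppr0.
have hzo : L1loc (fun x => enc z (- x) ^+ 2) by exact: (L1loc_opp hz).
rewrite -igD// -igZ; last exact: L1locD.
apply: ig_ae; [exact: L1locD|by apply: L1locZ; exact: L1locD|].
apply: aeonS (aeon_neq 0 1 0) => x x01 /eqP x0.
have xp : 0 < x by rewrite lt_neqAle eq_sym x0; case/andP: x01.
rewrite /enc normrN oppr_ge0 (ltW xp) leNgt xp/= gtr0_norm//.
by rewrite -/(v x) -/(p x); field.
Qed.

End Encoding.

(** * The wave operator in terms of Riemann invariants *)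

Section WaveGraph.
Context (R : realType) (al be : R).
Hypotheses (al0 : 0 < al) (be0 : 0 < be).
Local Notation wave_state := (H1 R * L2 R)%type.
Implicit Types (z y : wave_state).

Let be1 : 1 + be != 0. Proof. by rewrite gt_eqF// addr_gt0. Qed.

Lemma enc_int y x : 0 <= x <= 1 ->
  ig 0 x (enc y) = ig 0 x (ext y.2) + ig 0 x (ext (weak_deriv y.1)) /\
  ig (- x) 0 (enc y) = ig 0 x (ext y.2) - ig 0 x (ext (weak_deriv y.1)).
Proof.
move=> /andP[x0 x1].
have hy := L2loc_L1 (enc_L2 y).
have hv := L2loc_L1 (ext_L2loc y.2); have hp := L2loc_L1 (ext_L2loc (weak_deriv y.1)).
split.
  rewrite -igD//; apply: ig_eq => t /andP[t0 _].
  by rewrite /enc t0 ger0_norm// mul1r.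
rewrite -[X in ig _ X _]oppr0 -ig_opp// -igB//; apply: ig_ae.
- exact: L1loc_opp.
- exact: L1locB.
apply: aeonS (aeon_neq 0 x 0) => t /andP[t0 _] /eqP tn0.
have tp : 0 < t by rewrite lt_neqAle eq_sym tn0.
by rewrite /enc normrN oppr_ge0 leNgt tp/= gtr0_norm// mulN1r.
Qed.

(** In the encoding the wave operator is d/dx on (-1, 1). The absence of a jump at 0 is the
    condition w_x(0) = 0, [ka] is the value of the encoding at -1, and the two equations are the
    boundary condition at x = 1 written with the values of the encoding at -1 and 1. *)
Lemma wave_graphP r z y : wave_graph al be r z y <-> exists ka : R,
  [/\ aeon (-1) 1 (fun x => enc z x = ka + ig (-1) x (enc y)),
      y.1 1 = (1 + be)^-1 * (ka - al * z.1 1 + r) &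
      ka + ig (-1) 1 (enc y) = (1 - be) / (1 + be) * ka + 2 / (1 + be) * (r - al * z.1 1)].
Proof.
have hy := L2loc_L1 (enc_L2 y).
have hv := L2loc_L1 (ext_L2loc y.2); have hp := L2loc_L1 (ext_L2loc (weak_deriv y.1)).
have i01 : 0 <= (1 : R) <= 1 by rewrite ler01 lexx.
have sp x : 0 <= x <= 1 -> ig (-1) x (enc y) = ig (-1) 0 (enc y) + ig 0 x (enc y).
  by move=> /andP[x0 x1]; rewrite -ig_split// x0 andbT; lra.
have sm x : 0 <= x <= 1 -> ig (-1) (- x) (enc y) = ig (-1) 0 (enc y) - ig (- x) 0 (enc y).
  move=> /andP[x0 x1]; rewrite (@ig_split _ (-1) (- x) 0) ?addrK//.
  by apply/andP; split; lra.
split.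
  move=> [yz [p [pz yp p0 p1]]].
  pose ka := y.1 0 - ig (-1) 0 (enc y).
  have pE x : 0 <= x <= 1 -> p x = ig 0 x (ext y.2).
    by move=> x01; rewrite H1E// p0 add0r yp.
  have E x : 0 <= x <= 1 -> ka + ig (-1) x (enc y) = y.1 x + p x /\
     ka + ig (-1) (- x) (enc y) = y.1 x - p x.
    move=> x01; have [e1 e2] := enc_int y x01.
    by rewrite sp// sm// e1 e2 pE// (H1E y.1)// /ka; split; ring.
  exists ka.
  have [E1 E2] := E 1 i01; rewrite igxx addr0 in E2.
  split.
  - have [/ae01P zy _] := H1_ac y.1; have [/ae01P zp _] := H1_ac p.
    have := aeon_abs (aeon2 (fun x _ p q => conj p q) zy zp).
    apply: aeonS => x /andP[xl xr] [h1 h2].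
    have x1 : 0 <= `|x| <= 1 by rewrite normr_ge0 ler_norml xl.
    rewrite /enc !extE// -yz h1 -pz h2; have [F1 F2] := E _ x1.
    case: ger0P F1 F2 => x0 F1 F2; first by rewrite F1 mul1r.
    by rewrite opprK in F2; rewrite F2 mulN1r.
  - rewrite E2 p1; field => //.
  - rewrite E1 E2 p1; field => //.
move=> [ka [zE bc1 bc2]].
pose c := ka + ig (-1) 0 (enc y).
have y1 : y.1 1 = 2^-1 * (ka + (ka + ig (-1) 1 (enc y))).
  by rewrite bc1 bc2; field.
have y0 : y.1 0 = c.
  have := H1E y.1 i01; rewrite y1 sp//; have [e1 e2] := enc_int y i01.
  by rewrite e1 /c; have := sm 1 i01; rewrite igxx e2; lra.
have half : aeon 0 1 (fun x => z.2 x = y.1 x /\ weak_deriv z.1 x = ig 0 x (ext y.2)).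
  have := aeon2 (fun x _ p q => conj p q) (aeon01_sub zE) (aeon_neq 0 1 0).
  apply: aeonS => x x01 [[h1 h2] /eqP x0].
  have xp : 0 < x by rewrite lt_neqAle eq_sym x0; case/andP: x01.
  move: h1 h2; rewrite /enc normrN oppr_ge0 (ltW xp) leNgt xp/= gtr0_norm//.
  rewrite !extE// sp// sm//; have [-> ->] := enc_int y x01.
  rewrite H1E// y0 /c; lra.
split.
  apply: L2_ext; apply/ae01P; have [/ae01P zy _] := H1_ac y.1.
  by apply: aeon2 zy half => x _ -> [-> _].
exists (mkH1 (ig 0 1 (ext y.2)) y.2).
have pE x : 0 <= x <= 1 -> mkH1 (ig 0 1 (ext y.2)) y.2 x = ig 0 x (ext y.2).
  by move=> x01; rewrite mkH1E// (@ig_split _ 0 x 1)// addrK.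
split.
- apply: L2_ext; apply/ae01P.
  have [/ae01P h _] := H1_ac (mkH1 (ig 0 1 (ext y.2)) y.2).
  by apply: aeon2 h half => x x01 -> [_ ->]; rewrite pE.
- by rewrite mkH1_wd.
- by rewrite pE ?igxx// lexx ler01.
- rewrite pE//; have [e1 e2] := enc_int y i01.
  have h1 := sp 1 i01; have h2 := sm 1 i01; rewrite igxx in h2.
  have -> : ig 0 1 (ext y.2) = 2^-1 * ig (-1) 1 (enc y) by lra.
  have -> : ig (-1) 1 (enc y) = (1 - be) / (1 + be) * ka + 2 / (1 + be) * (r - al * z.1 1) - ka.
    by rewrite -bc2; ring.
  by rewrite bc1; field.
Qed.

End WaveGraph.

(** * Entire functions of matrices *)

Section PowerSeries.
Context (R : realType) (n : nat).
Implicit Types (C : nat -> 'M[R]_n) (A B : 'M[R]_n) (x : R).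

(** Domination by the coefficients of an exponential series is stable under termwise
    differentiation, so it gives at once the convergence of a series and of its derived series. *)
Definition exp_bounded (c : nat -> R) := exists K M : R,
  [/\ 0 <= K, 0 <= M & forall k, `|c k| <= K * (M ^+ k / k`!%:R)].

Lemma exp_bounded_cvg c x : exp_bounded c -> cvgn (pseries c x).
Proof.
move=> [K [M [K0 M0 h]]]; apply: normed_cvg.
apply: (@series_le_cvg _ _ (fun k => K * exp_coeff (M * `|x|) k)) => //.
- move=> k; exact: normr_ge0.
- move=> k; apply: mulr_ge0 => //; apply: exp_coeff_ge0; exact: mulr_ge0.
- move=> k /=; rewrite normrM normrX /exp_coeff/= exprMn mulrAC mulrA.
  by rewrite ler_wpM2r// ?exprn_ge0.
- by apply: is_cvg_seriesZ; exact: is_cvg_series_exp_coeff.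
Qed.

Lemma exp_bounded_diffs c : exp_bounded c -> exp_bounded (pseries_diffs c).
Proof.
move=> [K [M [K0 M0 h]]]; exists (K * M), M; split => //; first exact: mulr_ge0.
move=> k; rewrite /pseries_diffs normrM ger0_norm//.
apply: le_trans (ler_wpM2l _ (h k.+1)) _ => //.
rewrite factS natrM exprS invfM le_eqVlt; apply/orP; left; apply/eqP.
by field; rewrite nat1r !pnatr_eq0 -lt0n fact_gt0.
Qed.

Lemma exp_bounded_derive c x : exp_bounded c ->
  is_derive x (1 : R) (fun x => limn (pseries c x)) (limn (pseries (pseries_diffs c) x)).
Proof.
move=> hc; apply: (@pseries_snd_diffs _ _ (`|x| + 1)).
- exact: exp_bounded_cvg.
- exact/exp_bounded_cvg/exp_bounded_diffs.
- exact/exp_bounded_cvg/exp_bounded_diffs/exp_bounded_diffs.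
- by rewrite [ltRHS]ger0_norm ?addr_ge0// ltrDl.
Qed.

(** Matrix power series are treated entrywise, as scalar series in the real variable [x]. *)
Definition mx_bounded C := forall i j, exp_bounded (fun k => C k i j).

Definition pmx C x : 'M[R]_n := \matrix_(i, j) limn (pseries (fun k => C k i j) x).

Lemma pmx_derive C x i j : mx_bounded C ->
  is_derive x (1 : R) (fun x => pmx C x i j) (pmx (fun k => k.+1%:R *: C k.+1) x i j).
Proof.
move=> hC; have := exp_bounded_derive x (hC i j).
rewrite !mxE (_ : (fun k => (k.+1%:R *: C k.+1) i j) = pseries_diffs (fun k => C k i j)); last first.
  by apply/funext => k; rewrite /pseries_diffs mxE.
by under [in X in _ -> X]eq_fun do rewrite mxE.
Qed.

Lemma pmx_cvg C x i j : mx_bounded C ->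
  \sum_(0 <= k < m) C k i j * x ^+ k @[m --> \oo] --> pmx C x i j.
Proof. by move=> hC; rewrite mxE; exact: (exp_bounded_cvg (hC i j)). Qed.

Lemma pmx_eq C x (D : 'M[R]_n) : mx_bounded C ->
  (forall i j, \sum_(0 <= k < m) C k i j * x ^+ k @[m --> \oo] --> D i j) -> pmx C x = D.
Proof.
move=> hC h; apply/matrixP => i j.
exact: (cvg_unique _ (pmx_cvg hC) (h i j)).
Qed.

Lemma pmx_mull B C x : mx_bounded C -> mx_bounded (fun k => B *m C k) ->
  B *m pmx C x = pmx (fun k => B *m C k) x.
Proof.
move=> hC hB; apply/esym/pmx_eq => // i j; rewrite mxE.
rewrite (_ : (fun m => _) = fun m => \sum_l B i l * \sum_(0 <= k < m) C k l j * x ^+ k).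
  apply: cvg_big => [|l _]; first by move=> ? ?; exact: add_continuous.
  by apply: cvgM; [exact: cvg_cst|exact: pmx_cvg].
apply/funext => m; under [RHS]eq_bigr do rewrite big_distrr/=.
rewrite exchange_big/=; apply: eq_bigr => k _; rewrite mxE big_distrl/=.
by apply: eq_bigr => l _; rewrite mulrA.
Qed.

Lemma pmx_mulr B C x : mx_bounded C -> mx_bounded (fun k => C k *m B) ->
  pmx C x *m B = pmx (fun k => C k *m B) x.
Proof.
move=> hC hB; apply/esym/pmx_eq => // i j; rewrite mxE.
rewrite (_ : (fun m => _) = fun m => \sum_l (\sum_(0 <= k < m) C k i l * x ^+ k) * B l j).
  apply: cvg_big => [|l _]; first by move=> ? ?; exact: add_continuous.
  by apply: cvgM; [exact: pmx_cvg|exact: cvg_cst].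
apply/funext => m; under [RHS]eq_bigr do rewrite big_distrl/=.
rewrite exchange_big/=; apply: eq_bigr => k _; rewrite mxE big_distrl/=.
by apply: eq_bigr => l _; rewrite mulrAC.
Qed.

Lemma pmx0 C : mx_bounded C -> pmx C 0 = C 0%N.
Proof.
move=> hC; apply: pmx_eq => // i j; apply: cvg_near_cst; near=> m.
have m0 : (0 < m)%N by near: m; exists 1%N.
rewrite big_ltn// expr0 mulr1 big_nat_cond big1 ?addr0// => k.
by rewrite andbT => /andP[k0 _]; rewrite expr0n eqn0Ngt k0 mulr0.
Unshelve. all: by end_near. Qed.

Definition shift_mx C k := if k is k'.+1 then C k' else 0.

Lemma pmx_shift C x : mx_bounded C -> mx_bounded (shift_mx C) ->
  x *: pmx C x = pmx (shift_mx C) x.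
Proof.
move=> hC hS; apply/esym/pmx_eq => // i j; rewrite mxE -cvg_shiftS /=.
rewrite (_ : (fun m => _) = fun m => x * \sum_(0 <= k < m) C k i j * x ^+ k).
  by apply: cvgM; [exact: cvg_cst|exact: pmx_cvg].
apply/funext => m; rewrite big_nat_recl//= mxE mul0r add0r big_distrr/=.
by apply: eq_bigr => k _; rewrite exprS; ring.
Qed.

Definition fact_bounded (c : nat -> R) := forall k, `|c k| <= (k`!%:R)^-1.

(** [M] is the sum of the moduli of all entries, which bounds each row sum. *)
Lemma exprmx_bound A : exists M : R, 0 <= M /\ forall k i j, `|(A ^+ k) i j| <= M ^+ k.
Proof.
pose M := \sum_i \sum_j `|A i j|; have M0 : 0 <= M.
  by apply: sumr_ge0 => i _; apply: sumr_ge0.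
exists M; split => //; elim => [|k ih] i j.
  by rewrite !expr0 mxE; case: eqP; rewrite ?normr1 ?normr0.
rewrite !exprSr mxE; apply: le_trans (ler_norm_sum _ _ _) _.
apply: (@le_trans _ _ (\sum_l M ^+ k * `|A l j|)).
  by apply: ler_sum => l _; rewrite normrM ler_wpM2r.
rewrite -mulr_sumr ler_wpM2l ?exprn_ge0// /M; apply: ler_sum => l _.
by rewrite (bigD1 j)//= lerDl sumr_ge0.
Qed.

Lemma mx_bounded_pow c A : fact_bounded c -> mx_bounded (fun k => c k *: A ^+ k).
Proof.
move=> hc i j; have [M [M0 h]] := exprmx_bound A; exists 1, M; split => // k.
rewrite mul1r mxE normrM mulrC; exact: ler_pM.
Qed.

Lemma mx_bounded_powM c A B : fact_bounded c -> mx_bounded (fun k => B *m (c k *: A ^+ k)).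
Proof.
move=> hc i j; have [M [M0 h]] := exprmx_bound A; exists (\sum_l `|B i l|), M; split => //.
  exact: sumr_ge0.
move=> k; rewrite mxE; apply: le_trans (ler_norm_sum _ _ _) _; rewrite big_distrl/=.
apply: ler_sum => l _; rewrite normrM ler_wpM2l// mxE normrM mulrC.
by apply: ler_pM => //; exact: hc.
Qed.

Lemma mx_bounded_shift c A : (forall k, `|c k| <= (k.+1`!%:R)^-1) ->
  mx_bounded (shift_mx (fun k => c k *: A ^+ k)).
Proof.
(* Since [M + 1 >= 1], the power may be raised from [k] to [k.+1] to match the shifted index. *)
move=> hc i j; have [M [M0 h]] := exprmx_bound A; exists 1, (M + 1); split => //.
  exact: addr_ge0.
case=> [|k]; first by rewrite /= mxE normr0 mul1r expr0 divr_ge0.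
rewrite mul1r /= mxE normrM mulrC; apply: ler_pM => //.
apply: le_trans (h k i j) _.
apply: (@le_trans _ _ ((M + 1) ^+ k)).
  by rewrite lerXn2r ?nnegrE ?addr_ge0// lerDl.
by apply: ler_weXn2l; rewrite ?lerDr.
Qed.

Lemma expr_scalemx x A k : (x *: A) ^+ k = x ^+ k *: A ^+ k.
Proof.
elim: k => [|k ih]; first by rewrite !expr0 scale1r.
by rewrite !exprS ih -[_ * _]/(_ *m _) -scalemxAl -scalemxAr scalerA.
Qed.

Lemma cvg_mxP (F : nat -> 'M[R]_n) (L : 'M[R]_n) :
  (forall i j, F m i j @[m --> \oo] --> L i j) -> F m @[m --> \oo] --> L.
Proof.
move=> h; apply/cvg_ballP => e e0.
have : \forall m \near \oo, forall i j, ball (L i j) e (F m i j).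
  apply: filter_forall => i; apply: filter_forall => j.
  by have /cvg_ballP/(_ e e0) := h i j.
by apply: filterS => m hm; split => // i j; exact: hm.
Qed.

Lemma entire_pmx c x A : fact_bounded c ->
  entire_mx c (x *: A) = pmx (fun k => c k *: A ^+ k) x.
Proof.
move=> hc; apply/cvg_lim; first exact: norm_hausdorff.
apply: cvg_mxP => i j.
rewrite (_ : (fun m => _) = fun m => \sum_(0 <= k < m) (c k *: A ^+ k) i j * x ^+ k).
  by apply: pmx_cvg; exact: mx_bounded_pow.
apply/funext => m; rewrite /series/= summxE; apply: eq_bigr => k _.
by rewrite expr_scalemx !mxE; ring.
Qed.

End PowerSeries.

(** * Matrix hyperbolic functions and the matrix exponential *)

Section MatrixFunctions.
Context (R : realType) (n : nat) (A : 'M[R]_n).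
Implicit Types (x : R).

Definition exp_mx : 'M[R]_n -> 'M[R]_n := entire_mx (fun k => (k`!%:R)^-1).

Let ife (b : bool) k : `|if b then (0 : R) else (k`!%:R)^-1| <= (k`!%:R)^-1.
Proof. by case: b; rewrite ?normr0 ?ger0_norm ?invr_ge0. Qed.

Let fc : fact_bounded (fun k => if odd k then 0 else (k`!%:R)^-1 : R).
Proof. by move=> k; exact: ife. Qed.

Let fs : fact_bounded (fun k => if odd k then (k`!%:R)^-1 else 0 : R).
Proof. by move=> k; rewrite -if_neg; exact: ife. Qed.

Let fh1 k : `|(if odd k then 0 else (k.+1`!%:R)^-1 : R)| <= (k.+1`!%:R)^-1.
Proof. by case: odd; rewrite ?normr0 ?ger0_norm ?invr_ge0. Qed.

Let fh : fact_bounded (fun k => if odd k then 0 else (k.+1`!%:R)^-1 : R).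
Proof.
move=> k; apply: le_trans (fh1 k) _.
by rewrite lef_pV2 ?posrE ?ltr0n ?fact_gt0// ler_nat factS leq_pmull.
Qed.

Let fe : fact_bounded (fun k => (k`!%:R)^-1 : R).
Proof. by move=> k; rewrite ger0_norm ?invr_ge0. Qed.

Let factS_inv k : k.+1%:R * (k.+1`!%:R)^-1 = (k`!%:R)^-1 :> R.
Proof. by rewrite factS natrM invfM mulVKf. Qed.

Lemma entire_derive (c d : nat -> R) x i j : fact_bounded c -> fact_bounded d ->
  (forall k, k.+1%:R * c k.+1 = d k) ->
  is_derive x (1 : R) (fun x => entire_mx c (x *: A) i j) ((A *m entire_mx d (x *: A)) i j).
Proof.
move=> hc hd cd; under eq_fun do rewrite entire_pmx//.
rewrite entire_pmx// pmx_mull; [|exact: mx_bounded_pow|exact: mx_bounded_powM].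
apply: is_derive_eq (pmx_derive x i j (mx_bounded_pow A hc)) _.
congr (pmx _ _ _ _); apply/funext => k.
by rewrite scalerA cd exprS -scalemxAr.
Qed.

Lemma entire0 (c : nat -> R) : fact_bounded c -> entire_mx c (0 *: A) = (c 0%N)%:M.
Proof.
move=> hc; rewrite entire_pmx// pmx0; last exact: mx_bounded_pow.
by rewrite expr0 -scalemx1.
Qed.

Lemma entire_comm (c : nat -> R) x : fact_bounded c ->
  A *m entire_mx c (x *: A) = entire_mx c (x *: A) *m A.
Proof.
move=> hc; rewrite !entire_pmx//.
have e k : A *m (c k *: A ^+ k) = c k *: A ^+ k *m A.
  by rewrite -scalemxAr -scalemxAl -[A *m _]exprS -[_ *m A]exprSr.
rewrite pmx_mull; [|exact: mx_bounded_pow|exact: mx_bounded_powM].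
rewrite pmx_mulr; [|exact: mx_bounded_pow|].
  by congr (pmx _ _); apply/funext => k; exact: e.
by move=> i j; under eq_fun do rewrite -e; exact: mx_bounded_powM.
Qed.

Lemma cosh_derive x i j :
  is_derive x (1 : R) (fun x => cosh_mx (x *: A) i j) ((A *m sinh_mx (x *: A)) i j).
Proof.
apply: entire_derive => // k; rewrite /=; case: odd => /=; last by rewrite mulr0.
exact: factS_inv.
Qed.

Lemma sinh_derive x i j :
  is_derive x (1 : R) (fun x => sinh_mx (x *: A) i j) ((A *m cosh_mx (x *: A)) i j).
Proof.
apply: entire_derive => // k; rewrite /=; case: odd => /=; first by rewrite mulr0.
exact: factS_inv.
Qed.

Lemma exp_derive x i j :
  is_derive x (1 : R) (fun x => exp_mx (x *: A) i j) ((A *m exp_mx (x *: A)) i j).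
Proof. by apply: entire_derive => // k; exact: factS_inv. Qed.

(** This series plays the role of A^-1 sinh(xA) and makes sense for singular [A]; its derivative is
    cosh(xA). *)
Lemma xsinhc_pmx x : x *: sinhc_mx (x *: A) =
  pmx (shift_mx (fun k => (if odd k then 0 else (k.+1`!%:R)^-1) *: A ^+ k)) x.
Proof.
rewrite /sinhc_mx entire_pmx// pmx_shift//; first exact: mx_bounded_pow.
exact: mx_bounded_shift.
Qed.

Lemma xsinhc_derive x i j :
  is_derive x (1 : R) (fun x => (x *: sinhc_mx (x *: A)) i j) (cosh_mx (x *: A) i j).
Proof.
under eq_fun do rewrite xsinhc_pmx.
apply: is_derive_eq (pmx_derive x i j (mx_bounded_shift A fh1)) _.
rewrite /cosh_mx entire_pmx//; congr (pmx _ _ _ _); apply/funext => k /=.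
by rewrite scalerA; case: odd; rewrite ?mulr0// factS_inv.
Qed.

Lemma mul_xsinhc x : A *m (x *: sinhc_mx (x *: A)) = sinh_mx (x *: A).
Proof.
have e : (fun k => A *m shift_mx (fun k => (if odd k then 0 else (k.+1`!%:R)^-1 : R) *: A ^+ k) k) =
   (fun k => (if odd k then (k`!%:R)^-1 else 0) *: A ^+ k).
  apply/funext => -[|k] /=; first by rewrite mulmx0 scale0r.
  by rewrite -scalemxAr -[A *m _]exprS; case: odd.
rewrite xsinhc_pmx pmx_mull; last by rewrite e; exact: mx_bounded_pow.
  by rewrite e /sinh_mx entire_pmx.
exact: mx_bounded_shift.
Qed.

Lemma cosh0 : cosh_mx (0 *: A) = 1%:M.
Proof. by rewrite /cosh_mx entire0//= fact0 invr1. Qed.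

Lemma sinh0 : sinh_mx (0 *: A) = 0.
Proof. by rewrite /sinh_mx entire0//= raddf0. Qed.

Lemma exp0 : exp_mx (0 *: A) = 1%:M.
Proof. by rewrite /exp_mx entire0//= fact0 invr1. Qed.

Lemma cosh_comm x : A *m cosh_mx (x *: A) = cosh_mx (x *: A) *m A.
Proof. exact: entire_comm. Qed.

Lemma sinh_comm x : A *m sinh_mx (x *: A) = sinh_mx (x *: A) *m A.
Proof. exact: entire_comm. Qed.

Lemma exp_comm x : A *m exp_mx (x *: A) = exp_mx (x *: A) *m A.
Proof. exact: entire_comm. Qed.

Lemma mulmx_derive p q (B : 'M[R]_(p, n)) (E : R -> 'M[R]_n) (E' : 'M[R]_n) (D : 'M[R]_(n, q)) x i j :
  (forall i j, is_derive x (1 : R) (fun x => E x i j) (E' i j)) ->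
  is_derive x (1 : R) (fun x => (B *m E x *m D) i j) ((B *m E' *m D) i j).
Proof.
move=> h.
rewrite (_ : (fun x => _) = fun x => \sum_l \sum_k (B i k * D l j) * E x k l); last first.
  apply/funext => y; rewrite mxE; apply: eq_bigr => l _; rewrite mxE big_distrl/=.
  by apply: eq_bigr => k _; rewrite mulrAC.
rewrite (_ : _ i j = \sum_l \sum_k (B i k * D l j) * E' k l); last first.
  rewrite mxE; apply: eq_bigr => l _; rewrite mxE big_distrl/=.
  by apply: eq_bigr => k _; rewrite mulrAC.
by apply: der_sum => l; apply: der_sum => k; exact: derZ.
Qed.

End MatrixFunctions.

(** * Decay of the matrix exponential *)

Section ComplexParts.
Context (R : realType).
Implicit Types (u v : R[i]).

Lemma cReD u v : complex.Re (u + v) = complex.Re u + complex.Re v.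
Proof. by case: u v => [a b] [c d]. Qed.

Lemma cImD u v : complex.Im (u + v) = complex.Im u + complex.Im v.
Proof. by case: u v => [a b] [c d]. Qed.

Lemma cReM u v : complex.Re (u * v) =
  complex.Re u * complex.Re v - complex.Im u * complex.Im v.
Proof. by case: u v => [a b] [c d]. Qed.

Lemma cImM u v : complex.Im (u * v) =
  complex.Re u * complex.Im v + complex.Im u * complex.Re v.
Proof. by case: u v => [a b] [c d]. Qed.

Definition re_mx p q (B : 'M[R[i]]_(p, q)) : 'M[R]_(p, q) := map_mx (@complex.Re R) B.
Definition im_mx p q (B : 'M[R[i]]_(p, q)) : 'M[R]_(p, q) := map_mx (@complex.Im R) B.

Lemma re_mulmx_real p q r (B : 'M[R[i]]_(p, q)) (F : 'M[R]_(q, r)) :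
  re_mx (B *m map_mx (real_complex R) F) = re_mx B *m F.
Proof.
apply/matrixP => i j; rewrite !mxE (big_morph _ cReD erefl).
by apply: eq_bigr => k _; rewrite !mxE cReM /= mulr0 subr0.
Qed.

Lemma im_mulmx_real p q r (B : 'M[R[i]]_(p, q)) (F : 'M[R]_(q, r)) :
  im_mx (B *m map_mx (real_complex R) F) = im_mx B *m F.
Proof.
apply/matrixP => i j; rewrite !mxE (big_morph _ cImD erefl).
by apply: eq_bigr => k _; rewrite !mxE cImM /= mulr0 add0r.
Qed.

End ComplexParts.

Section Decay.
Context (R : realType) (n : nat).
Implicit Types (F : 'M[R]_n.+1) (Y : R -> 'cV[R]_n.+1).

Definition lin_sol F Y := forall t i, is_derive t (1 : R) (fun t => Y t i 0) ((F *m Y t) i 0).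

Definition sqnorm (v : 'cV[R]_n.+1) : R := \sum_i v i 0 ^+ 2.

Lemma sqnorm_ge0 v : 0 <= sqnorm v.
Proof. by apply: sumr_ge0 => i _; exact: sqr_ge0. Qed.

Lemma sqnorm_bound (B : 'M[R]_n.+1) i : exists K : R, 0 <= K /\
  forall v : 'cV[R]_n.+1, (B *m v) i 0 ^+ 2 <= K * sqnorm v.
Proof.
exists ((\sum_j `|B i j|) ^+ 2); split; first exact: sqr_ge0.
move=> v; rewrite mxE.
have h j : `|v j 0| <= Num.sqrt (sqnorm v).
  rewrite -sqrtr_sqr ler_wsqrtr// /sqnorm (bigD1 j)//= lerDl sumr_ge0// => k _.
  exact: sqr_ge0.
rewrite -[leLHS]real_normK ?num_real//.
rewrite -[X in _ * X](sqr_sqrtr (sqnorm_ge0 v)) -exprMn lerXn2r ?nnegrE//.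
  by rewrite mulr_ge0 ?sqrtr_ge0 ?sumr_ge0.
apply: le_trans (ler_norm_sum _ _ _) _; rewrite mulr_suml.
by apply: ler_sum => j _; rewrite normrM ler_wpM2l.
Qed.

Lemma sol_mulmx F Y (B : 'M[R]_n.+1) t i : lin_sol F Y ->
  is_derive t (1 : R) (fun t => (B *m Y t) i 0) ((B *m F *m Y t) i 0).
Proof.
move=> hY; rewrite (_ : (fun t => _) = fun t => \sum_j B i j * Y t j 0); last first.
  by apply/funext => s; rewrite mxE.
rewrite -mulmxA mxE; apply: der_sum => j; exact: derZ.
Qed.

Lemma comm_prod_factor (G : 'M[R[i]]_n.+1) (s : seq R[i]) z :
  (\prod_(y <- s) (G - y%:M)) *m (G - z%:M) = (G - z%:M) *m \prod_(y <- s) (G - y%:M).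
Proof.
have cs (X : 'M[R[i]]_n.+1) (c : R[i]) : GRing.comm X c%:M by rewrite /GRing.comm -![_ * _]/(_ *m _) scalar_mxC.
apply/esym; apply: commr_prod => y _.
apply: commrB; last exact: cs.
by apply/commr_sym; apply: commrB; [exact: commr_refl|exact: cs].
Qed.

(* Peeling off the factors F - s_i one at a time, each step is a scalar
   differential inequality to which gronwall_decay applies. *)
Lemma decay_prod F (s : seq R[i]) (B : 'M[R[i]]_n.+1) :
  (forall z, z \in s -> complex.Re z < 0) ->
  B *m map_mx (real_complex R) F = map_mx (real_complex R) F *m B ->
  (\prod_(z <- s) (map_mx (real_complex R) F - z%:M)) *m B = 0 ->
  exists M w : R, [/\ 0 <= M, 0 < w & forall Y, lin_sol F Y -> forall t i, 0 <= t ->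
    (re_mx B *m Y t) i 0 ^+ 2 + (im_mx B *m Y t) i 0 ^+ 2 <=
      M * expR (- w * t) * sqnorm (Y 0)].
Proof.
set Fc := map_mx (real_complex R) F.
elim: s B => [|z s ih] B hs hB.
  rewrite big_nil mul1mx => B0; exists 0, 1; split => // Y _ t i _.
  have -> : re_mx B = 0 by apply/matrixP => k l; rewrite B0 !mxE.
  have -> : im_mx B = 0 by apply/matrixP => k l; rewrite B0 !mxE.
  by rewrite !mul0mx mxE expr0n/= !mul0r addr0.
rewrite big_cons => hP.
have z0 : complex.Re z < 0 by apply: hs; rewrite inE eqxx.
pose B' := (Fc - z%:M) *m B.
have hB' : B' *m Fc = Fc *m B'.
  rewrite /B' -mulmxA hB !mulmxA; congr (_ *m B).
  by rewrite mulmxBl mulmxBr scalar_mxC.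
have hP' : (\prod_(z <- s) (Fc - z%:M)) *m B' = 0.
  by rewrite /B' mulmxA -hP; congr (_ *m B); exact: comm_prod_factor.
have [|M' [w' [M0 w0 hM]]] := ih B' _ hB' hP'.
  by move=> x xs; apply: hs; rewrite inE xs orbT.
move=> {s ih hs hP hP'}.
set a := complex.Re z; set b := complex.Im z; pose rho := - a.
have rho0 : 0 < rho by rewrite oppr_gt0.
have BF : B *m Fc = z *: B + B'.
  by rewrite /B' mulmxBl mul_scalar_mx hB addrC subrK.
have eR : re_mx B *m F = a *: re_mx B - b *: im_mx B + re_mx B'.
  rewrite -re_mulmx_real -/Fc BF; apply/matrixP => i j; rewrite [LHS]mxE [in LHS]mxE cReD.
  by rewrite [in LHS]mxE cReM !mxE.
have eI : im_mx B *m F = b *: re_mx B + a *: im_mx B + im_mx B'.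
  rewrite -im_mulmx_real -/Fc BF; apply/matrixP => i j; rewrite [LHS]mxE [in LHS]mxE cImD.
  by rewrite [in LHS]mxE cImM !mxE /a /b; ring.
have [K [K0 hK]] : exists K : R, 0 <= K /\ forall i v,
    (re_mx B *m v) i 0 ^+ 2 + (im_mx B *m v) i 0 ^+ 2 <= K * sqnorm v.
  have [k1 h1] := choice (sqnorm_bound (re_mx B)).
  have [k2 h2] := choice (sqnorm_bound (im_mx B)).
  have k10 i : 0 <= k1 i by have [] := h1 i.
  have k20 i : 0 <= k2 i by have [] := h2 i.
  exists (\sum_i (k1 i + k2 i)); split; first by apply: sumr_ge0 => i _; exact: addr_ge0.
  move=> i v; have [_ /(_ v) g1] := h1 i; have [_ /(_ v) g2] := h2 i.
  apply: (@le_trans _ _ ((k1 i + k2 i) * sqnorm v)); first by rewrite mulrDl lerD.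
  rewrite ler_wpM2r ?sqnorm_ge0// (bigD1 i)//= lerDl sumr_ge0// => k _.
  exact: addr_ge0.
pose v := Num.min rho w' / 2.
exists (K + M' / rho / (w' / 2)), v; split.
- by rewrite addr_ge0// !divr_ge0// ltW.
- by rewrite divr_gt0// lt_min rho0.
move=> Y hY t i t0.
set N := sqnorm (Y 0); have N0 : 0 <= N by exact: sqnorm_ge0.
pose p s := (re_mx B *m Y s) i 0; pose q s := (im_mx B *m Y s) i 0.
pose p' s := (re_mx B' *m Y s) i 0; pose q' s := (im_mx B' *m Y s) i 0.
have dp s : is_derive s (1 : R) p (a * p s - b * q s + p' s).
  apply: is_derive_eq (sol_mulmx (re_mx B) s i hY) _.
  by rewrite eR !mulmxDl mulNmx -!scalemxAl /p /q /p' !mxE.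
have dq s : is_derive s (1 : R) q (b * p s + a * q s + q' s).
  apply: is_derive_eq (sol_mulmx (im_mx B) s i hY) _.
  by rewrite eI !mulmxDl -!scalemxAl /p /q /q' !mxE.
pose f s := p s * p s + q s * q s.
pose f' s := ((a * p s - b * q s + p' s) * p s + p s * (a * p s - b * q s + p' s)) +
   ((b * p s + a * q s + q' s) * q s + q s * (b * p s + a * q s + q' s)).
have df s : is_derive s (1 : R) f (f' s) by apply: derD; exact: derM.
have f0 s : 0 <= f s by rewrite addr_ge0// -expr2 sqr_ge0.
have D0 : 0 <= M' / rho * N by rewrite mulr_ge0// divr_ge0// ltW.
(* Diagonal terms contribute [- 2 * rho * f], and the rotation by [b] cancels. Half of this decay
   absorbs the coupling through [2 * p * p' <= rho * p ^+ 2 + p' ^+ 2 / rho]. *)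
have fb s : 0 <= s -> f' s <= - rho * f s + M' / rho * N * expR (- w' * s).
  move=> s0; have := hM Y hY s i s0; rewrite -/N -/(p' s) -/(q' s) => h.
  have h2 : (p' s ^+ 2 + q' s ^+ 2) / rho <= M' / rho * N * expR (- w' * s).
    rewrite ler_pdivrMr//; apply: le_trans h _.
    rewrite le_eqVlt; apply/orP; left; apply/eqP; field.
    by rewrite gt_eqF.
  apply: le_trans (lerD (lexx _) h2).
  rewrite -subr_ge0 /f' /f.
  have -> : - rho * (p s * p s + q s * q s) + (p' s ^+ 2 + q' s ^+ 2) / rho -
    ((a * p s - b * q s + p' s) * p s + p s * (a * p s - b * q s + p' s) +
    ((b * p s + a * q s + q' s) * q s + q s * (b * p s + a * q s + q' s))) =
    rho * ((p s - p' s / rho) ^+ 2 + (q s - q' s / rho) ^+ 2).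
    have -> : a = - rho by rewrite opprK.
    by field; rewrite gt_eqF.
  by rewrite mulr_ge0 ?(ltW rho0)// addr_ge0// sqr_ge0.
have [v' [_ v'E /(_ t t0)]] := gronwall_decay rho0 w0 D0 df f0 fb.
rewrite v'E -/v /f -!expr2 => /le_trans; apply.
have h := hK i (Y 0); rewrite -/N -/(p 0) -/(q 0) in h.
have -> : (K + M' / rho / (w' / 2)) * expR (- v * t) * N =
    expR (- v * t) * (K * N + M' / rho * N / (w' / 2)) by ring.
by rewrite ler_wpM2l ?expR_ge0// lerD2r.
Qed.

(** By Cayley-Hamilton the product of the factors [F - z] over all roots of the characteristic
    polynomial is 0, so [decay_prod] applies with [B = 1]. The summand 1 in the constant only
    secures positivity. *)
Lemma hurwitz_decay F : hurwitz F -> exists M w : R, [/\ 0 < M, 0 < w &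
  forall Y, lin_sol F Y -> forall t, 0 <= t ->
    sqnorm (Y t) <= M * expR (- w * t) * sqnorm (Y 0)].
Proof.
move=> hF; set Fc := map_mx (real_complex R) F.
have [s hs] := closed_field_poly_normal (char_poly Fc).
rewrite (monicP (char_poly_monic Fc)) scale1r in hs.
have sr z : z \in s -> complex.Re z < 0.
  move=> zs; apply: hF; rewrite /mx_spectrum eigenvalue_root_char -/Fc hs.
  by rewrite root_prod_XsubC.
have P0 : \prod_(z <- s) (Fc - z%:M) = 0.
  rewrite -(Cayley_Hamilton Fc) hs rmorph_prod/=; apply: eq_bigr => z _.
  by rewrite rmorphB/= horner_mx_X horner_mx_C.
have [|| M [w [M0 w0 hM]]] := @decay_prod F s 1%:M sr.
- by rewrite mul1mx mulmx1.
- by rewrite mulmx1.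
have r1 : re_mx (1%:M : 'M[R[i]]_n.+1) = 1%:M.
  by apply/matrixP => i j; rewrite !mxE; case: eqP.
exists (n.+1%:R * M + 1), w; split => //; first by rewrite ltr_wpDl// mulr_ge0.
move=> Y hY t t0.
apply: (@le_trans _ _ (\sum_(i < n.+1) M * expR (- w * t) * sqnorm (Y 0))).
  apply: ler_sum => i _; have := hM Y hY t i t0; rewrite r1 mul1mx.
  by apply: le_trans; rewrite lerDl sqr_ge0.
rewrite sumr_const card_ord -mulr_natl.
have h : 0 <= expR (- w * t) * sqnorm (Y 0) by rewrite mulr_ge0 ?expR_ge0 ?sqnorm_ge0.
lra.
Qed.

End Decay.

(** * Invertibility of the gain matrix *)

Section SmoothStates.
Context (R : realType).
Implicit Types (f g : R -> R).

Lemma mkL2_ext f g : L2loc f -> L2loc g -> (forall x, 0 <= x <= 1 -> f x = g x) ->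
  mkL2 f = mkL2 g.
Proof.
move=> hf hg fg; apply: L2_ext; apply/ae01P.
have /ae01P e1 := mkL2E hf; have /ae01P e2 := mkL2E hg.
by apply: aeon2 e1 e2 => x x01 h1 h2; rewrite h1 h2 fg.
Qed.

Lemma mkL2_lin c f g : L2loc f -> L2loc g ->
  mkL2 (fun x => c * f x + g x) = c *: mkL2 f + mkL2 g.
Proof.
move=> hf hg; apply: L2_ext; apply/ae01P.
have hs : L2loc (fun x => c * f x + g x) by apply: L2locD => //; exact: L2locZ.
have /ae01P e0 := mkL2E hs; have /ae01P e1 := mkL2E hf; have /ae01P e2 := mkL2E hg.
have /ae01P e3 := L2_linE c (mkL2 f) (mkL2 g).
apply: aeon2 (aeon2 (fun x _ p q => conj p q) e0 e1) (aeon2 (fun x _ p q => conj p q) e2 e3).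
by move=> x _ [h0 h1] [h2 h3]; rewrite [LHS]h0 [RHS]h3 h1 h2.
Qed.

Lemma ig_ext_mkL2 f (a b : R) : 0 <= a -> b <= 1 -> L2loc f ->
  ig a b (ext (mkL2 f)) = ig a b f.
Proof.
move=> a0 b1 hf; apply: ig_ae; [exact/L2loc_L1/ext_L2loc|exact: L2loc_L1|].
have /ae01P h := mkL2E hf; apply: aeonS (aeon_sub a0 b1 h) => x /andP[ax xb].
by rewrite extE// (le_trans a0)// (le_trans xb).
Qed.

Lemma smooth_H1 f (f' : R -> R) : (forall x, is_derive x (1 : R) f (f' x)) -> continuous f' ->
  (forall x, 0 <= x <= 1 -> mkH1 (f 1) (mkL2 f') x = f x) /\
  H1_val (mkH1 (f 1) (mkL2 f')) = mkL2 f.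
Proof.
move=> df cf; have h x : 0 <= x <= 1 -> mkH1_fun (f 1) (mkL2 f') x = f x.
  move=> /andP[x0 x1]; rewrite /mkH1_fun ig_ext_mkL2//; last exact: cont_L2loc.
  by rewrite (FTC2 df cf x1) addrK.
split; first by move=> x x01; rewrite mkH1E//; exact: h.
apply: mkL2_ext => //; apply: cont_L2loc; first exact: mkH1_fun_cont.
exact: der_cont df.
Qed.

End SmoothStates.

Section EigenRows.
Context (R : realType) (n : nat) (A : 'M[R]_n) (al be : R).
Local Notation wave_state := (H1 R * L2 R)%type.

Definition gain_mx : 'M[R]_n := A *m sinh_mx A + (al%:M + be *: A) *m cosh_mx A.

(** Commutation makes the left kernel of [gain_mx] stable under [A]. *)
Lemma gain_comm : A *m gain_mx = gain_mx *m A.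
Proof.
have := cosh_comm A 1; have := sinh_comm A 1; rewrite scale1r => hs hc.
rewrite /gain_mx mulmxDr mulmxDl -!mulmxA hs; congr (_ + _).
rewrite -hc !mulmxA; congr (_ *m _).
by rewrite mulmxDr mulmxDl scalar_mxC -scalemxAl -scalemxAr.
Qed.

Variable j : 'I_n.

Let ej : 'cV[R]_n := delta_mx j 0.
Let fc (r : 'rV[R]_n) x : R := (r *m cosh_mx (x *: A) *m ej) 0 0.
Let fs (r : 'rV[R]_n) x : R := (r *m sinh_mx (x *: A) *m ej) 0 0.

Let dfc r x : is_derive x (1 : R) (fc r) (fs (r *m A) x).
Proof.
apply: is_derive_eq (mulmx_derive r ej 0 0 (cosh_derive A x)) _.
by rewrite /fs mulmxA.
Qed.

Let dfs r x : is_derive x (1 : R) (fs r) (fc (r *m A) x).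
Proof.
apply: is_derive_eq (mulmx_derive r ej 0 0 (sinh_derive A x)) _.
by rewrite /fc mulmxA.
Qed.

Let cfc r : continuous (fc r).
Proof. exact: (der_cont (dfc r)). Qed.

Let cfs r : continuous (fs r).
Proof. exact: (der_cont (dfs r)). Qed.

Let fc_lin c r r' x : fc (c *: r + r') x = c * fc r x + fc r' x.
Proof. by rewrite /fc !mulmxDl -!scalemxAl !mxE. Qed.

Let fs_lin c r r' x : fs (c *: r + r') x = c * fs r x + fs r' x.
Proof. by rewrite /fs !mulmxDl -!scalemxAl !mxE. Qed.

(** The pair (f, g) with f(x) = r cosh(xA) e_j and g(x) = r A cosh(xA) e_j. Rows stay real: the real
    and imaginary parts of a complex row give the two components of an element of the complexified
    space. *)
Let st (r : 'rV[R]_n) : wave_state := (mkH1 (fc r 1) (mkL2 (fs (r *m A))), mkL2 (fc (r *m A))).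

Let st_lin c r r' : st (c *: r + r') = c *: st r + st r'.
Proof.
have [l1 l2] := H1_lin c (st r).1 (st r').1.
apply/pair_equal_spec; split => /=.
  apply: H1_ext; first by rewrite l1 ?lexx ?ler01// !mkH11 fc_lin.
  rewrite l2 !mkH1_wd -mkL2_lin; [|exact/cont_L2loc/cfs|exact/cont_L2loc/cfs].
  by congr mkL2; apply/funext => x; rewrite mulmxDl -scalemxAl fs_lin.
rewrite -mkL2_lin; [|exact/cont_L2loc/cfc|exact/cont_L2loc/cfc].
by congr mkL2; apply/funext => x; rewrite mulmxDl -scalemxAl fc_lin.
Qed.

(** For every row f'' = r A^2 cosh(xA) e_j and f'(0) = 0; the condition at x = 1 is the entry [j] of
    [r *m gain_mx = 0]. *)
Let st_graph r : r *m gain_mx = 0 -> A1_op al be (st r) (st (r *m A)).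
Proof.
move=> rM; split; first by have [_ ->] := smooth_H1 (dfc (r *m A)) (cfs (r := _)).
exists (mkH1 (fs (r *m A) 1) (mkL2 (fc (r *m A *m A)))).
have [pE ->] := smooth_H1 (dfs (r *m A)) (cfc (r := _)).
rewrite !mkH1_wd; split => //.
  by rewrite pE ?lexx ?ler01// /fs sinh0 mulmx0 mul0mx mxE.
rewrite !mkH11 addr0; apply/eqP; rewrite -subr_eq0; apply/eqP.
have E : r *m gain_mx = r *m A *m sinh_mx A + al *: (r *m cosh_mx A) + be *: (r *m A *m cosh_mx A).
  rewrite /gain_mx mulmxDr mulmxA (mulmxDl al%:M) mul_scalar_mx -scalemxAl mulmxDr.
  by rewrite -!scalemxAr !mulmxA addrA.
have : (r *m gain_mx *m ej) 0 0 = 0 by rewrite rM mul0mx mxE.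
rewrite E !mulmxDl -!scalemxAl => h.
have {}h : fs (r *m A) 1 + al * fc r 1 + be * fc (r *m A) 1 = 0.
  by rewrite -[RHS]h /fs /fc scale1r !mxE.
by rewrite -[RHS]h; ring.
Qed.

(* If q A = l q and q gain_mx = 0 then f(x) = q cosh(xA) e_j satisfies
   f'' = l^2 f, f'(0) = 0 and f'(1) = - (al + l be) f(1), so (f, l f) is an
   eigenvector of A1_op. *)
Lemma eigenrow_spectrum (q : 'rV[R[i]]_n) (l : R[i]) : q 0 j != 0 ->
  q *m map_mx (real_complex R) A = l *: q ->
  q *m map_mx (real_complex R) gain_mx = 0 ->
  spectrum (wave_norm al) (A1_op al be) l.
Proof.
move=> qj qA qM [/(_ 0) [z [_ zu]] _].
set a := complex.Re l; set b := complex.Im l.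
have eR : re_mx q *m A = a *: re_mx q - b *: im_mx q.
  rewrite -re_mulmx_real qA; apply/matrixP => i k.
  by rewrite [LHS]mxE [in LHS]mxE cReM !mxE.
have eI : im_mx q *m A = b *: re_mx q + a *: im_mx q.
  rewrite -im_mulmx_real qA; apply/matrixP => i k.
  by rewrite [LHS]mxE [in LHS]mxE cImM !mxE /a /b; ring.
have mR : re_mx q *m gain_mx = 0.
  by rewrite -re_mulmx_real qM; apply/matrixP => i k; rewrite !mxE.
have mI : im_mx q *m gain_mx = 0.
  by rewrite -im_mulmx_real qM; apply/matrixP => i k; rewrite !mxE.
have st0 : st 0 = 0 by have := st_lin (-1) 0 0; rewrite scaler0 add0r scaleN1r addNr.
(* Were [l] in the resolvent set, the equation with right-hand side 0 would have one solution,
   whereas both this pair and [(st 0, st 0)] solve it. The traces at x = 0, where cosh(xA) is the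
   identity, then give [q 0 j = 0]. *)
have e1 : z = (st (re_mx q), st (im_mx q)).
  apply: zu; exists (st (re_mx q *m A), st (im_mx q *m A)).
    by split; exact: st_graph.
  have stZ c r : st (c *: r) = c *: st r.
    by rewrite -[X in st X]addr0 st_lin st0 addr0.
  by rewrite /cplx_scale/= eR eI -/a -/b -!scaleNr !st_lin !stZ subrr.
have e2 : z = (st 0, st 0).
  apply: zu; exists (st (0 *m A), st (0 *m A)).
    by split; apply: st_graph; rewrite mul0mx.
  by rewrite /cplx_scale/= mul0mx st0 !scaler0 !subr0 addr0.
have stj r : (st r).1 0 = r 0 j.
  have [sE _] := smooth_H1 (dfc r) (cfs (r := r *m A)).
  have -> : (st r).1 0 = fc r 0 by apply: sE; rewrite lexx ler01.
  by rewrite /fc cosh0 mulmx1 /ej -colE mxE.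
have h1 : st (re_mx q) = st 0 := congr1 fst (etrans (esym e1) e2).
have h2 : st (im_mx q) = st 0 := congr1 snd (etrans (esym e1) e2).
have r0 := stj (re_mx q); have i0 := stj (im_mx q).
rewrite h1 stj !mxE in r0; rewrite h2 stj !mxE in i0.
by case: (q 0 j) qj r0 i0 => x y /= qn x0 y0; move: qn; rewrite -x0 -y0 eqxx.
Qed.

End EigenRows.

Section GainUnit.
Context (R : realType) (n : nat) (A : 'M[R]_n) (al be : R).

(** By Cayley-Hamilton [v] is annihilated by the product of the factors [G - z]. Applying them one
    after another, the last row before 0 is an eigenrow, and since [M] commutes with [G] no row
    leaves the left kernel of [M]. *)
Lemma stable_eigenrow m (G M : 'M[R[i]]_m.+1) (v : 'rV[R[i]]_m.+1) :
  G *m M = M *m G -> v != 0 -> v *m M = 0 ->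
  exists (q : 'rV[R[i]]_m.+1) (l : R[i]), [/\ q != 0, q *m G = l *: q & q *m M = 0].
Proof.
move=> GM v0 vM.
have [s hs] := closed_field_poly_normal (char_poly G).
rewrite (monicP (char_poly_monic G)) scale1r in hs.
have P0 : v *m \prod_(z <- s) (G - z%:M) = 0.
  rewrite (_ : \prod_(z <- s) _ = 0) ?mulmx0//.
  rewrite -(Cayley_Hamilton G) hs rmorph_prod/=; apply: eq_bigr => z _.
  by rewrite rmorphB/= horner_mx_X horner_mx_C.
elim: s v v0 vM P0 {hs} => [|z s ih] v v0 vM.
  by rewrite big_nil mulmx1 => /eqP; rewrite (negbTE v0).
rewrite big_cons mulmxA => P0.
have [vz|vz] := eqVneq (v *m (G - z%:M)) 0.
  exists v, z; split => //; apply/eqP; rewrite -subr_eq0 -vz mulmxBr.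
  by rewrite scalar_mxC mul_scalar_mx.
apply: (ih _ vz) => //.
by rewrite -mulmxA mulmxBl GM -scalar_mxC -mulmxBr mulmxA vM mul0mx.
Qed.

Lemma gain_unit : (forall l : R[i],
     ~ (mx_spectrum A l /\ spectrum (wave_norm al) (A1_op al be) l)) ->
  gain_mx A al be \in unitmx.
Proof.
case: n A => [|m] B disj; first by rewrite unitmxE det_mx00 unitr1.
apply: contraT => nu; exfalso.
set G := map_mx (real_complex R) B; set M := map_mx (real_complex R) (gain_mx B al be).
have GM : G *m M = M *m G by rewrite /G /M -!map_mxM gain_comm.
have : M \notin unitmx by rewrite map_unitmx.
rewrite -row_free_unit -kermx_eq0 => /rowV0Pn[v /sub_kermxP vM v0].
have [q [l [q0 qG qM]]] := stable_eigenrow GM v0 vM.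
apply: (disj l); split.
  by apply/eigenvalueP; exists q.
have /rV0Pn[j qj] := q0.
exact: eigenrow_spectrum qj qG qM.
Qed.

End GainUnit.

(** * The decoupling transformation *)

Section IntegralSums.
Context (R : realType) (I : Type).
Implicit Types (s : seq I) (f : I -> R -> R).

Lemma L1loc_sum s f : (forall k, L1loc (f k)) -> L1loc (fun x => \sum_(k <- s) f k x).
Proof.
move=> hf; elim: s => [|k s ih].
  by under eq_fun do rewrite big_nil; apply: cont_L1loc => x; exact: cst_continuous.
by under eq_fun do rewrite big_cons; exact: L1locD.
Qed.

Lemma ig_sum s f (a b : R) : (forall k, L1loc (f k)) ->
  ig a b (fun x => \sum_(k <- s) f k x) = \sum_(k <- s) ig a b (f k).
Proof.
move=> hf; elim: s => [|k s ih].
  by under eq_fun do rewrite big_nil; rewrite big_nil ig0.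
under eq_fun do rewrite big_cons; rewrite big_cons igD// ?ih//.
exact: L1loc_sum.
Qed.

End IntegralSums.

Section Functional.
Context (R : realType) (n : nat) (A : 'M[R]_n) (B1 B2 B3 B4 : 'cV[R]_n) (al be : R).
Hypotheses (al0 : 0 < al).
Local Notation wave_state := (H1 R * L2 R)%type.
Implicit Types (z y : wave_state).

Let Q := gain_Q al be A B1 B2 B3 B4.
Let b := A *m B2 + B1.
Let L1 := gain_L1 al be A B1 B2 B3 B4.
Let L2g := gain_L2 al be A B1 B2 B3 B4.
Let L3 := gain_L3 B2.
Let L4 := gain_L4 al be A B1 B2 B3 B4.
Let dL2 (x : R) : 'cV[R]_n := - (cosh_mx (x *: A) *m b) + A *m sinh_mx (x *: A) *m Q.

Definition wave_functional z : 'cV[R]_n := z.1 0 *: L3 + z.1 1 *: L4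
  + \col_i ig 0 1 (fun x => L1 x i 0 * z.1 x) + \col_i ig 0 1 (fun x => L2g x i 0 * z.2 x).

Lemma wave_functionalE z i : wave_functional z i 0 = z.1 0 * L3 i 0 + z.1 1 * L4 i 0
  + ig 0 1 (fun x => L1 x i 0 * z.1 x) + ig 0 1 (fun x => L2g x i 0 * z.2 x).
Proof. by rewrite /wave_functional; move: L3 L4 => l3 l4; rewrite !mxE. Qed.

Lemma feedbackE K X z : feedback al be A B1 B2 B3 B4 K (X, z) =
  (K^T *m (X + wave_functional z)) 0 0.
Proof. by case: z => w v; rewrite /feedback /wave_functional !addrA. Qed.

(** This relation makes the integral of L1 w_t equal to [A] times the integral of L2 w_t. *)
Lemma mul_L2 x : A *m L2g x = L1 x.
Proof.
rewrite /L2g /gain_L2 /L1 /gain_L1 -/b -/Q mulmxDr mulmxN !mulmxA; congr (- _ + _).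
by rewrite scalemxAl mulmxA mul_xsinhc.
Qed.

Let dL2_derive x i : is_derive x (1 : R) (fun x => L2g x i 0) (dL2 x i 0).
Proof.
have h1 := mulmx_derive (-1%:M : 'M[R]_n) b i 0 (xsinhc_derive A x).
have h2 := mulmx_derive (1%:M : 'M[R]_n) Q i 0 (cosh_derive A x).
apply: is_derive_eq.
  rewrite (_ : (fun x => _) = fun x => ((- 1%:M) *m (x *: sinhc_mx (x *: A)) *m b) i 0 +
     (1%:M *m cosh_mx (x *: A) *m Q) i 0).
    exact: (derD h1 h2).
  apply/funext => y; rewrite /L2g /gain_L2 -/Q -/b scalemxAl !mulNmx !mul1mx.
  by rewrite [LHS]mxE.
by rewrite !mulNmx !mul1mx /dL2 [RHS]mxE.
Qed.

Let L1_derive x i : is_derive x (1 : R) (fun x => dL2 x i 0) ((A *m L1 x) i 0).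
Proof.
have h1 := mulmx_derive (-1%:M : 'M[R]_n) b i 0 (cosh_derive A x).
have h2 := mulmx_derive A Q i 0 (sinh_derive A x).
apply: is_derive_eq.
  rewrite (_ : (fun x => _) = fun x => ((- 1%:M) *m cosh_mx (x *: A) *m b) i 0 +
     (A *m sinh_mx (x *: A) *m Q) i 0).
    exact: (derD h1 h2).
  apply/funext => y; rewrite !mulNmx mul1mx /dL2.
  by rewrite [LHS]mxE.
rewrite /L1 /gain_L1 -/Q -/b [in RHS]mulmxDr [in RHS]mulmxN !mulmxA !mulNmx mul1mx.
by rewrite [RHS]mxE.
Qed.

Let L2_cont i : continuous (fun x => L2g x i 0).
Proof. exact: (der_cont (dL2_derive ^~ i)). Qed.

Let dL2_cont i : continuous (fun x => dL2 x i 0).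
Proof. exact: (der_cont (L1_derive ^~ i)). Qed.

Let L1_cont i : continuous (fun x => L1 x i 0).
Proof.
rewrite (_ : (fun x => _) = fun x => \sum_k A i k * L2g x k 0); last first.
  by apply/funext => x; rewrite -mul_L2 mxE.
by move=> x; apply: cvg_big => [|k _]; [move=> ? ?; exact: add_continuous|
  apply: cvgM; [exact: cvg_cst|exact: L2_cont]].
Qed.

Lemma H1_ext_fun (w : H1 R) : exists2 W : R -> R, continuous W & forall x, 0 <= x <= 1 -> w x = W x.
Proof.
exists (mkH1_fun (w 1) (weak_deriv w)); first exact: mkH1_fun_cont.
by move=> x x01; rewrite H1E1.
Qed.

Let int_ext (f : R -> R) (v : L2 R) : ig 0 1 (fun x => f x * v x) = ig 0 1 (fun x => f x * ext v x).
Proof. by apply: ig_eq => x x01; rewrite extE. Qed.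

Lemma wave_functional_lin c z z' :
  wave_functional (c *: z + z') = c *: wave_functional z + wave_functional z'.
Proof.
have [l1 _] := H1_lin c z.1 z'.1.
have e1 i : ig 0 1 (fun x => L1 x i 0 * (c *: z + z').1 x) =
   c * ig 0 1 (fun x => L1 x i 0 * z.1 x) + ig 0 1 (fun x => L1 x i 0 * z'.1 x).
  have [W cW hW] := H1_ext_fun z.1; have [W' cW' hW'] := H1_ext_fun z'.1.
  have i1 : L1loc (fun x => L1 x i 0 * W x) by apply: L1locM_cont => //; exact: cont_L1loc.
  have i2 : L1loc (fun x => L1 x i 0 * W' x) by apply: L1locM_cont => //; exact: cont_L1loc.
  have -> : ig 0 1 (fun x => L1 x i 0 * z.1 x) = ig 0 1 (fun x => L1 x i 0 * W x).
    by apply: ig_eq => x x01; rewrite hW.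
  have -> : ig 0 1 (fun x => L1 x i 0 * z'.1 x) = ig 0 1 (fun x => L1 x i 0 * W' x).
    by apply: ig_eq => x x01; rewrite hW'.
  rewrite -igZ// -igD//; last exact: L1locZ.
  by apply: ig_eq => x x01; rewrite l1// hW// hW'//; ring.
have e2 i : ig 0 1 (fun x => L2g x i 0 * ((c *: z + z').2 : L2 R) x) =
   c * ig 0 1 (fun x => L2g x i 0 * z.2 x) + ig 0 1 (fun x => L2g x i 0 * z'.2 x).
  have hL (v : L2 R) : L1loc (fun x => L2g x i 0 * ext v x).
    by apply: L2loc_mul; [exact: cont_L2loc|exact: ext_L2loc].
  rewrite !int_ext -igZ// -igD//; last exact: L1locZ.
  apply: ig_ae => //; first by apply: L1locD => //; exact: L1locZ.
  have /ae01P := L2_linE c z.2 z'.2; apply: aeonS => x x01 h.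
  by rewrite !extE// [X in _ * X = _]h; ring.
apply/matrixP => i k; rewrite (ord1 k) [LHS]wave_functionalE e1 e2.
have hc (v v' : 'cV[R]_n) : (c *: v + v') i 0 = c * v i 0 + v' i 0 by rewrite !mxE.
have l0 := l1 0; have l1' := l1 1; rewrite lexx ler01 in l0 l1'.
by rewrite [RHS]hc [wave_functional z i 0]wave_functionalE [wave_functional z' i 0]wave_functionalE
  [X in X * L3 i 0 + _]l0// [X in _ + X * L4 i 0]l1' ?lexx//; ring.
Qed.

Lemma wave_normE z : exists2 q : R, wave_norm al z = Num.sqrt q &
  q = ig 0 1 (fun x => ext (weak_deriv z.1) x ^+ 2 + ext z.2 x ^+ 2) + al * z.1 1 ^+ 2.
Proof.
eexists; last by reflexivity.
rewrite /wave_norm; congr (Num.sqrt (_ + _)).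
by apply: ig_eq => x x01; rewrite !extE.
Qed.

Lemma wave_functional_bounded : exists C : R, 0 <= C /\ forall z i,
  wave_functional z i 0 ^+ 2 <= C * wave_norm al z ^+ 2.
Proof.
(* With [q] the squared norm, w(1)^2 is at most [q / al] and the integral of w'^2 at most [q], so
   [c0 * q] bounds w(x)^2 on the whole interval. *)
have [c0 c0E] : exists c0 : R, c0 = 2 / al + 2 by exists (2 / al + 2).
have c00 : 0 <= c0 by rewrite c0E addr_ge0// divr_ge0// ltW.
have bnd i : exists C : R, 0 <= C /\ forall z, wave_functional z i 0 ^+ 2 <= C * wave_norm al z ^+ 2.
  have [M1 [M10 hM1]] := cont_bounded 0 1 (L1_cont (i := i)).
  have [M2 [M20 hM2]] := cont_bounded 0 1 (L2_cont (i := i)).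
  exists (4 * (L3 i 0 ^+ 2 * c0 + L4 i 0 ^+ 2 * c0 + M1 ^+ 2 * c0 + M2 ^+ 2)); split.
    have s2 (y : R) : 0 <= y ^+ 2 * c0 by rewrite mulr_ge0 ?sqr_ge0.
    have := s2 (L3 i 0); have := s2 (L4 i 0); have := s2 M1; have := sqr_ge0 M2; lra.
  move=> z; have [q -> qE] := wave_normE z.
  have hp := ext_L2loc (weak_deriv z.1); have hv := ext_L2loc z.2.
  have p0 : 0 <= ig 0 1 (fun x => ext (weak_deriv z.1) x ^+ 2).
    by apply: ig_ge0 => x _; exact: sqr_ge0.
  have v0 : 0 <= ig 0 1 (fun x => ext z.2 x ^+ 2).
    by apply: ig_ge0 => x _; exact: sqr_ge0.
  rewrite igD in qE; [|exact: L2loc_sqr|exact: L2loc_sqr].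
  have t0 : 0 <= al * z.1 1 ^+ 2 by rewrite mulr_ge0 ?sqr_ge0// ltW.
  have q0 : 0 <= q by rewrite qE !addr_ge0.
  rewrite sqr_sqrtr//.
  have t1 : z.1 1 ^+ 2 <= q / al.
    by rewrite ler_pdivlMr// mulrC qE lerDr addr_ge0.
  have w2 x : 0 <= x <= 1 -> z.1 x ^+ 2 <= c0 * q.
    move=> x01; have /andP[x0 x1] := x01; rewrite H1E1//.
    have cs := ig_CS x1 hp.
    have hs := L2loc_sqr hp.
    have I0 : 0 <= ig x 1 (fun x => ext (weak_deriv z.1) x ^+ 2).
      by apply: ig_ge0 => y _; exact: sqr_ge0.
    have I1 : ig x 1 (fun x => ext (weak_deriv z.1) x ^+ 2) <= q.
      rewrite qE (@ig_split _ 0 x 1 _ hs)//.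
      have : 0 <= ig 0 x (fun x => ext (weak_deriv z.1) x ^+ 2).
        by apply: ig_ge0 => y _; exact: sqr_ge0.
      lra.
    have I2 : ig x 1 (ext (weak_deriv z.1)) ^+ 2 <= q.
      have x1' : 1 - x <= 1 by rewrite gerBl.
      by apply: le_trans cs _; apply: le_trans (ler_wpM2r I0 x1') _; rewrite mul1r.
    set I := ig x 1 (ext _) in I2 *; have := sqr_ge0 (z.1 1 + I).
    by rewrite c0E mulrDl; lra.
  have i01 : 0 <= (1 : R) <= 1 by rewrite ler01 lexx.
  have i00 : 0 <= (0 : R) <= 1 by rewrite ler01 lexx.
  have w20 := w2 _ i00; have w21 := w2 _ i01.
  have J1 : ig 0 1 (fun x => L1 x i 0 * z.1 x) ^+ 2 <= M1 ^+ 2 * c0 * q.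
    have [W cW hW] := H1_ext_fun z.1.
    have -> : ig 0 1 (fun x => L1 x i 0 * z.1 x) = ig 0 1 (fun x => L1 x i 0 * W x).
      by apply: ig_eq => x x01; rewrite hW.
    have cLW : continuous (fun x => L1 x i 0 * W x) by move=> x; apply: cvgM; [exact: L1_cont|exact: cW].
    apply: le_trans (ig_CS ler01 (cont_L2loc cLW)) _; rewrite subr0 mul1r.
    apply: (@le_trans _ _ (ig 0 1 (fun=> M1 ^+ 2 * c0 * q))); last by rewrite ig_cst// subr0 mulr1.
    apply: ig_le; [exact/L2loc_sqr/cont_L2loc|by apply: cont_L1loc => x; exact: cst_continuous|].
    move=> x x01; rewrite exprMn -mulrA; apply: ler_pM; rewrite ?sqr_ge0// -?hW//; last exact: w2.
    by rewrite -[leLHS]real_normK ?num_real// lerXn2r ?nnegrE ?(ltW M10)//; exact: hM1.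
  have J2 : ig 0 1 (fun x => L2g x i 0 * z.2 x) ^+ 2 <= M2 ^+ 2 * q.
    rewrite int_ext.
    have hLv : L2loc (fun x => L2g x i 0 * ext z.2 x).
      by under eq_fun do rewrite mulrC; exact: L2locM_cont.
    apply: le_trans (ig_CS ler01 hLv) _; rewrite subr0 mul1r.
    apply: (@le_trans _ _ (ig 0 1 (fun x => M2 ^+ 2 * ext z.2 x ^+ 2))).
      apply: ig_le; [exact: L2loc_sqr|by apply: L1locZ; exact: L2loc_sqr|].
      move=> x x01; rewrite exprMn ler_wpM2r ?sqr_ge0//.
      by rewrite -[leLHS]real_normK ?num_real// lerXn2r ?nnegrE ?(ltW M20)//; exact: hM2.
    rewrite igZ; last exact: L2loc_sqr.
    by rewrite ler_wpM2l ?sqr_ge0// qE; lra.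
  rewrite wave_functionalE.
  set j1 := ig 0 1 _ in J1 *; set j2 := ig 0 1 _ in J2 *.
  have k1 := ler_wpM2l (sqr_ge0 (L3 i 0)) w20.
  have k2 := ler_wpM2l (sqr_ge0 (L4 i 0)) w21.
  set x1 := z.1 0 * L3 i 0; set x2 := z.1 1 * L4 i 0.
  have E1 : L3 i 0 ^+ 2 * z.1 0 ^+ 2 = x1 ^+ 2 by rewrite /x1; ring.
  have E2 : L4 i 0 ^+ 2 * z.1 1 ^+ 2 = x2 ^+ 2 by rewrite /x2; ring.
  rewrite E1 in k1; rewrite E2 in k2.
  apply: (@le_trans _ _ (4 * (x1 ^+ 2 + x2 ^+ 2 + j1 ^+ 2 + j2 ^+ 2))); last lra.
  have := sqr_ge0 (x1 - x2); have := sqr_ge0 (x1 - j1); have := sqr_ge0 (x1 - j2).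
  have := sqr_ge0 (x2 - j1); have := sqr_ge0 (x2 - j2); have := sqr_ge0 (j1 - j2); lra.
have [C hC] := choice bnd.
have C0 i : 0 <= C i by have [] := hC i.
exists (\sum_i C i); split; first by apply: sumr_ge0.
move=> z i; have [_ /(_ z)] := hC i; move=> /le_trans; apply.
by rewrite ler_wpM2r ?sqr_ge0// (bigD1 i)//= lerDl sumr_ge0.
Qed.

Hypothesis unitM : gain_mx A al be \in unitmx.

Let QE : gain_mx A al be *m Q = A *m B4 + B3 + (cosh_mx A + (al%:M + be *: A) *m sinhc_mx A) *m b.
Proof. by rewrite /Q /gain_Q -/(gain_mx A al be) mulKVmx. Qed.

Let L2_1 : L2g 1 = - (sinhc_mx A *m b) + cosh_mx A *m Q.
Proof. by rewrite /L2g /gain_L2 !scale1r. Qed.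

Let dL2_1 : dL2 1 = - (cosh_mx A *m b) + A *m sinh_mx A *m Q.
Proof. by rewrite /dL2 scale1r. Qed.

Let dL2_0 : dL2 0 = - b.
Proof. by rewrite /dL2 cosh0 sinh0 mul1mx mulmx0 mul0mx addr0. Qed.

Let L4E : L4 = be *: L2g 1 - B4.
Proof. by rewrite L2_1 scalerDr scalerN. Qed.

(** The equation that defines [Q], rewritten with [L2g 1] and [dL2 1]. It makes the coefficient of
    w(1) vanish in [wave_functional_graph]. *)
Let boundary : B3 - al *: L2g 1 - dL2 1 - A *m L4 = 0.
Proof.
have g (X : 'M[R]_n) (v : 'cV[R]_n) : ((al%:M + be *: A) *m X) *m v =
    al *: (X *m v) + be *: (A *m (X *m v)).
  by rewrite -mulmxA mulmxDl mul_scalar_mx -scalemxAl.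
have e1 (v : 'cV[R]_n) : gain_mx A al be *m v = A *m sinh_mx A *m v +
    (al *: (cosh_mx A *m v) + be *: (A *m (cosh_mx A *m v))).
  by rewrite /gain_mx mulmxDl g.
have e2 (v : 'cV[R]_n) : (cosh_mx A + (al%:M + be *: A) *m sinhc_mx A) *m v =
    cosh_mx A *m v + (al *: (sinhc_mx A *m v) + be *: (A *m (sinhc_mx A *m v))).
  by rewrite mulmxDl g.
have e3 : A *m L2g 1 = - (A *m (sinhc_mx A *m b)) + A *m (cosh_mx A *m Q).
  by rewrite L2_1 [LHS]mulmxDr mulmxN.
have := QE; rewrite e1 e2 L4E mulmxBr -scalemxAr e3 L2_1 dL2_1.
move: (A *m sinh_mx A *m Q) (A *m (cosh_mx A *m Q)) (cosh_mx A *m Q) (A *m B4)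
  (A *m (sinhc_mx A *m b)) (sinhc_mx A *m b) (cosh_mx A *m b) => x1 x2 x3 x4 x5 x6 x7 h.
apply/matrixP => i k; have := congr1 (fun v : 'cV[R]_n => v i k) h.
by rewrite !mxE; lra.
Qed.

(* Two integrations by parts, using gain_L2'' = A^2 gain_L2: this says that
   X + wave_functional (w, w_t) solves Y' = (A + gain_L2 1 K^T) Y. *)
Lemma wave_functional_graph r z y : wave_graph al be r z y ->
  z.1 0 *: B1 + y.1 0 *: B2 + z.1 1 *: B3 + y.1 1 *: B4 + wave_functional y =
  A *m wave_functional z + r *: L2g 1.
Proof.
move=> [yz [p [pz yp p0 p1]]].
have i01 : 0 <= (1 : R) <= 1 by rewrite ler01 lexx.
have ext1 (w : H1 R) : exists2 W : R -> R, continuous W & forall x, 0 <= x <= 1 -> w x = W x.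
  exact: H1_ext_fun.
(* The integral of L2 w_xx. In the first integration by parts the end term at 0 drops because
   [p 0 = 0]; in the second, the derivative of [dL2] is [A *m L1]. *)
have iL2 i : ig 0 1 (fun x => L2g x i 0 * y.2 x) =
   L2g 1 i 0 * p 1 - dL2 1 i 0 * z.1 1 + dL2 0 i 0 * z.1 0 +
   ig 0 1 (fun x => (A *m L1 x) i 0 * z.1 x).
  have hL2' := cont_L1loc (dL2_cont (i := i)).
  have cAL : continuous (fun x => (A *m L1 x) i 0).
    rewrite (_ : (fun x => _) = fun x => \sum_k A i k * L1 x k 0); last first.
      by apply/funext => x; rewrite mxE.
    by move=> x; apply: cvg_big => [|k _]; [move=> ? ?; exact: add_continuous|
      apply: cvgM; [exact: cvg_cst|exact: L1_cont]].
  have hp := L2loc_L1 (ext_L2loc (weak_deriv p)).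
  have hz := L2loc_L1 (ext_L2loc (weak_deriv z.1)).
  have E1 x : 0 <= x <= 1 -> L2g x i 0 = L2g 0 i 0 + ig 0 x (fun x => dL2 x i 0).
    move=> /andP[x0 _]; exact: (FTC2 (dL2_derive ^~ i) (dL2_cont (i := i)) x0).
  have E2 x : 0 <= x <= 1 -> dL2 x i 0 = dL2 0 i 0 + ig 0 x (fun x => (A *m L1 x) i 0).
    move=> /andP[x0 _]; exact: (FTC2 (L1_derive ^~ i) cAL x0).
  have P1 := ig_parts ler01 hL2' hp E1 (H1E p).
  have P2 := ig_parts ler01 (cont_L1loc cAL) hz E2 (H1E z.1).
  have [Wp cWp hWp] := ext1 p; have [Wz cWz hWz] := ext1 z.1.
  have S1 : ig 0 1 (fun x => dL2 x i 0 * p x + L2g x i 0 * ext (weak_deriv p) x) =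
     ig 0 1 (fun x => dL2 x i 0 * ext (weak_deriv z.1) x) + ig 0 1 (fun x => L2g x i 0 * y.2 x).
    have -> : ig 0 1 (fun x => dL2 x i 0 * p x + L2g x i 0 * ext (weak_deriv p) x) =
       ig 0 1 (fun x => dL2 x i 0 * Wp x + L2g x i 0 * ext (weak_deriv p) x).
      by apply: ig_eq => x x01; rewrite hWp.
    rewrite int_ext -igD; first last.
    - by apply: L2loc_mul; [exact: cont_L2loc|exact: ext_L2loc].
    - by apply: L2loc_mul; [exact: cont_L2loc|exact: ext_L2loc].
    apply: ig_ae.
    - apply: L1locD; first exact: (L1locM_cont hL2' cWp).
      by apply: L2loc_mul; [exact: cont_L2loc|exact: ext_L2loc].
    - by apply: L1locD; apply: L2loc_mul; [exact: cont_L2loc|exact: ext_L2loc|exact: cont_L2loc|exact: ext_L2loc].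
    - have [/ae01P h _] := H1_ac p; apply: aeonS h => x x01.
      by rewrite (extE (weak_deriv p) x01) (extE (weak_deriv z.1) x01) (extE y.2 x01)
        -(hWp x x01) -pz -yp => ->.
  have S2 : ig 0 1 (fun x => (A *m L1 x) i 0 * z.1 x + dL2 x i 0 * ext (weak_deriv z.1) x) =
     ig 0 1 (fun x => (A *m L1 x) i 0 * z.1 x) + ig 0 1 (fun x => dL2 x i 0 * ext (weak_deriv z.1) x).
    have -> : ig 0 1 (fun x => (A *m L1 x) i 0 * z.1 x) = ig 0 1 (fun x => (A *m L1 x) i 0 * Wz x).
      by apply: ig_eq => x x01; rewrite hWz.
    rewrite -igD; first by apply: ig_eq => x x01; rewrite hWz.
      exact: (L1locM_cont (cont_L1loc cAL) cWz).
    by apply: L2loc_mul; [exact: cont_L2loc|exact: ext_L2loc].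
  have arith (l1 l0 d1 d0 q1 q0 z1 z0 I1 I2 I3 S T : R) : q0 = 0 -> l1 * q1 = l0 * q0 + S ->
      S = I2 + I1 -> d1 * z1 = d0 * z0 + T -> T = I3 + I2 ->
      I1 = l1 * q1 - d1 * z1 + d0 * z0 + I3.
    move=> -> h1 h2 h3 h4; rewrite mulr0 add0r in h1.
    have hT : T = d1 * z1 - d0 * z0 by rewrite h3 [RHS]addrC addKr.
    have hI : I2 = T - I3 by rewrite h4 [RHS]addrC addKr.
    have -> : I1 = S - I2 by rewrite h2 [RHS]addrC addKr.
    by rewrite hI hT -h1; ring.
  exact: (arith _ _ _ _ _ _ _ _ _ _ _ _ _ p0 P1 S1 P2 S2).
(* Here [y.1] equals [z.2] almost everywhere, and [mul_L2] extracts [A]. *)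
have iL1 i : ig 0 1 (fun x => L1 x i 0 * y.1 x) = (A *m \col_k ig 0 1 (fun x => L2g x k 0 * z.2 x)) i 0.
  have -> : ig 0 1 (fun x => L1 x i 0 * y.1 x) = ig 0 1 (fun x => \sum_k A i k * (L2g x k 0 * ext z.2 x)).
    have [W cW hW] := ext1 y.1.
    have hs k : L1loc (fun x => A i k * (L2g x k 0 * ext z.2 x)).
      by apply: L1locZ; apply: L2loc_mul; [exact: cont_L2loc|exact: ext_L2loc].
    transitivity (ig 0 1 (fun x => L1 x i 0 * W x)).
      by apply: ig_eq => x x01; rewrite hW.
    apply: ig_ae.
    - exact: (L1locM_cont (cont_L1loc (L1_cont (i := i))) cW).
    - exact: L1loc_sum.
    - have [/ae01P h _] := H1_ac y.1; apply: aeonS h => x x01.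
      rewrite yz (extE z.2 x01) (hW x x01) => ->; rewrite -mul_L2 mxE mulr_suml.
      by apply: eq_bigr => k _; rewrite mulrA.
  have hL k : L1loc (fun x => L2g x k 0 * ext z.2 x).
    by apply: L2loc_mul; [exact: cont_L2loc|exact: ext_L2loc].
  rewrite ig_sum; last by move=> k; exact: L1locZ.
  rewrite mxE; apply: eq_bigr => k _; rewrite (igZ _ _ _ (hL k)); congr (_ * _).
  by rewrite mxE int_ext.
have iAL i : (A *m \col_k ig 0 1 (fun x => L1 x k 0 * z.1 x)) i 0 = ig 0 1 (fun x => (A *m L1 x) i 0 * z.1 x).
  have [W cW hW] := ext1 z.1.
  have hL k : L1loc (fun x => L1 x k 0 * W x).
    exact: (L1locM_cont (cont_L1loc (L1_cont (i := k))) cW).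
  have -> : ig 0 1 (fun x => (A *m L1 x) i 0 * z.1 x) =
      ig 0 1 (fun x => \sum_k A i k * (L1 x k 0 * W x)).
    apply: ig_eq => x x01; rewrite (hW x x01) mxE mulr_suml.
    by apply: eq_bigr => k _; rewrite mulrA.
  rewrite ig_sum; last by move=> k; exact: L1locZ.
  rewrite mxE; apply: eq_bigr => k _; rewrite (igZ _ _ _ (hL k)); congr (_ * _).
  by rewrite mxE; apply: ig_eq => x x01; rewrite (hW x x01).
have hA (l3 l4 t1 t2 : 'cV[R]_n) (c d : R) : A *m (c *: l3 + d *: l4 + t1 + t2) =
    c *: (A *m l3) + d *: (A *m l4) + A *m t1 + A *m t2.
  by rewrite !mulmxDr -!scalemxAr.
apply/matrixP => i k; rewrite (ord1 k) {k} [in RHS]/wave_functional hA.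
(* The integrals now agree, and four end terms remain: w(1) is settled by [bd], w_t(1) by [e4], w(0)
   by [e0] and [e3], w_t(0) by [e3']. *)
have bd : B3 i 0 - al * L2g 1 i 0 - dL2 1 i 0 - (A *m L4) i 0 = 0.
  have := congr1 (fun v : 'cV[R]_n => v i 0) boundary.
  by move: (L2g 1) (dL2 1) (A *m L4) => v1 v2 v3; rewrite !mxE.
have e4 : L4 i 0 = be * L2g 1 i 0 - B4 i 0.
  by rewrite L4E; move: (L2g 1) => v1; rewrite !mxE.
have e0 : dL2 0 i 0 = - ((A *m B2) i 0 + B1 i 0).
  by rewrite dL2_0 /b; move: (A *m B2) => v1; rewrite !mxE.
have e3 : (A *m L3) i 0 = - (A *m B2) i 0.
  by rewrite /L3 /gain_L3 mulmxN; move: (A *m B2) => v1; rewrite !mxE.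
have e3' : L3 i 0 = - B2 i 0 by rewrite /L3 /gain_L3 mxE.
have fin (a3 a4 t1 t2 l2 : 'cV[R]_n) (s : R) :
    z.1 0 * B1 i 0 + y.1 0 * B2 i 0 + z.1 1 * B3 i 0 + y.1 1 * B4 i 0 + s =
    z.1 0 * a3 i 0 + z.1 1 * a4 i 0 + t1 i 0 + t2 i 0 + r * l2 i 0 ->
    wave_functional y i 0 = s ->
    (z.1 0 *: B1 + y.1 0 *: B2 + z.1 1 *: B3 + y.1 1 *: B4 + wave_functional y) i 0 =
    (z.1 0 *: a3 + z.1 1 *: a4 + t1 + t2 + r *: l2) i 0.
  move=> h e; rewrite -e in h; move: (wave_functional y) h => wy h.
  by rewrite !mxE.
apply: fin (wave_functionalE y i).
rewrite iL1 iL2 iAL e3 e3' e4 e0 p1.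
have {}bd : (A *m L4) i 0 = B3 i 0 - al * L2g 1 i 0 - dL2 1 i 0 by rewrite -[RHS]subr0 -bd opprB addrCA subrr addr0.
rewrite bd; ring.
Qed.

End Functional.

(** * The closed-loop semigroup *)

Section Flow.
Context (R : realType) (n : nat) (F : 'M[R]_n).
Implicit Types (v : 'cV[R]_n) (t : R).

Lemma colB v v' i : (v - v') i 0 = v i 0 - v' i 0.
Proof. by rewrite !mxE. Qed.

Definition flow v t : 'cV[R]_n := exp_mx (t *: F) *m v.

Lemma mul_flow_derive m (B : 'M[R]_(m, n)) v t i :
  is_derive t (1 : R) (fun t => (B *m flow v t) i 0) ((B *m (F *m flow v t)) i 0).
Proof.
have h := mulmx_derive B v i 0 (exp_derive F t).
rewrite /flow !mulmxA; rewrite mulmxA in h.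
by rewrite (_ : (fun t => _) = fun x => (B *m exp_mx (x *: F) *m v) i 0)//;
  apply/funext => s; rewrite mulmxA.
Qed.

Lemma flow_derive v t i :
  is_derive t (1 : R) (fun t => flow v t i 0) ((F *m flow v t) i 0).
Proof.
have := mul_flow_derive 1%:M v t i; rewrite mul1mx.
by under eq_fun do rewrite mul1mx.
Qed.

Lemma flow0 v : flow v 0 = v.
Proof. by rewrite /flow exp0 mul1mx. Qed.

Lemma flow_lin c v v' t : flow (c *: v + v') t = c *: flow v t + flow v' t.
Proof. by rewrite /flow mulmxDr scalemxAr. Qed.

Lemma flow_comm v t : F *m flow v t = flow (F *m v) t.
Proof. by rewrite /flow mulmxA exp_comm mulmxA. Qed.

Definition ssq v : R := \sum_i v i 0 ^+ 2.

Lemma ssq_ge0 v : 0 <= ssq v.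
Proof. by apply: sumr_ge0 => i _; exact: sqr_ge0. Qed.

Lemma ssq_ge v i : v i 0 ^+ 2 <= ssq v.
Proof. by rewrite /ssq (bigD1 i)//= lerDl sumr_ge0// => k _; exact: sqr_ge0. Qed.

Hypothesis hF : hurwitz F.

Lemma ode_decay : exists M w : R, [/\ 0 < M, 0 < w &
  forall Y : R -> 'cV[R]_n, (forall t i, is_derive t (1 : R) (fun t => Y t i 0) ((F *m Y t) i 0)) ->
    forall t, 0 <= t -> ssq (Y t) <= M * expR (- w * t) * ssq (Y 0)].
Proof.
(* The decay estimate is available for nonempty matrices; in dimension 0 all sums are empty. *)
rewrite /ssq; case: n F hF => [|m] G hG; last exact: (hurwitz_decay hG).
by exists 1, 1; split => // Y _ t _; rewrite !big_ord0 mulr0.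
Qed.

(** Uniqueness is read off from the decay estimate: the difference of the two sides solves the
    linear equation and starts at 0, so it is bounded by 0. *)
Lemma flow_add v s t : 0 <= s -> flow v (s + t) = flow (flow v t) s.
Proof.
move=> s0; pose Z s := flow v (s + t) - flow (flow v t) s.
have dZ r i : is_derive r (1 : R) (fun r => Z r i 0) ((F *m Z r) i 0).
  have d1 : is_derive r (1 : R) (fun r : R => r + t) 1.
    by apply: is_derive_eq (derD (is_derive_id r (1 : R)) (is_derive_cst t r (1 : R))) _; rewrite addr0.
  have d2 := @is_derive1_comp _ (fun y => flow v y i 0) (fun r => r + t) r _ _ (flow_derive v (r + t) i) d1; rewrite mulr1 in d2.
  have d3 := derZ (-1) (flow_derive (flow v t) r i).
  have := derD d2 d3; rewrite /Z mulmxBr.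
  rewrite (_ : (fun y => _) = fun r => (flow v (r + t) - flow (flow v t) r) i 0); last first.
    by apply/funext => y; rewrite /= mulN1r colB.
  by move=> h; apply: is_derive_eq h _; rewrite mulN1r colB.
have [M [w [_ _ /(_ Z dZ s s0)]]] := ode_decay.
have -> : Z 0 = 0 by rewrite /Z add0r flow0 subrr.
rewrite {2}/ssq big1 ?mulr0; last by move=> i _; rewrite mxE expr0n.
move=> h; apply/matrixP => i k; rewrite (ord1 k).
have := le_trans (ssq_ge (Z s) i) h.
rewrite real_exprn_even_le0 ?num_real//= => /eqP.
by rewrite /Z colB => /eqP; rewrite subr_eq0 => /eqP.
Qed.

End Flow.

(** * The driven wave equation as an evolution of wave states *)

Section WaveEvolution.
Context (R : realType) (al be : R).
Hypotheses (al0 : 0 < al) (be0 : 0 < be).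
Local Notation wave_state := (H1 R * L2 R)%type.
Implicit Types (W z y : wave_state) (u psi a : R -> R).

Lemma wave_norm_ge0 z : 0 <= wave_norm al z.
Proof. exact: sqrtr_ge0. Qed.

Lemma wave_norm_dec (phi : R -> R) (a : R) : L2loc phi ->
  wave_norm al (dec phi a) ^+ 2 = 2^-1 * ig (-1) 1 (fun x => phi x ^+ 2) + al * a ^+ 2.
Proof.
move=> hp; rewrite wave_norm_sqr// dec1 sqr_sqrtr; last first.
  apply: addr_ge0; apply: mulr_ge0; rewrite ?sqr_ge0 ?(ltW al0)//.
  by apply: ig_ge0 => x _; exact: sqr_ge0.
congr (_ * _ + _); apply: ig_ae; [exact/L2loc_sqr/enc_L2|exact: L2loc_sqr|].
by apply: aeonS (enc_dec a hp) => x _ ->.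
Qed.

Definition evolves u W psi a :=
  [/\ delay_sol al be u psi a, a 0 = W.1 1 & aeon (-1) 1 (fun x => psi x = enc W x)].

(** The state at time [t] is seen through the window of [psi] between [t - 1] and [t + 1]. *)
Definition snapshot psi a t : wave_state := dec (fun x => psi (x + t)) (a t).

Lemma evolves_exists u W : continuous u ->
  exists p : (R -> R) * (R -> R), evolves u W p.1 p.2.
Proof.
move=> cu; have [psi [a [h1 h2 h3]]] := delay_existence al be0 (W.1 1) (enc_L2 W) cu.
by exists (psi, a).
Qed.

Lemma evolves_unique u W psi a psi' a' t : continuous u -> 0 <= t ->
  evolves u W psi a -> evolves u W psi' a' -> snapshot psi a t = snapshot psi' a' t.
Proof.
move=> cu t0 [h1 h2 h3] [h1' h2' h3'].
have a00 : a 0 = a' 0 by rewrite h2 h2'.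
have pp : aeon (-1) 1 (fun x => psi x = psi' x) by apply: aeon2 h3 h3' => x _ -> ->.
have [e1 e2] := delay_unique al0 be0 cu h1 h1' a00 pp t0.
have [hp _ _ _] := h1; have [hp' _ _ _] := h1'.
rewrite /snapshot e1; apply: dec_ext; [exact: L2loc_shift|exact: L2loc_shift|].
by apply: (@aeon_shift _ (-1) 1 t (fun x => psi x = psi' x)); rewrite [-1 + t]addrC [1 + t]addrC.
Qed.

Lemma snapshot0 u W psi a : evolves u W psi a -> snapshot psi a 0 = W.
Proof.
move=> [[hp _ _ _] h2 h3]; rewrite /snapshot h2 -[RHS]dec_enc; apply: dec_ext.
- exact: L2loc_shift.
- exact: enc_L2.
- by apply: aeonS h3 => x _; rewrite addr0.
Qed.

Lemma evolves_shift u W psi a t : continuous u -> 0 <= t -> evolves u W psi a ->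
  evolves (fun s => u (s + t)) (snapshot psi a t) (fun s => psi (s + t)) (fun s => a (s + t)).
Proof.
move=> cu t0 [h1 h2 h3]; have [hp _ _ _] := h1; split.
- exact: delay_shift.
- by rewrite add0r /snapshot dec1.
- by apply: aeonS (enc_dec (a t) (L2loc_shift t hp)) => x _ ->.
Qed.

Lemma evolves_eq u u' W psi a : (forall t, 0 <= t -> u t = u' t) ->
  evolves u W psi a -> evolves u' W psi a.
Proof.
move=> uE [[h1 h2 h3 h4] h5 h6]; split => //; split=> // t t0; last by rewrite h4// uE.
by rewrite h3//; congr (_ + _); apply: ig_eq => s /andP[s0 _]; rewrite /slope uE.
Qed.

Lemma evolves_lin c u W psi a u' W' psi' a' : continuous u -> continuous u' ->
  evolves u W psi a -> evolves u' W' psi' a' ->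
  evolves (fun s => c * u s + u' s) (c *: W + W') (fun s => c * psi s + psi' s)
    (fun s => c * a s + a' s).
Proof.
move=> cu cu' [h1 h2 h3] [h1' h2' h3']; split.
- exact: delay_lin.
- by rewrite h2 h2' tr1_lin.
- have h := enc_lin c W W'.
  have h' : aeon (-1) 1 (fun x => psi x = enc W x /\ psi' x = enc W' x) by apply: aeon2 h3 h3'.
  by apply: aeon2 h h' => x _ -> [-> ->].
Qed.

Lemma snapshot_lin c psi a psi' a' t : L2loc psi -> L2loc psi' ->
  snapshot (fun s => c * psi s + psi' s) (fun s => c * a s + a' s) t =
  c *: snapshot psi a t + snapshot psi' a' t.
Proof. by move=> hp hp'; rewrite /snapshot -dec_lin//; exact: L2loc_shift. Qed.

Lemma snapshot_energy psi a t : L2loc psi ->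
  wave_norm al (snapshot psi a t) ^+ 2 = 2 * energy al psi a t.
Proof.
move=> hp; rewrite wave_norm_dec; last exact: L2loc_shift.
rewrite (@ig_shift _ _ _ (fun x => psi x ^+ 2)); last exact: L2loc_sqr.
by rewrite /energy [-1 + t]addrC [1 + t]addrC; field.
Qed.

Lemma dec_eq (phi phi' : R -> R) (b b' : R) : (forall x, phi x = phi' x) -> b = b' ->
  dec phi b = dec phi' b'.
Proof. by move=> /funext -> ->. Qed.

Lemma snapshot_diff psi a t : L2loc psi ->
  wave_norm al (snapshot psi a t - snapshot psi a 0) ^+ 2 =
  2^-1 * ig (-1) 1 (fun x => (psi (x + t) - psi x) ^+ 2) + al * (a t - a 0) ^+ 2.
Proof.
move=> hp; have h0 := L2loc_shift 0 hp; have ht := L2loc_shift t hp.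
have -> : snapshot psi a t - snapshot psi a 0 =
    dec (fun x => -1 * psi (x + 0) + psi (x + t)) (-1 * a 0 + a t).
  by rewrite dec_lin// scaleN1r addrC.
rewrite wave_norm_dec//; last by apply: L2locD => //; exact: L2locZ.
congr (_ * _ + _ * _ ^+ 2); last by ring.
by apply: ig_eq => x _; rewrite addr0; ring.
Qed.

Lemma snapshot_quotient psi a psi' a' t : L2loc psi -> L2loc psi' ->
  wave_norm al (t^-1 *: (snapshot psi a t - snapshot psi a 0) - snapshot psi' a' 0) ^+ 2 =
  2^-1 * ig (-1) 1 (fun x => (t^-1 * (psi (x + t) - psi x) - psi' x) ^+ 2) +
  al * (t^-1 * (a t - a 0) - a' 0) ^+ 2.
Proof.
move=> hp hp'.
have h0 := L2loc_shift 0 hp; have h0' := L2loc_shift 0 hp'; have ht := L2loc_shift t hp.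
have e1 : snapshot psi a t - snapshot psi a 0 =
    dec (fun x => -1 * psi (x + 0) + psi (x + t)) (-1 * a 0 + a t).
  by rewrite dec_lin// scaleN1r addrC.
have hd : L2loc (fun x => -1 * psi (x + 0) + psi (x + t)) by apply: L2locD => //; exact: L2locZ.
have e2 : t^-1 *: (snapshot psi a t - snapshot psi a 0) - snapshot psi' a' 0 =
  dec (fun x => -1 * psi' (x + 0) + t^-1 * (-1 * psi (x + 0) + psi (x + t)))
      (-1 * a' 0 + t^-1 * (-1 * a 0 + a t)).
  rewrite e1 [RHS]dec_lin//; last exact: L2locZ.
  rewrite scaleN1r addrC; congr (_ + _).
  have hz : L2loc (fun=> 0 : R) by apply: cont_L2loc => x; exact: cst_continuous.
  have d0 : dec (fun=> 0) 0 = 0 :> wave_state.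
    have h := dec_lin (-1) 0 0 hz hz; rewrite scaleN1r addNr in h.
    by rewrite -[RHS]h; apply: dec_eq => [x|]; rewrite mulr0 addr0.
  have h := dec_lin t^-1 (-1 * a 0 + a t) 0 hd hz.
  rewrite d0 [RHS]addr0 in h; rewrite -[LHS]h.
  by apply: dec_eq => [x|]; rewrite addr0.
rewrite e2 wave_norm_dec; last first.
  by apply: L2locD; [exact: L2locZ|exact: L2locZ].
congr (_ * _ + _ * _ ^+ 2); last by ring.
by apply: ig_eq => x _; rewrite addr0; ring.
Qed.

Lemma wave_norm_cvg0 (g : R -> wave_state) (p : R -> R) (q : R -> R) :
  (forall t, wave_norm al (g t) ^+ 2 = 2^-1 * p t + al * q t ^+ 2) -> (forall t, 0 <= p t) ->
  (wave_norm al (g t) @[t --> (0:R)^'+] --> (0:R)) <->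
  (p t @[t --> (0:R)^'+] --> (0:R) /\ q t @[t --> (0:R)^'+] --> (0:R)).
Proof.
move=> gE p0; split=> [h|[hp hq]].
  have h2 : 2^-1 * p t + al * q t ^+ 2 @[t --> (0:R)^'+] --> (0:R).
    have e : (fun t => 2^-1 * p t + al * q t ^+ 2) = fun t => wave_norm al (g t) * wave_norm al (g t).
      by apply/funext => t; rewrite -gE expr2.
    by rewrite e -[X in _ --> X](mulr0 (0:R)); exact: cvgM.
  have q20 t : 0 <= al * q t ^+ 2 by rewrite mulr_ge0 ?sqr_ge0// ltW.
  split.
    have : 2 * (2^-1 * p t + al * q t ^+ 2) @[t --> (0:R)^'+] --> (2 * 0 : R).
      by apply: cvgM => //; exact: cvg_cst.
    rewrite mulr0; apply: (@squeeze_cvgr _ _ _ _ (fun=> 0)); last exact: cvg_cst.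
    by apply: nearW => t; rewrite p0/=; have := q20 t; lra.
  have h3 : Num.sqrt (al^-1 * (2^-1 * p t + al * q t ^+ 2)) @[t --> (0:R)^'+] --> (0:R).
    have h4 : al^-1 * (2^-1 * p t + al * q t ^+ 2) @[t --> (0:R)^'+] --> (al^-1 * 0 : R).
      by apply: cvgM => //; exact: cvg_cst.
    by have := continuous_cvg _ (@sqrt_continuous R _) h4; rewrite mulr0 sqrtr0; apply.
  apply/norm_cvg0P; apply: (@squeeze_cvgr _ _ _ _ (fun=> 0) _ _ _ _ _ h3); last exact: cvg_cst.
  apply: nearW => t; rewrite normr_ge0/= -sqrtr_sqr ler_wsqrtr//.
  rewrite mulrDr mulKf ?gt_eqF// lerDr !mulr_ge0 ?invr_ge0// ltW//.
have h : 2^-1 * p t + al * q t ^+ 2 @[t --> (0:R)^'+] --> (2^-1 * 0 + al * (0 * 0) : R).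
  apply: cvgD; apply: cvgM => //; try exact: cvg_cst.
  by rewrite (_ : (fun t => q t ^+ 2) = fun t => q t * q t)//; exact: cvgM.
have := continuous_cvg _ (@sqrt_continuous R _) h.
rewrite !mulr0 addr0 sqrtr0 => h3.
rewrite (_ : (fun t => _) = fun t => Num.sqrt (2^-1 * p t + al * q t ^+ 2)); first exact: h3.
by apply/funext => t; rewrite -gE sqrtr_sqr ger0_norm// wave_norm_ge0.
Qed.

(** One direction is [delay_deriv]. For the other, the solution started from [y] with input [u'] is
    integrated in time; the result starts from [W] with input [u], so by uniqueness it is the given
    solution, whose quotients then converge. *)
Lemma evolves_graph u u' W psi a y : continuous u -> continuous u' ->
  (forall t, 0 <= t -> u t = u 0 + ig 0 t u') -> evolves u W psi a ->
  (wave_norm al (t^-1 *: (snapshot psi a t - W) - y) @[t --> (0:R)^'+] --> (0:R)) <->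
  wave_graph al be (u 0) W y.
Proof.
move=> cu cu' uE hW; have W0 := snapshot0 hW.
(* This solution extends the encoding of [y] beyond 1; it is the candidate for the time
   derivative. *)
have [[psi' a'] hy] := evolves_exists y cu'; rewrite /= in hy.
have y0 := snapshot0 hy.
have [[hp' ca' _ _] a'0 p'y] := hy; have hy1 := L2loc_L1 hp'.
have ey1 := L2loc_L1 (enc_L2 y).
have igy x : x <= 1 -> ig (-1) x psi' = ig (-1) x (enc y).
  by move=> x1; apply: ig_ae => //; apply: aeon_sub p'y.
have pos (f : R -> R -> R) t : 0 <= ig (-1) 1 (fun x => f t x ^+ 2).
  by apply: ig_ge0 => x _; exact: sqr_ge0.
split=> [|hg].
  have [hs a0 pW] := hW; have [hp _ _ _] := hs.
  have E t := snapshot_quotient a a' t hp hp'.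
  rewrite -{1}W0 -{1}y0.
  move=> /(wave_norm_cvg0 E (pos _))[c1 c2].
  have c3 : t^-1 * (a t - a 0) @[t --> (0:R)^'+] --> y.1 1.
    have -> : (fun t => t^-1 * (a t - a 0)) = fun t => (t^-1 * (a t - a 0) - a' 0) + a' 0.
      by apply/funext => t; rewrite subrK.
    by rewrite -a'0 -[X in _ --> X]add0r; apply: cvgD => //; exact: cvg_cst.
  have [ka [k1 k2 k3]] := delay_deriv cu hs hp' c1 c3.
  apply/wave_graphP => //; exists ka; rewrite -a0; split => //.
  - by apply: aeon2 pW k1 => x /andP[_ x1] <- ->; rewrite igy.
  - by rewrite -igy.
have /(wave_graphP _ be0)[ka [k1 k2 k3]] := hg.
pose P x := ka + ig (-1) x psi'; pose Aa t := W.1 1 + ig 0 t a'.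
have hP : evolves u W P Aa.
  split.
  - have [h _ _] := hy.
    have e1 : a' 0 = (1 + be)^-1 * (ka - al * W.1 1 + u 0) by rewrite a'0 k2.
    have e2 : ka + ig (-1) 1 psi' =
        (1 - be) / (1 + be) * ka + 2 / (1 + be) * (u 0 - al * W.1 1) by rewrite igy.
    exact: (delay_primitive cu cu' uE h e1 e2).
  - by rewrite /Aa igxx addr0.
  - by apply: aeonS k1 => x /andP[_ x1] ->; rewrite /P igy.
have [[hPp _ _ _] _ _] := hP.
have E t := snapshot_quotient Aa a' t hPp hp'.
have [_ hc] := wave_norm_cvg0 E (pos _).
have P0 := snapshot0 hP.
rewrite P0 y0 in hc.
apply: cvg_trans; last apply: hc.
  apply: near_eq_cvg; near=> t; have t0 : 0 < t by near: t; exact: nbhs_right_gt.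
  by rewrite (evolves_unique cu (ltW t0) hW hP).
split.
  exact: (primitive_deriv hp' (fun x => erefl (P x))).
have := average_cvg ca' => h.
rewrite (_ : (fun t => _) = fun t => t^-1 * ig 0 t a' - a' 0); last first.
  by apply/funext => t; rewrite /Aa igxx addr0 addrAC subrr add0r.
rewrite -[X in _ --> X](subrr (a' 0)); apply: cvgB; [exact: h|exact: cvg_cst].
Unshelve. all: by end_near. Qed.

End WaveEvolution.

(** * The closed-loop flow, its decay and its generator *)

Section ClosedLoop.
Context (R : realType) (n : nat) (A : 'M[R]_n) (B1 B2 B3 B4 K : 'cV[R]_n) (al be : R).
Local Notation wave_state := (H1 R * L2 R)%type.
Local Notation state := ('cV[R]_n * wave_state)%type.
Local Notation L := (gain_L2 al be A B1 B2 B3 B4 1).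
Local Notation F := (A + L *m K^T).
Local Notation Lam := (wave_functional A B1 B2 B3 B4 al be).
Implicit Types (z y : state) (v : 'cV[R]_n) (W : wave_state).
Hypotheses (al0 : 0 < al) (be0 : 0 < be) (hF : hurwitz F).

Definition reduced z : 'cV[R]_n := z.1 + Lam z.2.

(** As the reduced state evolves autonomously, the feedback along a trajectory is a function of time
    known in advance, and the wave can be solved in open loop. *)
Definition input v t : R := (K^T *m flow F v t) 0 0.

Lemma input_derive v t : is_derive t (1 : R) (input v) (input (F *m v) t).
Proof. by rewrite /input -flow_comm; exact: mul_flow_derive. Qed.

Lemma input_cont v : continuous (input v).
Proof. exact: (der_cont (input_derive v)). Qed.

Lemma input_primitive v t : 0 <= t -> input v t = input v 0 + ig 0 t (input (F *m v)).
Proof. by apply: FTC2; [exact: input_derive|exact: input_cont]. Qed.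

Lemma input_lin c v v' t : input (c *: v + v') t = c * input v t + input v' t.
Proof. by rewrite /input flow_lin mulmxDr -scalemxAr !mxE. Qed.

Lemma reduced_lin c z z' : reduced (c *: z + z') = c *: reduced z + reduced z'.
Proof.
have e1 : (c *: z + z').1 = c *: z.1 + z'.1 by [].
have e2 : (c *: z + z').2 = c *: z.2 + z'.2 by [].
rewrite /reduced e1 e2 wave_functional_lin.
by rewrite [in RHS]scalerDr addrACA.
Qed.

Let hevol z := evolves_exists al be0 z.2 (@input_cont (reduced z)).

(** The delay solution is picked by choice; [wave_path_unique] shows that for [t >= 0] the states do
    not depend on it. *)
Definition wave_path z t : wave_state := snapshot (sval (cid (hevol z))).1 (sval (cid (hevol z))).2 t.

Lemma wave_pathE z : exists psi a,
  evolves al be (input (reduced z)) z.2 psi a /\ wave_path z = snapshot psi a.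
Proof.
by exists (sval (cid (hevol z))).1, (sval (cid (hevol z))).2; split=> //;
  exact: (svalP (cid (hevol z))).
Qed.

Lemma wave_path_unique z psi a t : 0 <= t ->
  evolves al be (input (reduced z)) z.2 psi a -> wave_path z t = snapshot psi a t.
Proof.
move=> t0 h; have [psi' [a' [h' ->]]] := wave_pathE z.
exact: (evolves_unique al0 be0 (@input_cont (reduced z)) t0 h' h).
Qed.

Definition closed_flow t z : state :=
  (flow F (reduced z) t - Lam (wave_path z t), wave_path z t).

Lemma reduced_flow t z : reduced (closed_flow t z) = flow F (reduced z) t.
Proof. exact: subrK. Qed.

Lemma wave_path0 z : wave_path z 0 = z.2.
Proof. by have [psi [a [h ->]]] := wave_pathE z; exact: (snapshot0 h). Qed.

Lemma closed_flow0 z : closed_flow 0 z = z.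
Proof. by rewrite /closed_flow wave_path0 flow0 addrK; case: z. Qed.

Lemma wave_path_lin t c z z' : 0 <= t ->
  wave_path (c *: z + z') t = c *: wave_path z t + wave_path z' t.
Proof.
move=> t0; have [psi [a [h ->]]] := wave_pathE z; have [psi' [a' [h' ->]]] := wave_pathE z'.
have [[hp _ _ _] _ _] := h; have [[hp' _ _ _] _ _] := h'.
rewrite -snapshot_lin//; apply: wave_path_unique => //.
have hl := evolves_lin c (@input_cont (reduced z)) (@input_cont (reduced z')) h h'.
apply: evolves_eq hl => s _; by rewrite reduced_lin input_lin.
Qed.

Let pair_lin_sub c v l v' l' W W' :
  (c *: v + v' - (c *: l + l'), c *: W + W') = c *: ((v - l, W) : state) + (v' - l', W').
Proof.
by rewrite -[RHS]/(c *: (v - l) + (v' - l'), c *: W + W') scalerBr addrACA -opprD.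
Qed.

Lemma closed_flow_lin t c z z' : 0 <= t ->
  closed_flow t (c *: z + z') = c *: closed_flow t z + closed_flow t z'.
Proof.
move=> t0; rewrite /closed_flow wave_path_lin// reduced_lin flow_lin wave_functional_lin.
exact: pair_lin_sub.
Qed.

(** After a restart at time [t] the reduced state has moved along the flow, so the new input is the
    old one shifted by [t], and uniqueness identifies the waves. *)
Lemma closed_flow_add s t z : 0 <= s -> 0 <= t ->
  closed_flow (s + t) z = closed_flow s (closed_flow t z).
Proof.
move=> s0 t0; rewrite {1 2}/closed_flow reduced_flow -flow_add//.
suff -> : wave_path (closed_flow t z) s = wave_path z (s + t) by [].
have [psi [a [h e]]] := wave_pathE z.
have h1 := evolves_shift (@input_cont (reduced z)) t0 h.
have e2 : (closed_flow t z).2 = snapshot psi a t by rewrite -e.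
rewrite -e2 in h1.
have h2 : evolves al be (input (reduced (closed_flow t z))) (closed_flow t z).2
    (fun s => psi (s + t)) (fun s => a (s + t)).
  by apply: evolves_eq h1 => r r0; rewrite reduced_flow /input -flow_add.
rewrite (wave_path_unique s0 h2) e /snapshot.
by apply: dec_eq => [x|]; rewrite ?addrA.
Qed.

Lemma state_norm_sqr z : state_norm al z ^+ 2 = ssq z.1 + wave_norm al z.2 ^+ 2.
Proof. by rewrite sqr_sqrtr// addr_ge0 ?ssq_ge0 ?sqr_ge0. Qed.

Lemma ssqD v v' : ssq (v + v') <= 2 * ssq v + 2 * ssq v'.
Proof.
rewrite /ssq !mulr_sumr -big_split; apply: ler_sum => i _ /=; rewrite mxE.
have := sqr_ge0 (v i 0 - v' i 0); lra.
Qed.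

Lemma ssqN v : ssq (- v) = ssq v.
Proof. by rewrite /ssq; apply: eq_bigr => i _; rewrite mxE sqrrN. Qed.

Lemma ssq_functional : exists2 D : R, 0 <= D & forall W, ssq (Lam W) <= D * wave_norm al W ^+ 2.
Proof.
have [C [C0 hC]] := wave_functional_bounded A B1 B2 B3 B4 be al0.
exists (C *+ n); first exact: mulrn_wge0.
move=> W; apply: (@le_trans _ _ (\sum_(i < n) C * wave_norm al W ^+ 2)).
  by apply: ler_sum => i _; exact: hC.
by rewrite sumr_const card_ord mulrnAl.
Qed.

Lemma input_bound : exists2 C : R, 0 <= C &
  forall v t, input v t ^+ 2 <= C * ssq (flow F v t).
Proof.
exists ((\sum_i `|K i 0|) ^+ 2); first exact: sqr_ge0.
move=> v t; rewrite -[X in _ * X]sqr_sqrtr ?ssq_ge0// -exprMn -[leLHS]real_normK ?num_real//.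
rewrite lerXn2r ?nnegrE ?normr_ge0 ?mulr_ge0 ?sqrtr_ge0 ?sumr_ge0//.
rewrite /input mxE mulr_suml; apply: (le_trans (ler_norm_sum _ _ _)).
apply: ler_sum => i _; rewrite normrM mxE ler_wpM2l// -sqrtr_sqr ler_wsqrtr//.
exact: ssq_ge.
Qed.

Lemma closed_flow_decay : exists M w : R, [/\ 0 < M, 0 < w & forall z t, 0 <= t ->
  state_norm al (closed_flow t z) ^+ 2 <= M * expR (- (w * t)) * state_norm al z ^+ 2].
Proof.
have [D D0 hD] := ssq_functional; have [C C0 hC] := input_bound.
have [M1 [w1 [M10 w10 h1]]] := ode_decay hF.
have [M2 [w2 [M20 w20 h2]]] := energy_decay al0 be0 w10.
have hfl v t : 0 <= t -> ssq (flow F v t) <= M1 * expR (- (w1 * t)) * ssq v.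
  by move=> t0; have := h1 _ (flow_derive F v) t t0; rewrite flow0 mulNr.
(* The factor [2 + 2 * D] passes from the state to its reduced state and [C * M1] from there to the
   squared input; the energy enters as half the squared wave norm, whence the 2. *)
pose P := M2 * (1 + 2 * C * M1 * (2 + 2 * D)).
have P0 : 0 < P.
  by rewrite mulr_gt0// ltr_wpDr// !mulr_ge0// ?addr_ge0 ?mulr_ge0// ltW.
(* From X = Y - Lam: [|X|^2] is at most twice [|Y|^2] plus [2 * D] times the squared wave norm,
   which is counted once more for itself. *)
exists (2 * M1 * (2 + 2 * D) + (1 + 2 * D) * P), (Num.min w1 w2); split.
- by rewrite addr_gt0// mulr_gt0// ?mulr_gt0//; lra.
- by rewrite lt_min w10.
move=> z t t0; rewrite !state_norm_sqr.
have [X0 [X0E X00]] : exists X0, X0 = ssq z.1 /\ 0 <= X0 by exists (ssq z.1); rewrite ssq_ge0.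
have [N0 [N0E N00]] : exists N0, N0 = wave_norm al z.2 ^+ 2 /\ 0 <= N0.
  by exists (wave_norm al z.2 ^+ 2); rewrite sqr_ge0.
have hv : ssq (reduced z) <= (2 + 2 * D) * (X0 + N0).
  have := ssqD z.1 (Lam z.2); have := hD z.2; rewrite -X0E -N0E /reduced => k1 k2.
  apply: (le_trans k2); have := mulr_ge0 D0 X00; lra.
have v0 := ssq_ge0 (reduced z).
have hw : wave_norm al (wave_path z t) ^+ 2 <= P * expR (- (w2 * t)) * (X0 + N0).
  have [psi [a [h e]]] := wave_pathE z; have [hs _ _] := h; have [hp _ _ _] := hs.
  have k0 : 0 <= C * M1 * ssq (reduced z) by rewrite !mulr_ge0// ltW.
  have hu s : 0 <= s -> input (reduced z) s ^+ 2 <= C * M1 * ssq (reduced z) * expR (- (w1 * s)).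
    move=> s0; apply: (le_trans (hC _ s)).
    by rewrite -!mulrA ler_wpM2l// [ssq _ * _]mulrC mulrA; exact: hfl.
  have hen := h2 _ _ _ _ (@input_cont (reduced z)) hs k0 hu t t0.
  have e0 : N0 = 2 * energy al psi a 0 by rewrite N0E -wave_path0 e snapshot_energy.
  have k1 : C * M1 * ssq (reduced z) <= C * M1 * ((2 + 2 * D) * (X0 + N0)).
    by rewrite ler_wpM2l// mulr_ge0// ltW.
  rewrite e snapshot_energy//.
  have x0 := expR_gt0 (- (w2 * t)).
  have mx0 : 0 < M2 * expR (- (w2 * t)) by rewrite mulr_gt0.
  apply: (@le_trans _ _ (2 * (M2 * expR (- (w2 * t)) * (energy al psi a 0 +  C * M1 * ((2 + 2 * D) * (X0 + N0)))))).
    rewrite ler_pM2l//; apply: (le_trans hen).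
    by rewrite ler_pM2l// lerD2l.
  rewrite [leRHS](_ : _ = M2 * expR (- (w2 * t)) * ((1 + 2 * C * M1 * (2 + 2 * D)) * (X0 + N0))); last by rewrite /P; ring.
  rewrite mulrCA ler_pM2l// mulrDr -e0.
  by rewrite [leRHS]mulrDl mul1r !mulrA lerD// lerDr.
have hS : 0 <= X0 + N0 by rewrite addr_ge0.
have mint s : s = w1 \/ s = w2 -> expR (- (s * t)) <= expR (- (Num.min w1 w2 * t)).
  by move=> hs; rewrite ler_expR lerN2 ler_wpM2r// ge_min; case: hs => ->; rewrite lexx ?orbT.
have k1 : ssq (closed_flow t z).1 <= 2 * ssq (flow F (reduced z) t) + 2 * (D * wave_norm al (wave_path z t) ^+ 2).
  apply: (le_trans (ssqD _ _)); rewrite ssqN lerD2l ler_pM2l//; exact: hD.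
have k2 : ssq (flow F (reduced z) t) <= M1 * (2 + 2 * D) * (expR (- (Num.min w1 w2 * t)) * (X0 + N0)).
  apply: (le_trans (hfl _ _ t0)).
  rewrite -!mulrA ler_pM2l// mulrCA ler_pM ?expR_ge0//; exact: mint (or_introl erefl).
have k3 : wave_norm al (wave_path z t) ^+ 2 <= P * (expR (- (Num.min w1 w2 * t)) * (X0 + N0)).
  apply: (le_trans hw); rewrite -mulrA ler_pM2l// ler_wpM2r//; exact: mint (or_intror erefl).
have k4 := ler_wpM2l D0 k3.
rewrite -X0E -N0E -mulrA; move: k1 k2 k3 k4.
move: (expR _ * _) (wave_norm al (wave_path z t) ^+ 2) (ssq (flow _ _ _)) (ssq (closed_flow t z).1) => E W1 S S1 k1 k2 k3 k4.
rewrite /closed_flow /=; lra.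
Qed.

Local Notation T := closed_flow.

Lemma cvg0_le (f g : R -> R) : (forall t, `|f t| <= g t) ->
  g t @[t --> (0:R)^'+] --> (0:R) -> f t @[t --> (0:R)^'+] --> (0:R).
Proof.
move=> fg hg; apply/norm_cvg0P; apply: (@squeeze_cvgr _ _ _ _ (fun=> 0) _ _ _ _ _ hg).
  by apply: nearW => t; rewrite normr_ge0 fg.
exact: cvg_cst.
Qed.

Lemma cvg0_sqr (f : R -> R) :
  f t @[t --> (0:R)^'+] --> (0:R) -> f t ^+ 2 @[t --> (0:R)^'+] --> (0:R).
Proof. by move=> h; have := cvgM h h; rewrite mulr0; exact. Qed.

Lemma state_norm_cvg0 (g : R -> state) :
  state_norm al (g t) @[t --> (0:R)^'+] --> (0:R) <->
  wave_norm al (g t).2 @[t --> (0:R)^'+] --> (0:R) /\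
  forall i, (g t).1 i 0 @[t --> (0:R)^'+] --> (0:R).
Proof.
have sq (x y : R) : 0 <= y -> x ^+ 2 <= y ^+ 2 -> `|x| <= y.
  by move=> y0 xy; rewrite -[leRHS]ger0_norm// -ler_sqr ?nnegrE// !real_normK ?num_real.
split=> [h|[hw hX]].
  split=> [|i]; apply: cvg0_le h => t; apply: sq; rewrite ?sqrtr_ge0// state_norm_sqr.
    by rewrite lerDr ssq_ge0.
  by apply: (le_trans (ssq_ge _ i)); rewrite lerDl sqr_ge0.
have h2 : (fun t => \sum_i (g t).1 i 0 ^+ 2 + wave_norm al (g t).2 ^+ 2) t
    @[t --> (0:R)^'+] --> (0:R).
  rewrite -[X in _ --> X]addr0; apply: cvgD.
    elim: (index_enum _) => [|i s ih].
      by under eq_fun do rewrite big_nil; exact: cvg_cst.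
    under eq_fun do rewrite big_cons.
    have := cvgD (cvg0_sqr (hX i)) ih; rewrite addr0; exact.
  exact: cvg0_sqr.
have := continuous_cvg _ (@sqrt_continuous R _) h2; rewrite sqrtr0; exact.
Qed.

Lemma functional_cvg0 (g : R -> wave_state) i :
  wave_norm al (g t) @[t --> (0:R)^'+] --> (0:R) ->
  Lam (g t) i 0 @[t --> (0:R)^'+] --> (0:R).
Proof.
move=> h; have [C [C0 hC]] := wave_functional_bounded A B1 B2 B3 B4 be al0.
apply: (@cvg0_le _ (fun t => Num.sqrt C * wave_norm al (g t))); last first.
  by rewrite -[X in _ --> X](mulr0 (Num.sqrt C)); apply: cvgM h; exact: cvg_cst.
move=> t; rewrite -sqrtr_sqr -[wave_norm al _]ger0_norm ?sqrtr_ge0// -sqrtr_sqr -sqrtrM//.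
exact: ler_wsqrtr.
Qed.

Lemma functionalB W W' : Lam (W - W') = Lam W - Lam W'.
Proof. by rewrite addrC -scaleN1r wave_functional_lin scaleN1r addrC. Qed.

Lemma functionalZ c W : Lam (c *: W) = c *: Lam W.
Proof.
have z0 : Lam 0 = 0 by rewrite -(subrr (0 : wave_state)) functionalB subrr.
by have := wave_functional_lin A B1 B2 B3 B4 al be c W 0; rewrite z0 !addr0.
Qed.

Lemma flow_quotient_cvg v i : t^-1 * (flow F v t - v) i 0 @[t --> (0:R)^'+] --> (F *m v) i 0.
Proof.
have [hd hv] := flow_derive F v 0 i; rewrite flow0 in hv.
have h : (fun h : R => h^-1 *: ((fun t => flow F v t i 0) (h *: 1 + 0) - flow F v 0 i 0)) t @[t --> (0:R)^'] --> (F *m v) i 0.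
  by rewrite -hv; exact: hd.
apply: cvg_trans; last exact: (cvg_dnbhs_at_right h).
apply: near_eq_cvg; apply: nearW => t /=.
by rewrite flow0 /= [_ *: 1]mulr1 addr0 colB.
Qed.

Lemma closed_flow_cont z : state_norm al (T t z - z) @[t --> (0:R)^'+] --> (0:R).
Proof.
have hw : wave_norm al (wave_path z t - z.2) @[t --> (0:R)^'+] --> (0:R).
  have [psi [a [h e]]] := wave_pathE z.
  have [hs _ _] := h; have [hp _ _ _] := hs.
  rewrite -(snapshot0 h) e.
  apply/(wave_norm_cvg0 al0 (fun t => snapshot_diff al0 a t hp)); last exact: delay_strong_cont hs.
  by move=> t; apply: ig_ge0 => x _; exact: sqr_ge0.
apply/state_norm_cvg0; split=> [//|i].
have hl := functional_cvg0 i hw.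
have e t : (T t z - z).1 i 0 = (flow F (reduced z) t i 0 - flow F (reduced z) 0 i 0) -
    Lam (wave_path z t - z.2) i 0.
  rewrite flow0 functionalB /reduced /closed_flow /=.
  move: (Lam _) (Lam _) (flow _ _ _) => l l' f; rewrite !mxE; ring.
under eq_fun do rewrite e.
have h0 : flow F (reduced z) t i 0 - flow F (reduced z) 0 i 0 @[t --> (0:R)^'+] -->
    flow F (reduced z) 0 i 0 - flow F (reduced z) 0 i 0.
  apply: cvgB; last exact: cvg_cst.
  by apply: cvg_at_right_filter; exact: (der_cont (fun t => flow_derive F (reduced z) t i)).
rewrite subrr in h0; have := cvgB h0 hl; rewrite subr0; exact.
Qed.

(** The wave component of the quotient decides [wave_graph] by itself, the input being a given
    function of time. Once it converges, so does its image under the bounded functional, and the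
    other component converges exactly when [F *m v = y.1 + Lam y.2]; [wave_functional_graph] turns
    this into the equation for X. *)
Lemma closed_flow_generator z y : gain_mx A al be \in unitmx ->
  generator (state_norm al) T z y <-> closed_loop al be A B1 B2 B3 B4 K z y.
Proof.
move=> unitM; pose v := reduced z.
pose V t := t^-1 *: (wave_path z t - z.2) - y.2.
have hV : wave_norm al (V t) @[t --> (0:R)^'+] --> (0:R) <-> wave_graph al be (input v 0) z.2 y.2.
  have [psi [a [h e]]] := wave_pathE z.
  have c1 := @input_cont v.
  have c2 := @input_cont (F *m v).
  have uE := @input_primitive v.
  by rewrite /V e; exact: (evolves_graph al0 be0 y.2 c1 c2 uE h).
have u0 : input v 0 = feedback al be A B1 B2 B3 B4 K z.
  by rewrite /input flow0 [in RHS](surjective_pairing z) feedbackE.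
have gE t i : (t^-1 *: (T t z - z) - y).1 i 0 =
    t^-1 * (flow F v t - v) i 0 - (y.1 + Lam y.2) i 0 - Lam (V t) i 0.
  rewrite /V functionalB functionalZ functionalB /v /reduced /closed_flow /=.
  move: (Lam _) (Lam _) (Lam _) (flow _ _ _) => l l' l2 f; rewrite !mxE; ring.
have Fv : F *m v = A *m z.1 + (A *m Lam z.2 + input v 0 *: L).
  rewrite mulmxDl -mulmxA /input flow0 [K^T *m v in LHS]mx11_scalar mul_mx_scalar.
  by rewrite {1}/v /reduced mulmxDr addrA.
have hg : wave_graph al be (input v 0) z.2 y.2 ->
    y.1 = A *m z.1 + z.2.1 0 *: B1 + y.2.1 0 *: B2 + z.2.1 1 *: B3 + y.2.1 1 *: B4 <->
    F *m v = y.1 + Lam y.2.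
  move=> /(wave_functional_graph B1 B2 B3 B4 unitM); rewrite Fv => <-.
  split=> [->|/esym h]; first by rewrite !addrA.
  by apply: (addIr (Lam y.2)); rewrite h !addrA.
rewrite /generator; split.
  move=> /state_norm_cvg0[/hV hw hX]; split; last by rewrite -u0.
  apply/(hg hw)/matrixP => i j; rewrite (ord1 j).
  have hl := functional_cvg0 i (iffRL hV hw).
  have h2 : t^-1 * (flow F v t - v) i 0 - (y.1 + Lam y.2) i 0 @[t --> (0:R)^'+] --> (0 : R).
    have := cvgD (hX i) hl; rewrite addr0 => h2.
    rewrite (_ : (fun t => _) = fun t => (t^-1 *: (T t z - z) - y).1 i 0 + Lam (V t) i 0).
      exact: h2.
    by apply/funext => t; rewrite gE subrK.
  have h3 : t^-1 * (flow F v t - v) i 0 - (y.1 + Lam y.2) i 0 @[t --> (0:R)^'+] -->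
      (F *m v) i 0 - (y.1 + Lam y.2) i 0.
    by apply: cvgB; [exact: flow_quotient_cvg|exact: cvg_cst].
  by apply/eqP; rewrite -subr_eq0; apply/eqP; exact: (cvg_unique _ h3 h2).
move=> [hX hw]; rewrite -u0 in hw; apply/state_norm_cvg0.
have hVw := iffRL hV hw; split; first exact: hVw.
move=> i; under eq_fun do rewrite gE.
have h0 : t^-1 * (flow F v t - v) i 0 - (y.1 + Lam y.2) i 0 @[t --> (0:R)^'+] --> (0:R).
  have -> : y.1 + Lam y.2 = F *m v by apply/esym/hg.
  rewrite -[X in _ --> X](subrr ((F *m v) i 0)).
  by apply: cvgB; [exact: flow_quotient_cvg|exact: cvg_cst].
have := cvgB h0 (functional_cvg0 i hVw); rewrite subr0; exact.
Qed.

Lemma closed_loop_stable : gain_mx A al be \in unitmx ->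
  exponentially_stable (state_norm al) (closed_loop al be A B1 B2 B3 B4 K).
Proof.
move=> unitM; have [M [w [M0 w0 hM]]] := closed_flow_decay.
(* The previous estimate concerns squared norms: the constant becomes its root and the rate is
   halved. *)
have decay z t : 0 <= t ->
    state_norm al (T t z) <= Num.sqrt M * expR (- (w / 2 * t)) * state_norm al z.
  move=> t0; have c0 : 0 <= Num.sqrt M * expR (- (w / 2 * t)) * state_norm al z.
    by rewrite !mulr_ge0 ?sqrtr_ge0 ?expR_ge0.
  rewrite -ler_sqr ?nnegrE ?sqrtr_ge0//; apply: (le_trans (hM z t t0)).
  have e : expR (- (w * t)) = expR (- (w / 2 * t)) * expR (- (w / 2 * t)).
    by rewrite -expRD; congr expR; field.
  rewrite e; have sM : M = Num.sqrt M * Num.sqrt M by rewrite -expr2 sqr_sqrtr// ltW.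
  by rewrite {1}sM le_eqVlt; apply/orP; left; apply/eqP; ring.
exists T; split.
- split.
  + move=> t t0; split; first by move=> c z z'; exact: closed_flow_lin.
    by exists (Num.sqrt M * expR (- (w / 2 * t))) => z; exact: decay.
  + exact: closed_flow0.
  + by move=> s t s0 t0 z; exact: closed_flow_add.
  + exact: closed_flow_cont.
- by move=> z y; exact: closed_flow_generator.
- by exists (Num.sqrt M), (w / 2); split; rewrite ?sqrtr_gt0 ?divr_gt0//.
Qed.

End ClosedLoop.

Theorem theorem2p2 (R : realType) (n : nat) (A : 'M[R]_n)
    (B1 B2 B3 B4 : 'cV[R]_n) (alpha beta : R) (K : 'cV[R]_n)
    (alpha_gt0 : 0 < alpha) (beta_gt0 : 0 < beta)
    (disjoint_spectra : forall l : R[i],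
       ~ (mx_spectrum A l /\ spectrum (wave_norm alpha) (A1_op alpha beta) l))
    (ctrl : controllable A
       (A *m B2 + B1 + cosh_mx A *m (A *m B4 + B3)))
    (hurwitz_K : hurwitz (A + gain_L2 alpha beta A B1 B2 B3 B4 1 *m K^T)) :
  exponentially_stable (state_norm alpha)
    (closed_loop alpha beta A B1 B2 B3 B4 K).
Proof.
exact: (closed_loop_stable alpha_gt0 beta_gt0 hurwitz_K (gain_unit disjoint_spectra)).
Qed.
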